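(* Fix a volume form-germ $\Omega$ at $0$ on $\mathbb R^r$, and let $A\in C^\infty(\mathbb R^r,\mathrm{Sym}_n)$ be symmetrically quasi-homogeneous. (1) If there exists a diffeomorphism-germ $\Phi\in\mathcal D_A$ reversing the orientation of $\mathbb R^r$, then every $B\in C^\infty(\mathbb R^r,\mathrm{Sym}_n)$ which is $\mathcal G$-equivalent to $A$ is volume-preserving equivalent to $A$. (2) Assume that every diffeomorphism-germ $\Phi\in\mathcal D_A$ preserves the orientation of $\mathbb R^r$. Then: (a) if $B\in C^\infty(\mathbb R^r,\mathrm{Sym}_n)$ is orientation-preserving equivalent to $A$, then $B$ is volume-preserving equivalent to $A$; (b) if $B\in C^\infty(\mathbb R^r,\mathrm{Sym}_n)$ is $\mathcal G$-equivalent to $A$ but is not orientation-preserving equivalent to $A$, then $B$ is volume-preserving equivalent to $\bar A$, where $\bar A(x_1,x_2,\dots,x_r)=A(-x_1,x_2,\dots,x_r)$; and $A$, $\bar A$ are not volume-preserving equivalent.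
   Context: All germs are at $0\in\mathbb R^r$ and are smooth or real-analytic (one category fixed throughout). $\mathrm{Sym}_n$ and $\mathrm{GL}_n$ are the symmetric and the invertible real $n\times n$ matrices; $C^\infty(\mathbb R^r,S)$ is the space of map-germs $(\mathbb R^r,0)\to S$ (value at $0$ arbitrary in $S$). A volume form-germ is a germ at $0$ of an $r$-form not vanishing at $0$. A diffeomorphism-germ $\Phi:(\mathbb R^r,0)\to(\mathbb R^r,0)$ is orientation-preserving (reversing) if $\det d\Phi|_0>0$ ($<0$). $A,B\in C^\infty(\mathbb R^r,\mathrm{Sym}_n)$ are $\mathcal G$-equivalent if $B=X^T(A\circ\Phi)X$ for some diffeomorphism-germ $\Phi:(\mathbb R^r,0)\to(\mathbb R^r,0)$ and some $X\in C^\infty(\mathbb R^r,\mathrm{GL}_n)$; orientation-preserving equivalent if $\Phi$ can be chosen orientation-preserving; volume-preserving equivalent if $\Phi$ can be chosen with $\Phi^*\Omega=\Omega$. $\mathcal D_A$ is the group of diffeomorphism-germs $\Phi:(\mathbb R^r,0)\to(\mathbb R^r,0)$ for which there is $X\in C^\infty(\mathbb R^r,\mathrm{GL}_n)$ with $A=X^T(A\circ\Phi)X$. Symmetrical quasi-homogeneity: $A$ is symmetrically quasi-homogeneous if there exist a coordinate system $(x_1,\dots,x_r)$ on $(\mathbb R^r,0)$ (centred at $0$), non-negative integers $\lambda_1,\dots,\lambda_r$ with $\sum_k\lambda_k>0$, non-negative integers $\delta_1,\dots,\delta_n$, and $X\in C^\infty(\mathbb R^r,\mathrm{GL}_n)$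 such that $B=X^TAX$ satisfies $$B_{ij}(t^{\lambda_1}x_1,\dots,t^{\lambda_r}x_r)=t^{\frac12(\delta_i+\delta_j)}B_{ij}(x_1,\dots,x_r)\quad\text{for all } t\in\mathbb R,\ i,j=1,\dots,n$$ (for $x$ and $(t^{\lambda_k}x_k)$ in a sufficiently small neighbourhood of $0$; $t^0=1$). When $\delta_i+\delta_j$ is odd, the condition is understood as $B_{ij}\equiv 0$. *)

(* Defs.v *)
From HB Require Import structures.
From mathcomp Require Import all_boot all_order all_algebra finmap.
From mathcomp Require Import all_classical all_reals all_analysis.
From mathcomp.analysis.showcase Require Import summability.
Set Implicit Arguments.
Unset Strict Implicit.
Unset Printing Implicit Defensive.
Import Order.TTheory GRing.Theory Num.Theory.
Import numFieldNormedType.Exports.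
Local Open Scope classical_set_scope.
Local Open Scope ring_scope.

(** Points and tangent vectors of [R^r] are row vectors ['rV[R]_r]. A germ at
    [0] is represented by a total function; every condition below only involves
    its values near [0], so it does not depend on the representative. *)

Variant category := Smooth | Analytic.

Definition iter_partial (R : realType) (r : nat) (s : seq 'I_r)
    (f : 'rV[R]_r -> R) : 'rV[R]_r -> R :=
  foldr (fun (k : 'I_r) (g : 'rV[R]_r -> R) => 'D_(delta_mx 0 k) g) f s.

(** [s] is quantified after [near], so that all the iterated partial
    derivatives exist and are continuous on one common neighbourhood of [0]. *)
Definition smooth_germ (R : realType) (r : nat) (f : 'rV[R]_r -> R) : Prop :=
  \forall x \near (0 : 'rV[R]_r), forall s : seq 'I_r,
    {for x, continuous (iter_partial s f)} /\
    forall k : 'I_r, derivable (iter_partial s f) x (delta_mx 0 k).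

Definition monomial (R : realType) (r : nat) (m : {ffun 'I_r -> nat})
    (x : 'rV[R]_r) : R :=
  \prod_(k < r) x 0 k ^+ m k.

(** Near [0], [f] is the sum of a power series in [r] variables; convergence
    along the finite sets of multi-indices is unconditional (hence absolute)
    convergence. *)
Definition analytic_germ (R : realType) (r : nat) (f : 'rV[R]_r -> R) : Prop :=
  exists c : {ffun 'I_r -> nat} -> R, \forall x \near (0 : 'rV[R]_r),
    partial_sum (fun m => c m * monomial m x) A @[A --> totally] --> f x.

Definition fun_germ (C : category) (R : realType) (r : nat)
    (f : 'rV[R]_r -> R) : Prop :=
  match C with
  | Smooth => smooth_germ f
  | Analytic => analytic_germ f
  end.

Definition mx_germ (C : category) (R : realType) (r p q : nat)
    (F : 'rV[R]_r -> 'M[R]_(p, q)) : Prop :=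
  forall i j, fun_germ C (fun x => F x i j).

Definition sym_germ (C : category) (R : realType) (r n : nat)
    (A : 'rV[R]_r -> 'M[R]_n) : Prop :=
  mx_germ C A /\ \forall x \near (0 : 'rV[R]_r), (A x)^T = A x.

Definition GL_germ (C : category) (R : realType) (r n : nat)
    (X : 'rV[R]_r -> 'M[R]_n) : Prop :=
  mx_germ C X /\ \forall x \near (0 : 'rV[R]_r), X x \in unitmx.

Definition diffeo_germ (C : category) (R : realType) (r : nat)
    (Phi : 'rV[R]_r -> 'rV[R]_r) : Prop :=
  [/\ mx_germ C Phi, Phi 0 = 0 &
      exists Psi : 'rV[R]_r -> 'rV[R]_r,
        [/\ mx_germ C Psi, Psi 0 = 0,
            \forall x \near (0 : 'rV[R]_r), Psi (Phi x) = x &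
            \forall x \near (0 : 'rV[R]_r), Phi (Psi x) = x]].

Definition orientation_preserving (R : realType) (r : nat)
    (Phi : 'rV[R]_r -> 'rV[R]_r) : Prop := 0 < \det ('J Phi 0).

Definition orientation_reversing (R : realType) (r : nat)
    (Phi : 'rV[R]_r -> 'rV[R]_r) : Prop := \det ('J Phi 0) < 0.

(** An [r]-form maps a point [x] and [r] tangent vectors at [x], given as the
    rows of a matrix, to a scalar. *)
Definition dform (R : realType) (r : nat) := 'rV[R]_r -> 'M[R]_r -> R.

Definition multilinear (R : realType) (r : nat) (w : 'M[R]_r -> R) : Prop :=
  forall (V V1 V2 : 'M[R]_r) (i : 'I_r) (a b : R),
    row i V = a *: row i V1 + b *: row i V2 ->
    row' i V1 = row' i V -> row' i V2 = row' i V ->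
    w V = a * w V1 + b * w V2.

Definition alternating (R : realType) (r : nat) (w : 'M[R]_r -> R) : Prop :=
  forall (V : 'M[R]_r) (i j : 'I_r), i != j -> row i V = row j V -> w V = 0.

Definition volume_form_germ (C : category) (R : realType) (r : nat)
    (Omega : dform R r) : Prop :=
  [/\ \forall x \near (0 : 'rV[R]_r),
        multilinear (Omega x) /\ alternating (Omega x),
      forall V : 'M[R]_r, fun_germ C (fun x => Omega x V) &
      exists V : 'M[R]_r, Omega 0 V != 0].

Definition pullback (R : realType) (r : nat) (Phi : 'rV[R]_r -> 'rV[R]_r)
    (Omega : dform R r) : dform R r :=
  fun x V => Omega (Phi x) (\matrix_(i < r) 'd Phi x (row i V)).

Definition preserves_form (R : realType) (r : nat) (Omega : dform R r)
    (Phi : 'rV[R]_r -> 'rV[R]_r) : Prop :=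
  \forall x \near (0 : 'rV[R]_r),
    forall V : 'M[R]_r, pullback Phi Omega x V = Omega x V.

(** [B = X^T (A o Phi) X] for some germ [X] with values in [GL_n]. *)
Definition equiv_via (C : category) (R : realType) (r n : nat)
    (A B : 'rV[R]_r -> 'M[R]_n) (Phi : 'rV[R]_r -> 'rV[R]_r) : Prop :=
  exists2 X : 'rV[R]_r -> 'M[R]_n, GL_germ C X &
    \forall x \near (0 : 'rV[R]_r), B x = (X x)^T *m A (Phi x) *m X x.

Definition G_equiv (C : category) (R : realType) (r n : nat)
    (A B : 'rV[R]_r -> 'M[R]_n) : Prop :=
  exists2 Phi, diffeo_germ C Phi & equiv_via C A B Phi.

Definition orientation_preserving_equiv (C : category) (R : realType)
    (r n : nat) (A B : 'rV[R]_r -> 'M[R]_n) : Prop :=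
  exists Phi, [/\ diffeo_germ C Phi, orientation_preserving Phi &
                  equiv_via C A B Phi].

Definition volume_preserving_equiv (C : category) (R : realType) (r n : nat)
    (Omega : dform R r) (A B : 'rV[R]_r -> 'M[R]_n) : Prop :=
  exists Phi, [/\ diffeo_germ C Phi, preserves_form Omega Phi &
                  equiv_via C A B Phi].

Definition symmetry_group (C : category) (R : realType) (r n : nat)
    (A : 'rV[R]_r -> 'M[R]_n) : set ('rV[R]_r -> 'rV[R]_r) :=
  [set Phi | diffeo_germ C Phi /\ equiv_via C A A Phi].

(** The coordinate system is the diffeomorphism germ [phi], with
    [x_k = phi p 0 k]. The point [q] is the one of coordinates
    [t^(lambda_k) x_k]; both [p] and [q] range over a small neighbourhood [U]
    of [0], and [t] over the whole of [R] (with [0 ^+ 0 = 1]). *)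
Definition sym_quasi_homogeneous (C : category) (R : realType) (r n : nat)
    (A : 'rV[R]_r -> 'M[R]_n) : Prop :=
  exists (phi : 'rV[R]_r -> 'rV[R]_r) (lambda : 'I_r -> nat)
         (delta : 'I_n -> nat) (X : 'rV[R]_r -> 'M[R]_n),
    let B := fun p => (X p)^T *m A p *m X p in
    [/\ diffeo_germ C phi, (0 < \sum_(k < r) lambda k)%N, GL_germ C X &
      exists2 U : set 'rV[R]_r, nbhs (0 : 'rV[R]_r) U &
        forall (i j : 'I_n),
          if odd (delta i + delta j) then forall p, U p -> B p i j = 0
          else forall (t : R) (p q : 'rV[R]_r), U p -> U q ->
            (forall k, phi q 0 k = t ^+ lambda k * phi p 0 k) ->
            B q i j = t ^+ (delta i + delta j)./2 * B p i j].

(** [bar A (x_1, x_2, ..., x_r) = A (- x_1, x_2, ..., x_r)]; indices start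
    at [0]. *)
Definition bar (R : realType) (r n : nat) (A : 'rV[R]_r -> 'M[R]_n) :
    'rV[R]_r -> 'M[R]_n :=
  fun x => A (\row_(k < r) if val k == 0%N then - x 0 k else x 0 k).

(* Main.v *)
Require Import Defs.
From HB Require Import structures.
From mathcomp Require Import all_boot all_order all_algebra finmap.
From mathcomp Require Import all_classical all_reals all_analysis.
From mathcomp.analysis.showcase Require Import summability.
From mathcomp Require Import perm ring lra.
Set Implicit Arguments.
Unset Strict Implicit.
Unset Printing Implicit Defensive.
Import Order.TTheory GRing.Theory Num.Theory.
Import numFieldNormedType.Exports.
Local Open Scope classical_set_scope.
Local Open Scope ring_scope.

(* After a change of coordinates and of frame, [A] is a matrix [Q] of quasi-homogeneous
   functions, and [Q] is equivalent to itself through every map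
   [Psi_v : x |-> (v(x)^(mu_k) x_k)_k] with [v] a positive germ. With
   [N = \sum_k mu_k > 0] and [u = v^N], the Jacobian of [Psi_v] is [u + E u / N],
   where [E = \sum_k mu_k x_k d/dx_k]; the equation [u + E u / N = w] is solved by
   [u(x) = N \int_0^1 t^(N-1) w(t . x) dt]. Hence every positive density [w] is a
   Jacobian of a symmetry of [Q], so any two volume forms defining the same
   orientation are exchanged by a symmetry of [A]. What is left of the
   classification is the sign of the Jacobian at [0]. *)

(** * Functions of class [C^k] *)

(** The Jacobian matrix of [Psi_v] is a rank-one perturbation of the identity times a diagonal
    matrix, so its determinant is [v^N (1 + E v / v)]: nonlinear in [v], but linear in [u = v^N].
    Some weights may be zero, so [t . x] need not tend to [0] with [t]; the boundary term
    [t^N w(t . x)] still vanishes at [t = 0] because [N > 0]. As [E] vanishes at [0],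
    [u(0) = w(0) > 0], and the [N]-th root of [u] exists.

    The obstacle is regularity: every quotient, root and inverse map that is produced must be
    smooth, respectively analytic. All of them are reduced to a scalar equation [G(x, y) = y] with
    [dG/dy = 0] at [0]. It is solved once in each category, by elementary calculus for [C^k]
    functions and by iteration in a Banach algebra for power series. Together with the closure rules
    and the Euler integral this forms an interface on which the rest of the argument is uniform.

    A volume form enters through its density, its value on the standard basis, which pullback
    composes with the map and multiplies by the Jacobian. *)

(** The norm is the maximum of the entries, so balls are cubes and estimates are made coordinate by
    coordinate. The sign condition covers [r = 0], where the left side is vacuous. *)
Lemma rV_norm_le (R : realType) r (x : 'rV[R]_r) e : 0 <= e ->
  (forall k, `|x 0 k| <= e) <-> `|x| <= e.
Proof.
move=> e0; rewrite [in X in _ <-> X]/Num.Def.normr /= mx_normrE; split=> [xe|].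
  by apply/bigmax_leP; split => // -[i k] _ /=; rewrite ord1.
by move/bigmax_leP => [_ xe] k; exact: (xe (0, k)).
Qed.

Lemma rV_norm_lt (R : realType) r (x : 'rV[R]_r) e : 0 < e ->
  (forall k, `|x 0 k| < e) <-> `|x| < e.
Proof.
move=> e0; rewrite [in X in _ <-> X]/Num.Def.normr /= mx_normrE; split=> [xe|].
  by apply/bigmax_ltP; split => // -[i k] _ /=; rewrite ord1.
by move/bigmax_ltP => [_ xe] k; exact: (xe (0, k)).
Qed.

Lemma rV_coord_le (R : realType) r (x : 'rV[R]_r) k : `|x 0 k| <= `|x|.
Proof. by move: k; apply/rV_norm_le. Qed.

Lemma norm_delta_mx (R : realType) r (k : 'I_r) :
  `|delta_mx 0 k : 'rV[R]_r| <= 1.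
Proof.
apply/rV_norm_le => // j; rewrite mxE eqxx /=.
by case: (j == k); rewrite ?normr1 ?normr0.
Qed.

Lemma near0_cubeP (R : realType) r (P : 'rV[R]_r -> Prop) :
  (\forall x \near (0 : 'rV[R]_r), P x) <->
  exists2 e : R, 0 < e & forall x, `|x| < e -> P x.
Proof.
split=> [/nbhs_normP[e /= e0 eP]|[e e0 eP]].
  by exists e => // x xe; apply: eP; rewrite /= sub0r normrN.
apply/nbhs_normP; exists e => //= x /=; rewrite sub0r normrN; exact: eP.
Qed.

Lemma is_derive_line (R : realType) r (f : 'rV[R]_r -> R) (x v : 'rV[R]_r) (s : R) :
  derivable f (x + s *: v) v ->
  is_derive s 1 (fun t : R => f (x + t *: v)) ('D_v f (x + s *: v)).
Proof.
move=> df.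
have E : (fun h : R => h^-1 *: (f ((h *: 1 + s) *: v + x) - f (s *: v + x))) =
         (fun h : R => h^-1 *: (f (h *: v + (x + s *: v)) - f (x + s *: v))).
  apply/funext => h; congr (_ *: (f _ - f _)); last by rewrite addrC.
  by rewrite [h *: 1]mulr1 scalerDl addrCA addrAC addrA (addrC x).
have F : (fun t : R => f (x + t *: v)) = (fun t : R => f (t *: v + x)).
  by apply/funext => t; rewrite addrC.
rewrite F; apply: DeriveDef.
  by rewrite /derivable /= E.
by rewrite /derive /= E.
Qed.

(** The bound [|s| <= |t|], in place of an interval, covers both signs of [t]. *)
Lemma MVT_line (R : realType) r (f : 'rV[R]_r -> R) (x v : 'rV[R]_r) (t : R) :
  (forall s : R, `|s| <= `|t| -> derivable f (x + s *: v) v) ->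
  exists2 s : R, `|s| <= `|t| & f (x + t *: v) - f x = t * 'D_v f (x + s *: v).
Proof.
move=> df; pose g (s : R) := f (x + s *: v).
have dg (s : R) : `|s| <= `|t| -> is_derive s 1 g ('D_v f (x + s *: v)).
  by move=> /df; exact: is_derive_line.
have gE : f (x + t *: v) - f x = g t - g 0 by rewrite /g scale0r addr0.
have cg (a b : R) : (forall s : R, s \in `[a, b]%R -> `|s| <= `|t|) ->
    {within `[a, b], continuous g}.
  move=> ab; apply: derivable_within_continuous => s /ab /dg [] //.
have [t0|t0] := leP 0 t.
  have tn (s : R) : s \in `[0, t]%R -> `|s| <= `|t|.
    by rewrite in_itv /= => /andP[s0 st]; rewrite !ger0_norm.
  have [|s /tn st E] := @MVT_segment _ g (fun s => 'D_v f (x + s *: v)) _ _ t0 _ (cg _ _ tn).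
    by move=> s /subset_itv_oo_cc /tn; exact: dg.
  by exists s => //; rewrite gE E subr0 mulrC.
have tn (s : R) : s \in `[t, 0]%R -> `|s| <= `|t|.
  rewrite in_itv /= => /andP[s0 st].
  by rewrite (ler0_norm st) (ltr0_norm t0) lerN2.
have [|s /tn st E] := @MVT_segment _ g (fun s => 'D_v f (x + s *: v)) _ _ (ltW t0) _ (cg _ _ tn).
  by move=> s /subset_itv_oo_cc /tn; exact: dg.
exists s => //; rewrite gE -opprB E sub0r mulrN opprK mulrC //.
Qed.

(** The coordinates of [x] are moved to those of [x + h] one at a time: [p j] carries the increments
    of index below [j], so each difference is taken along a single axis. *)
Lemma rV_telescope (R : realType) r (f : 'rV[R]_r -> R) (x h : 'rV[R]_r) :
  exists p : 'I_r -> 'rV[R]_r,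
    [/\ forall j k, p j 0 k = x 0 k \/ p j 0 k = x 0 k + h 0 k,
        forall j, p j 0 j = x 0 j &
        f (x + h) - f x =
          \sum_j (f (p j + h 0 j *: delta_mx 0 j) - f (p j))].
Proof.
pose q (n : nat) : 'rV[R]_r := \row_k (if (k < n)%N then x 0 k + h 0 k else x 0 k).
exists (fun j => q j); split=> [j k|j|].
- by rewrite mxE; case: ifP; [right|left].
- by rewrite mxE ltnn.
have qS (j : 'I_r) : q j + h 0 j *: delta_mx 0 j = q j.+1.
  apply/rowP => k; rewrite !mxE eqxx /= ltnS.
  have [->|kj] := eqVneq k j; first by rewrite leqnn ltnn mulr1.
  by rewrite mulr0 addr0 [in RHS]leq_eqVlt (inj_eq val_inj) (negbTE kj).
under eq_bigr do rewrite qS.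
rewrite -(big_mkord xpredT (fun j => f (q j.+1) - f (q j))) telescope_sumr //.
by congr (f _ - f _); apply/rowP => k; rewrite !mxE ?ltn_ord.
Qed.

(** The mean value theorem is applied on each edge of the telescoping path. In the maximum norm this
    path stays within [|h|] of [x], so control of the partial derivatives on a cube suffices. *)
Lemma mean_value_rV (R : realType) r (f : 'rV[R]_r -> R) (x h : 'rV[R]_r) :
  (forall y j, `|y - x| <= `|h| -> derivable f y (delta_mx 0 j)) ->
  exists2 xi : 'I_r -> 'rV[R]_r, (forall j, `|xi j - x| <= `|h|) &
    f (x + h) - f x = \sum_j h 0 j * 'D_(delta_mx 0 j) f (xi j).
Proof.
move=> df; have [p [ph pj ->]] := rV_telescope f x h.
have seg j (s : R) : `|s| <= `|h 0 j| ->
    `|p j + s *: delta_mx 0 j - x| <= `|h|.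
  move=> sh; apply/rV_norm_le => // k; rewrite !mxE eqxx /=.
  have [->|kj] := eqVneq k j.
    by rewrite mulr1 pj addrAC subrr add0r (le_trans sh) // rV_coord_le.
  rewrite mulr0 addr0; case: (ph j k) => ->; first by rewrite subrr normr0.
  by rewrite addrAC subrr add0r rV_coord_le.
have step (j : 'I_r) : exists y : 'rV[R]_r, `|y - x| <= `|h| /\
    f (p j + h 0 j *: delta_mx 0 j) - f (p j) = h 0 j * 'D_(delta_mx 0 j) f y.
  have [s /seg hs|s sh E] := @MVT_line _ _ f (p j) (delta_mx 0 j) (h 0 j).
    exact: df.
  by exists (p j + s *: delta_mx 0 j); split=> //; exact: seg.
have [xi xiP] := choice step.
by exists xi => [j|]; [have [] := xiP j|apply: eq_bigr => j _; have [] := xiP j].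
Qed.

(** Recursion on partial derivatives over one fixed set [U]: the closure properties become
    inductions on [n], and smoothness is [Ck n U] for every [n] with the same [U]. *)
Fixpoint Ck (R : realType) r n (U : set 'rV[R]_r) (f : 'rV[R]_r -> R) : Prop :=
  (forall x, U x -> {for x, continuous f}) /\
  if n is m.+1 then forall k : 'I_r,
    (forall x, U x -> derivable f x (delta_mx 0 k)) /\
    Ck m U ('D_(delta_mx 0 k) f)
  else True.

Lemma Ck_cont (R : realType) r n (U : set 'rV[R]_r) f x :
  Ck n U f -> U x -> {for x, continuous f}.
Proof. by case: n => [|n] [fc _] Ux; exact: fc. Qed.

Lemma CkS (R : realType) r n (U : set 'rV[R]_r) f : Ck n.+1 U f -> Ck n U f.
Proof.
elim: n f => [|n IH] f [fc fd]; split=> // k; have [dk Dk] := fd k.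
by split=> //; apply: IH.
Qed.

Lemma Ck0 (R : realType) r n (U : set 'rV[R]_r) f : Ck n U f -> Ck 0 U f.
Proof. by elim: n => // n IH /CkS. Qed.

Lemma Ck_sub (R : realType) r n (U V : set 'rV[R]_r) f :
  V `<=` U -> Ck n U f -> Ck n V f.
Proof.
move=> VU; elim: n f => [|n IH] f [fc fd]; split=> //.
- by move=> x /VU; exact: fc.
- by move=> x /VU; exact: fc.
by move=> k; have [dk Dk] := fd k; split=> [x /VU|]; [exact: dk|exact: IH].
Qed.

Lemma open_near (T : topologicalType) (U : set T) (P : T -> Prop) x :
  open U -> U x -> (forall y, U y -> P y) -> \forall y \near x, P y.
Proof. by move=> oU Ux UP; apply: filterS (open_nbhs_nbhs (conj oU Ux)). Qed.

Lemma Ck_ext (R : realType) r n (U : set 'rV[R]_r) f g : open U ->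
  (forall x, U x -> f x = g x) -> Ck n U f -> Ck n U g.
Proof.
move=> oU; elim: n f g => [|n IH] f g fg [fc fd]; split=> //.
- move=> x Ux; rewrite /prop_for /continuous_at -fg //.
  have fgx : {near x, f =1 g} by exact: (open_near oU Ux fg).
  exact: cvg_trans (near_eq_cvg fgx) (fc x Ux).
- move=> x Ux; rewrite /prop_for /continuous_at -fg //.
  have fgx : {near x, f =1 g} by exact: (open_near oU Ux fg).
  exact: cvg_trans (near_eq_cvg fgx) (fc x Ux).
move=> k; have [dk Dk] := fd k; split=> [x Ux|].
  by apply: near_eq_derivable (dk x Ux); exact: (open_near oU Ux fg).
apply: IH Dk => x Ux; apply: near_eq_derive; exact: (open_near oU Ux fg).
Qed.

Lemma Ck_cst (R : realType) r n (U : set 'rV[R]_r) (a : R) :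
  Ck n U (fun=> a).
Proof.
elim: n a => [|n IH] a; split=> //; try by move=> x _; exact: cst_continuous.
move=> k; split=> [x _|]; first exact: derivable_cst.
suff -> : 'D_(delta_mx 0 k) (fun=> a) = (fun=> 0) :> ('rV[R]_r -> R) by exact: IH.
by apply/funext => x; rewrite derive_cst.
Qed.

Lemma CkD (R : realType) r n (U : set 'rV[R]_r) f g : open U ->
  Ck n U f -> Ck n U g -> Ck n U (fun x => f x + g x).
Proof.
move=> oU; elim: n f g => [|n IH] f g [fc fd] [gc gd]; split=> //.
- by move=> x Ux; exact: (continuousD (fc x Ux) (gc x Ux)).
- by move=> x Ux; exact: (continuousD (fc x Ux) (gc x Ux)).
move=> k; have [dfk Dfk] := fd k; have [dgk Dgk] := gd k.
split=> [x Ux|]; first by apply: derivableD; [exact: dfk|exact: dgk].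
apply: Ck_ext (IH _ _ Dfk Dgk) => // x Ux.
by rewrite deriveD; [|exact: dfk|exact: dgk].
Qed.

Lemma CkM (R : realType) r n (U : set 'rV[R]_r) f g : open U ->
  Ck n U f -> Ck n U g -> Ck n U (fun x => f x * g x).
Proof.
move=> oU; elim: n f g => [|n IH] f g Ff Fg; have [fc fd] := Ff;
  have [gc gd] := Fg; split=> //.
- by move=> x Ux; exact: (continuousM (fc x Ux) (gc x Ux)).
- by move=> x Ux; exact: (continuousM (fc x Ux) (gc x Ux)).
move=> k; have [dfk Dfk] := fd k; have [dgk Dgk] := gd k.
split=> [x Ux|]; first by apply: derivableM; [exact: dfk|exact: dgk].
apply: Ck_ext (CkD oU (IH _ _ (CkS Ff) Dgk) (IH _ _ (CkS Fg) Dfk)) => // x Ux.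
by rewrite deriveM; [|exact: dfk|exact: dgk].
Qed.

Lemma Ck_sum (R : realType) r n (U : set 'rV[R]_r) (I : Type) (s : seq I) F :
  open U -> (forall i, Ck n U (F i)) ->
  Ck n U (fun x => \sum_(i <- s) F i x).
Proof.
move=> oU FC; elim: s => [|i s IH].
  by apply: Ck_ext (Ck_cst _ _ 0) => // x _; rewrite big_nil.
by apply: Ck_ext (CkD oU (FC i) IH) => // x _; rewrite big_cons.
Qed.

Lemma derive_coord (R : realType) r (k : 'I_r) (x v : 'rV[R]_r) :
  is_derive x v (fun y : 'rV[R]_r => y 0 k) (v 0 k).
Proof.
have E : (fun h : R => h^-1 *: ((h *: v + x) 0 k - x 0 k)) @ 0^' --> v 0 k.
  apply: cvg_near_cst; near=> h.
  have h0 : h != 0 by near: h; exact: nbhs_dnbhs_neq.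
  by rewrite !mxE addrK [_ *: _]mulrA mulVf ?mul1r.
apply: DeriveDef; first by apply/cvg_ex; exists (v 0 k).
by apply/cvg_lim.
Unshelve. all: by end_near. Qed.

Lemma Ck_coord (R : realType) r n (U : set 'rV[R]_r) (k : 'I_r) :
  Ck n U (fun x => x 0 k).
Proof.
case: n => [|n]; split=> //; try by move=> x _; exact: coord_continuous.
move=> j; split=> [x _|]; first by have [] := derive_coord k x (delta_mx 0 j).
suff -> : 'D_(delta_mx 0 j) (fun x : 'rV[R]_r => x 0 k) =
  (fun=> delta_mx (0 : 'I_1) j 0 k) by exact: Ck_cst.
by apply/funext => x; have [_ ->] := derive_coord k x (delta_mx 0 j).
Qed.

Lemma CkV (R : realType) r n (U : set 'rV[R]_r) (f : 'rV[R]_r -> R) : open U ->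
  (forall x, U x -> f x != 0) -> Ck n U f -> Ck n U (fun x => (f x)^-1).
Proof.
move=> oU f0; elim: n f f0 => [|n IH] f f0 Ff; have [fc fd] := Ff; split=> //.
- by move=> x Ux; exact: (continuousV (f0 x Ux) (fc x Ux)).
- by move=> x Ux; exact: (continuousV (f0 x Ux) (fc x Ux)).
move=> k; have [dfk Dfk] := fd k; split=> [x Ux|].
  by apply: derivableV; [exact: f0|exact: dfk].
have FV := IH _ f0 (CkS Ff).
apply: Ck_ext (CkM oU (Ck_cst n U (-1)) (CkM oU (CkM oU FV FV) Dfk)) => // x Ux.
rewrite deriveV; [|exact: f0|exact: dfk].
by rewrite mulN1r expr2 invfM [in RHS]scaleNr.
Qed.

Lemma differentiable_linear_approx (R : realType) (V W : normedModType R)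
    (f : V -> W) (df : {linear V -> W}) x : continuous df ->
  (forall e : R, 0 < e ->
    \forall h \near (0 : V), `|f (h + x) - (f x + df h)| <= e * `|h|) ->
  differentiable f x.
Proof.
move=> dfc dfe; have E : f \o shift x = cst (f x) + df +o_ 0 id.
  by apply/eqaddoP => e e0; exact: dfe.
by apply/diff_locallyP; rewrite (diff_unique dfc E).
Qed.

(** The mean value formula uses partial derivatives at points close to [x]; by continuity they may
    be replaced by those at [x], with an error small against [|h|]. *)
Lemma differentiable_partials (R : realType) r (U : set 'rV[R]_r) f x :
  open U -> Ck 1 U f -> U x -> differentiable f x.
Proof.
move=> oU [_ fd] Ux.
pose df (h : 'rV[R]_r) : R := \sum_j h 0 j * 'D_(delta_mx 0 j) f x.
have dfl : linear df.
  move=> a u v; rewrite /df scaler_sumr -big_split /=; apply: eq_bigr => j _.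
  by rewrite !mxE mulrDl -mulrA.
pose dfL : {linear 'rV[R]_r -> R} :=
  HB.pack df (GRing.isLinear.Build _ _ _ _ df dfl).
have dfc : continuous dfL.
  move=> y; apply: (@Ck_cont _ _ 0 setT df) => //; apply: Ck_sum => [|j].
    exact: openT.
  by apply: CkM; [exact: openT|exact: Ck_coord|exact: Ck_cst].
apply: (differentiable_linear_approx dfc) => e e0.
(* There are [r] error terms to share [e]; [r.+1] keeps the tolerance positive when [r = 0]. *)
have e'0 : 0 < e / (r.+1)%:R by rewrite divr_gt0.
have : \forall y \near x, U y /\ forall j : 'I_r,
    `|'D_(delta_mx 0 j) f x - 'D_(delta_mx 0 j) f y| <= e / (r.+1)%:R.
  apply: filterI; first exact: open_nbhs_nbhs.
  have H (j : 'I_r) : \forall y \near x,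
      `|'D_(delta_mx 0 j) f x - 'D_(delta_mx 0 j) f y| <= e / (r.+1)%:R.
    have [_ [Dc _]] := fd j.
    by have /cvgrPdist_le/(_ _ e'0) := Dc x Ux.
  exact: filter_forall H.
move=> /nbhs_normP[d /= d0 dP].
apply/near0_cubeP; exists d => // h hd.
have dP' y : `|y - x| <= `|h| -> U y /\ forall j : 'I_r,
    `|'D_(delta_mx 0 j) f x - 'D_(delta_mx 0 j) f y| <= e / (r.+1)%:R.
  by move=> yh; apply: dP; rewrite /= distrC (le_lt_trans yh).
have [y j /dP'[Uy _]|xi xih E] := @mean_value_rV _ _ f x h.
  by have [dk _] := fd j; exact: dk.
rewrite opprD addrA (addrC h) E /df -sumrB.
rewrite (le_trans (ler_norm_sum _ _ _)) //.
apply: (@le_trans _ _ (\sum_(j < r) `|h| * (e / (r.+1)%:R))).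
  apply: ler_sum => j _; rewrite -mulrBr normrM ler_pM ?rV_coord_le // distrC.
  by have [_] := dP' _ (xih j); exact.
rewrite sumr_const card_ord -[_ *+ r]mulr_natr.
have -> : `|h| * (e / r.+1%:R) * r%:R = e * `|h| * (r%:R / r.+1%:R) by ring.
apply: ler_piMr; first by rewrite mulr_ge0 // ltW.
by rewrite ler_pdivrMr // mul1r ler_nat.
Qed.

(** [Phi] is restricted to the line through [x] in the direction [v]: for a curve, derivability of
    the coordinates is differentiability, and the chain rule for differentiable maps applies. *)
Lemma is_derive_comp (R : realType) q (V : normedModType R) (f : 'rV[R]_q -> R)
    (Phi : V -> 'rV[R]_q) (x v : V) :
  differentiable f (Phi x) ->
  (forall j, derivable (fun y => Phi y 0 j) x v) ->
  is_derive x v (fun y => f (Phi y))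
    (\sum_j 'D_(delta_mx 0 j) f (Phi x) * 'D_v (fun y => Phi y 0 j) x).
Proof.
move=> df dPhi.
pose g (h : R) := Phi (h *: v + x).
have dg : differentiable g 0.
  apply/derivable1_diffP/derivable_mxP => i j; rewrite ord1.
  by have /derivable1P := dPhi j.
have gE : g 0 = Phi x by rewrite /g scale0r add0r.
have dfg : differentiable (f \o g) 0.
  by apply: differentiable_comp; rewrite // gE.
have dfP : derivable (fun y => f (Phi y)) x v.
  by apply/derivable1P/derivable1_diffP.
apply: DeriveDef => //.
have -> : 'D_v (fun y => f (Phi y)) x = 'D_1 (f \o g) 0.
  rewrite /derive /=; set F := fun h => _; set G := fun h => _.
  suff -> : F = G by [].
  by apply/funext => h; rewrite /F /G /= gE /g addr0 [h *: 1]mulr1.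
rewrite deriveE // diff_comp ?gE //=.
have -> : 'd g 0 1 = \sum_j 'D_v (fun y => Phi y 0 j) x *: delta_mx 0 j.
  rewrite -deriveE // [LHS]row_sum_delta; apply: eq_bigr => j _; congr (_ *: _).
  rewrite derive_mx; last exact/derivable1_diffP.
  rewrite mxE /derive /=; set F := fun h => _; set G := fun h => _.
  suff -> : F = G by [].
  by apply/funext => h; rewrite /F /G /g /= addr0 scale0r add0r [h *: 1]mulr1.
rewrite raddf_sum /=; apply: eq_bigr => j _.
by rewrite linearZ /= (deriveE _ df) mulrC.
Qed.

Lemma continuous_rV (R : realType) q (T : topologicalType)
    (F : T -> 'rV[R]_q) x :
  (forall j, {for x, continuous (fun y => F y 0 j)}) -> {for x, continuous F}.
Proof.
move=> Fc; apply/cvgrPdist_le => /= e e0.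
have : \forall y \near x, forall j, `|F x 0 j - F y 0 j| <= e.
  by apply: filter_forall => j; have /cvgrPdist_le := Fc j; exact.
apply: filterS => y ye; apply/rV_norm_le; first exact: ltW.
by move=> j; rewrite !mxE.
Qed.

Lemma Ck_comp (R : realType) q r n (V : set 'rV[R]_q) (U : set 'rV[R]_r) f
    (Phi : 'rV[R]_r -> 'rV[R]_q) :
  open V -> open U -> (forall x, U x -> V (Phi x)) ->
  Ck n V f -> (forall j, Ck n U (fun x => Phi x 0 j)) ->
  Ck n U (fun x => f (Phi x)).
Proof.
move=> oV oU UV.
have cPhi m : (forall j, Ck m U (fun x => Phi x 0 j)) ->
    forall x, U x -> {for x, continuous Phi}.
  by move=> Pm x Ux; apply: continuous_rV => j; exact: Ck_cont (Pm j) Ux.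
elim: n f => [|n IH] f Ff FP; (split; last first) => //.
- move=> x Ux; apply: continuous_comp; first exact: (cPhi _ FP).
  exact: Ck_cont Ff (UV _ Ux).
- move=> k.
have F1 : Ck 1 V f.
  by have [fc fd] := Ff; split=> // j; have [? /Ck0] := fd j.
have D x : U x -> is_derive x (delta_mx 0 k) (fun y => f (Phi y))
    (\sum_j 'D_(delta_mx 0 j) f (Phi x) * 'D_(delta_mx 0 k) (fun y => Phi y 0 j) x).
  move=> Ux; apply: is_derive_comp.
    by apply: differentiable_partials oV F1 _; exact: UV.
  by move=> j; have [_ Pd] := FP j; have [dk _] := Pd k; exact: dk.
split=> [x /D[] //|].
pose g x := \sum_j 'D_(delta_mx 0 j) f (Phi x) *
  'D_(delta_mx 0 k) (fun y => Phi y 0 j) x.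
apply: (@Ck_ext _ _ _ _ g) => // [x /D [_ ->] //|].
apply: Ck_sum => // j; apply: CkM => //.
  by apply: (IH ('D_(delta_mx 0 j) f)) => [|i]; [have [_ fd] := Ff; have [] := fd j|exact: CkS].
by have [_ Pd] := FP j; have [_] := Pd k.
- move=> x Ux; apply: continuous_comp; first exact: (cPhi _ FP).
  exact: Ck_cont Ff (UV _ Ux).
Qed.

Lemma iter_partial_rcons (R : realType) r (s : seq 'I_r) k f :
  iter_partial (rcons s k) f = iter_partial s ('D_(delta_mx 0 k) f) :> ('rV[R]_r -> R).
Proof. by rewrite /iter_partial foldr_rcons. Qed.

Lemma Ck_iter_partial (R : realType) r (s : seq 'I_r) n (U : set 'rV[R]_r) f :
  Ck (size s + n) U f -> Ck n U (iter_partial s f).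
Proof.
elim/last_ind: s f => [|s k IH] f //.
rewrite size_rcons addSn iter_partial_rcons => -[_ /(_ k)[_]]; exact: IH.
Qed.

(** Lists grow at the head by one more derivative, so the claim for all lists [s] at once is stable
    under differentiation and an induction on [n] gives [Ck n]. Conversely, order [size s + 1]
    controls [iter_partial s f] and its first partial derivatives. *)
Lemma smooth_germP (R : realType) r (f : 'rV[R]_r -> R) :
  smooth_germ f <-> exists2 e : R, 0 < e & forall n, Ck n (ball 0 e) f.
Proof.
split=> [|[e e0 fC]].
  move=> /nbhs_ballP[e /= e0 eP]; exists e => //.
  have eP' s x : ball 0 e x -> {for x, continuous (iter_partial s f)} /\
    forall k : 'I_r, derivable (iter_partial s f) x (delta_mx 0 k).
    by move=> /eP.
  move=> n; suff H s : Ck n (ball 0 e) (iter_partial s f) by exact: (H [::]).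
  elim: n s => [|n IH] s; split=> //.
  - by move=> x /(eP' s)[].
  - by move=> x /(eP' s)[].
  move=> k; split; first by move=> x /(eP' s)[].
  exact: (IH (k :: s)).
apply: (@filterS _ _ _ (ball 0 e)); last exact: nbhsx_ballx.
move=> x ex s; have := fC (size s + 1)%N => /Ck_iter_partial [fc fd].
by split=> [|k]; [exact: fc|have [dk _] := fd k; exact: dk].
Qed.

(** * Smooth germs *)

Lemma smooth_germ_near (R : realType) r (f g : 'rV[R]_r -> R) :
  (\forall x \near (0 : 'rV[R]_r), f x = g x) -> smooth_germ f -> smooth_germ g.
Proof.
move=> /nbhs_ballP[d /= d0 fg] /smooth_germP[e e0 fC].
have m0 : 0 < Num.min d e by rewrite lt_min d0.
apply/smooth_germP; exists (Num.min d e) => // n.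
apply: (@Ck_ext _ _ _ _ f); first exact: ball_open.
  by move=> x xb; apply: fg; apply: le_ball xb; rewrite ge_min lexx.
by apply: Ck_sub (fC n) => x; apply: le_ball; rewrite ge_min lexx orbT.
Qed.

Lemma smooth_germ_cst (R : realType) r (a : R) :
  smooth_germ (fun _ : 'rV[R]_r => a).
Proof. by apply/smooth_germP; exists 1 => // n; exact: Ck_cst. Qed.

Lemma smooth_germ_coord (R : realType) r (k : 'I_r) :
  smooth_germ (fun x : 'rV[R]_r => x 0 k).
Proof. by apply/smooth_germP; exists 1 => // n; exact: Ck_coord. Qed.

Lemma smooth_germ_pair (R : realType) q r (f : 'rV[R]_q -> R) (g : 'rV[R]_r -> R) :
  smooth_germ f -> smooth_germ g -> exists2 e : R, 0 < e &
    (forall n, Ck n (ball 0 e) f) /\ (forall n, Ck n (ball 0 e) g).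
Proof.
move=> /smooth_germP[d d0 fC] /smooth_germP[e e0 gC].
have m0 : 0 < Num.min d e by rewrite lt_min d0.
exists (Num.min d e) => //; split=> n.
  by apply: Ck_sub (fC n) => x; apply: le_ball; rewrite ge_min lexx.
by apply: Ck_sub (gC n) => x; apply: le_ball; rewrite ge_min lexx orbT.
Qed.

Lemma smooth_germD (R : realType) r (f g : 'rV[R]_r -> R) :
  smooth_germ f -> smooth_germ g -> smooth_germ (fun x => f x + g x).
Proof.
move=> fs gs; have [e e0 [fC gC]] := smooth_germ_pair fs gs.
by apply/smooth_germP; exists e => // n; apply: CkD => //; exact: ball_open.
Qed.

Lemma smooth_germM (R : realType) r (f g : 'rV[R]_r -> R) :
  smooth_germ f -> smooth_germ g -> smooth_germ (fun x => f x * g x).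
Proof.
move=> fs gs; have [e e0 [fC gC]] := smooth_germ_pair fs gs.
by apply/smooth_germP; exists e => // n; apply: CkM => //; exact: ball_open.
Qed.

Lemma smooth_germ_partial (R : realType) r (f : 'rV[R]_r -> R) k :
  smooth_germ f -> smooth_germ ('D_(delta_mx 0 k) f).
Proof.
move=> /smooth_germP[e e0 fC]; apply/smooth_germP; exists e => // n.
by have [_ /(_ k)[]] := fC n.+1.
Qed.

Lemma smooth_germ_cont (R : realType) r (f : 'rV[R]_r -> R) :
  smooth_germ f -> \forall x \near (0 : 'rV[R]_r), {for x, continuous f}.
Proof. by apply: filterS => x /(_ [::])[]. Qed.

Lemma smooth_germ_cont0 (R : realType) r (f : 'rV[R]_r -> R) :
  smooth_germ f -> {for (0 : 'rV[R]_r), continuous f}.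
Proof. by move/smooth_germ_cont/nbhs_singleton. Qed.

Lemma smooth_germ_comp (R : realType) q r (f : 'rV[R]_q -> R)
    (Phi : 'rV[R]_r -> 'rV[R]_q) :
  smooth_germ f -> (forall j, smooth_germ (fun x => Phi x 0 j)) -> Phi 0 = 0 ->
  smooth_germ (fun x => f (Phi x)).
Proof.
move=> /smooth_germP[d d0 fC] Ps P0.
have Pc : {for (0 : 'rV[R]_r), continuous Phi}.
  by apply: continuous_rV => j; exact: smooth_germ_cont0.
have : \forall x \near (0 : 'rV[R]_r), ball 0 d (Phi x).
  by apply: Pc; rewrite P0; exact: nbhsx_ballx.
move=> /nbhs_ballP[d' /= d'0 Pd].
have /fin_all_exists2 [e e0 PC] : forall j, exists2 e : R, 0 < e &
    forall n, Ck n (ball 0 e) (fun x => Phi x 0 j).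
  by move=> j; apply/smooth_germP.
pose m := \big[Num.min/d']_j e j.
have m0 : 0 < m by apply: lt_bigmin.
apply/smooth_germP; exists m => // n.
apply: (@Ck_comp _ _ _ _ (ball 0 d)); try exact: ball_open.
- move=> x xm; apply: Pd; apply: le_ball xm; exact: bigmin_le_id.
- exact: fC.
- move=> j; apply: Ck_sub (PC j n) => x; apply: le_ball; exact: bigmin_le.
Qed.

(** * Adjoining a last variable; fixed points in that variable, smooth case *)

Definition join (R : realType) r (x : 'rV[R]_r) (y : R) : 'rV[R]_(r + 1) :=
  row_mx x y%:M.

Lemma joinl (R : realType) r (x : 'rV[R]_r) y k : join x y 0 (lshift 1 k) = x 0 k.
Proof. exact: row_mxEl. Qed.

Lemma joinr (R : realType) r (x : 'rV[R]_r) y : join x y 0 (rshift r 0) = y.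
Proof. by rewrite /join row_mxEr mxE. Qed.

Lemma join_eta (R : realType) r (z : 'rV[R]_(r + 1)) :
  join (lsubmx z) (z 0 (rshift r 0)) = z.
Proof.
rewrite -[RHS]hsubmxK; congr row_mx; apply/rowP => i.
by rewrite !mxE !ord1.
Qed.

Lemma join_norm (R : realType) r (x : 'rV[R]_r) y d :
  (`|join x y| < d) = (`|x| < d) && (`|y| < d).
Proof.
have [d0|d0] := ltP 0 d; last first.
  by rewrite !ltNge !(le_trans d0).
apply/idP/andP => [/rV_norm_lt H|[/rV_norm_lt xd yd]].
  split; last by rewrite -(joinr x y) H.
  by apply/rV_norm_lt => // k; rewrite -(joinl x y) H.
apply/rV_norm_lt => // k; case: (split_ordP k) => j ->; first by rewrite joinl xd.
by rewrite ord1 joinr.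
Qed.

Lemma join0 (R : realType) r : join (0 : 'rV[R]_r) 0 = 0.
Proof.
by rewrite -[RHS]join_eta; congr join; [apply/rowP => i|]; rewrite !mxE.
Qed.

Lemma coord_line (R : realType) r (x : 'rV[R]_r) (s : R) j k :
  (x + s *: delta_mx 0 j) 0 k = x 0 k + s * (k == j)%:R.
Proof. by rewrite !mxE eqxx. Qed.

Lemma joinDr (R : realType) r (x : 'rV[R]_r) (y s : R) :
  join x (y + s) = join x y + s *: delta_mx 0 (rshift r 0).
Proof.
apply/rowP => k; rewrite coord_line.
case: (split_ordP k) => j ->; first by rewrite !joinl eq_lrshift mulr0 addr0.
by rewrite ord1 !joinr eqxx mulr1.
Qed.

Lemma joinDl (R : realType) r (x : 'rV[R]_r) (y s : R) k :
  join (s *: delta_mx 0 k + x) y = s *: delta_mx 0 (lshift 1 k) + join x y.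
Proof.
apply/rowP => i; rewrite [in RHS]addrC coord_line.
case: (split_ordP i) => j ->; first by rewrite !joinl addrC coord_line eq_lshift.
by rewrite ord1 !joinr eq_rlshift mulr0 addr0.
Qed.

Lemma cvg_join (R : realType) r (T : Type) (F : set_system T) {FF : Filter F}
    (f : T -> 'rV[R]_r) (g : T -> R) x y :
  f @ F --> x -> g @ F --> y -> (fun t => join (f t) (g t)) @ F --> join x y.
Proof.
move=> fx gy; apply/cvgrPdist_lt => /= e e0.
have /cvgrPdist_lt/(_ _ e0) Hf := fx; have /cvgrPdist_lt/(_ _ e0) Hg := gy.
near=> t.
have -> : join x y - join (f t) (g t) = join (x - f t) (y - g t).
  apply/rowP => k; rewrite mxE [X in _ + X]mxE.
  by case: (split_ordP k) => j ->; rewrite ?ord1 ?joinl ?joinr // !mxE.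
rewrite join_norm; apply/andP; split; near: t => //.
Unshelve. all: by end_near. Qed.

Lemma continuous_join (R : realType) r (T : topologicalType)
    (f : T -> 'rV[R]_r) (g : T -> R) x :
  {for x, continuous f} -> {for x, continuous g} ->
  {for x, continuous (fun t => join (f t) (g t))}.
Proof. by move=> fc gc; exact: cvg_join fc gc. Qed.

Lemma continuous_joinl (R : realType) r (y : R) (x : 'rV[R]_r) :
  {for x, continuous (fun t => join t y)}.
Proof.
exact: (@continuous_join _ _ _ id (fun=> y) x (@cvg_id _ _)
  (@cst_continuous _ _ y x)).
Qed.

Lemma Ck_join (R : realType) r n (U : set 'rV[R]_r) (g : 'rV[R]_r -> R) j :
  Ck n U g -> Ck n U (fun x => join x (g x) 0 j).
Proof.
move=> gC; case: (split_ordP j) => i ->.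
  have -> : (fun x : 'rV[R]_r => join x (g x) 0 (lshift 1 i)) = fun x => x 0 i.
    by apply/funext => x; rewrite joinl.
  exact: Ck_coord.
have -> // : (fun x : 'rV[R]_r => join x (g x) 0 (rshift r i)) = g.
by apply/funext => x; rewrite ord1 joinr.
Qed.

(** A continuous partial derivative that vanishes at [0] is at most [2^-1] near [0]; the mean value
    theorem along the last axis turns this into a contraction. *)
Lemma smooth_last_contraction (R : realType) r (G : 'rV[R]_(r + 1) -> R) :
  smooth_germ G -> 'D_(delta_mx 0 (rshift r 0)) G 0 = 0 ->
  exists2 d : R, 0 < d & forall x y y', `|x| < d -> `|y| < d -> `|y'| < d ->
    `|G (join x y) - G (join x y')| <= 2^-1 * `|y - y'|.
Proof.
move=> Gs G0; have /smooth_germP[e /= e0 GC] := Gs.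
have /smooth_germ_cont0 /cvgrPdist_le := smooth_germ_partial (rshift r 0) Gs.
move=> /(_ 2^-1); rewrite invr_gt0 ltr0n => /(_ isT) /near0_cubeP[e' e'0 De'].
(* The intermediate points have last coordinate [y' + s] with [|s| <= |y| + |y'|], hence of size
   below [3 d]. *)
pose d := Num.min e e' / 3.
have d3 : d + (d + d) = Num.min e e' by rewrite /d; field.
have d0 : 0 < d by rewrite divr_gt0 // lt_min e0.
exists d => // x y y' xd yd yd'.
have seg (s : R) : `|s| <= `|y - y'| ->
    `|join x y' + s *: delta_mx 0 (rshift r 0)| < Num.min e e'.
  move=> sy; rewrite -joinDr join_norm -d3; apply/andP; split.
    by rewrite (lt_trans xd) // ltrDl addr_gt0.
  rewrite (le_lt_trans (ler_normD _ _)) // ltr_leD //.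
  by rewrite (le_trans sy) // (le_trans (ler_normB _ _)) // lerD // ltW.
have [s /seg|s /seg sy E] :=
    @MVT_line _ _ G (join x y') (delta_mx 0 (rshift r 0)) (y - y').
  have [_ /(_ (rshift r 0))[dG _]] := GC 1%N.
  move=> sy; apply: dG; rewrite -ball_normE /= sub0r normrN.
  by rewrite (lt_le_trans sy) // ge_min lexx.
move: E; rewrite -joinDr (addrC y') subrK => ->.
rewrite normrM mulrC ler_wpM2r //.
have := De' _ (lt_le_trans sy _); rewrite G0 sub0r normrN; apply.
by rewrite ge_min lexx orbT.
Qed.

(** Two fixed points over the same [x] are at most half as far apart as they are, so they coincide.
    Continuity of [g] keeps [g x] in the domain of the contraction. *)
Lemma smooth_last_unique (R : realType) r (G : 'rV[R]_(r + 1) -> R)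
    (g : 'rV[R]_r -> R) :
  smooth_germ G -> 'D_(delta_mx 0 (rshift r 0)) G 0 = 0 ->
  smooth_germ g -> g 0 = 0 ->
  (\forall x \near (0 : 'rV[R]_r), G (join x (g x)) = g x) ->
  \forall z \near (0 : 'rV[R]_(r + 1)),
    G z = z 0 (rshift r 0) -> z 0 (rshift r 0) = g (lsubmx z).
Proof.
move=> Gs DG0 gs g0 gG; have [d d0 Gd] := smooth_last_contraction Gs DG0.
have /cvgrPdist_lt/(_ _ d0) := smooth_germ_cont0 gs; rewrite g0 => gd.
have /near0_cubeP[e e0 eP] : \forall x \near (0 : 'rV[R]_r),
    G (join x (g x)) = g x /\ `|g x| < d.
  by apply: filterI => //; apply: filterS gd => x; rewrite sub0r normrN.
apply/near0_cubeP; exists (Num.min d e); first by rewrite lt_min d0.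
move=> z; rewrite -{1 2}[z]join_eta join_norm !lt_min.
set x := lsubmx z; set y := z _ _ => /andP[/andP[xd xe] /andP[yd _]] Gz.
have [gx gxd] := eP _ xe.
have := Gd _ _ _ xd yd gxd; rewrite Gz gx => H.
apply/eqP; rewrite -subr_eq0 -normr_le0.
by have := normr_ge0 (y - g x); lra.
Qed.

Lemma continuous_dist (R : realType) (T : topologicalType) (f : T -> R) x :
  (forall e, 0 < e -> \forall y \near x, `|f x - f y| < e) ->
  {for x, continuous f}.
Proof. by move=> fe; apply/cvgrPdist_lt. Qed.

(* [G] is a contraction in the last variable: this bounds the increments of [g],
   hence its continuity, and the mean value theorem along the last axis then
   gives the partial derivatives of [g]. *)
Lemma smooth_fixed_point (R : realType) r (G : 'rV[R]_(r + 1) -> R) :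
  smooth_germ G -> G 0 = 0 -> 'D_(delta_mx 0 (rshift r 0)) G 0 = 0 ->
  exists g : 'rV[R]_r -> R, [/\ smooth_germ g, g 0 = 0 &
    \forall x \near (0 : 'rV[R]_r), G (join x (g x)) = g x].
Proof.
move=> Gs G0 DG0; have [d d0 Gd] := smooth_last_contraction Gs DG0.
have /smooth_germP[e /= e0 GC] := Gs.
set l := rshift r 0 in DG0.
have H1 : \forall z \near (0 : 'rV[R]_(r + 1)), `|'D_(delta_mx 0 l) G z| < 1.
  have /smooth_germ_cont0 /cvgrPdist_lt := smooth_germ_partial l Gs.
  move=> /(_ 1 ltr01); apply: filterS => z.
  by rewrite DG0 sub0r normrN.
have [e1 e10 e1P] := (near0_cubeP _).1 H1.
pose V : set 'rV[R]_(r + 1) := ball 0 (Num.min e e1).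
have VP z : `|z| < Num.min e e1 -> V z by rewrite /V -ball_normE /= sub0r normrN.
have Vl z : V z -> `|'D_(delta_mx 0 l) G z| < 1.
  rewrite /V -ball_normE /= sub0r normrN => zm; apply: e1P.
  by rewrite (lt_le_trans zm) // ge_min lexx orbT.
have oV : open V by exact: ball_open.
have GV n : Ck n V G.
  by apply: Ck_sub (GC n) => z; apply: le_ball; rewrite ge_min lexx.
(* The fixed points will satisfy [|g x| <= c], so the increments of [g] are at most [2 c] and the
   mean value points have last coordinate at most [3 c], which must stay inside the cube [V]. *)
pose c := Num.min d (Num.min e e1) / 4.
have c0 : 0 < c by rewrite divr_gt0 // !lt_min d0 e0.
have c4 : c + (c + c) + c = Num.min d (Num.min e e1) by rewrite /c; field.
have md : Num.min d (Num.min e e1) <= d by rewrite ge_min lexx.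
have me : Num.min d (Num.min e e1) <= Num.min e e1 by rewrite ge_min lexx orbT.
have c3 : c + (c + c) < Num.min e e1 by lra.
have ce : c < Num.min e e1 by lra.
have cd : c < d by lra.
have [d' d'0 Gd'] : exists2 d' : R, 0 < d' & forall x : 'rV[R]_r, `|x| < d' ->
    `|x| < c /\ `|G (join x 0)| < c / 2.
  have /smooth_germ_cont0 /cvgrPdist_lt := Gs => /(_ (c / 2)).
  rewrite divr_gt0 // G0 => /(_ isT) /near0_cubeP[d1 d10 d1P].
  exists (Num.min c d1) => [|x]; first by rewrite lt_min c0.
  rewrite lt_min => /andP[xc xd1]; split=> //.
  have := d1P (join x 0); rewrite sub0r normrN; apply.
  by rewrite join_norm xd1 normr0.
have Gcont x y : `|x| < Num.min e e1 -> `|y| < Num.min e e1 ->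
    {for join x y, continuous G}.
  by move=> xe ye; apply: (Ck_cont (GV 0)); apply: VP; rewrite join_norm xe.
(* The fixed point over [x] comes from the intermediate value theorem for [y - G(x, y)] on
   [[-c, c]]. At both ends [|G(x, y)| < c], since [|G(x, 0)| < c / 2] and the contraction adds at
   most [c / 2]. Far from [0] the value chosen is arbitrary. *)
have /choice[g gP] : forall x : 'rV[R]_r, exists y, `|x| < d' ->
    `|y| <= c /\ G (join x y) = y.
  move=> x; have [xd'|] := ltP `|x| d'; last by exists 0.
  have [xc Gx] := Gd' _ xd'.
  pose f y := y - G (join x y).
  have Gb y : `|y| = c -> `|G (join x y)| < c.
    move=> yc; rewrite -[G _](subrK (G (join x 0))) (le_lt_trans (ler_normD _ _)) //.
    rewrite [ltRHS](splitr c) ler_ltD //.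
    have := Gd x y 0 (lt_trans xc cd); rewrite yc normr0 subr0 yc => /(_ cd d0).
    by rewrite mulrC.
  have fc : {within `[- c, c], continuous f}.
    apply: continuous_in_subspaceT => y; rewrite inE /= in_itv /= => yc.
    have ye : `|y| < Num.min e e1 by rewrite (le_lt_trans _ ce) // ler_norml.
    apply: continuousB; first exact: cvg_id.
    apply: (@continuous_comp _ _ _ (fun y => join x y) G).
      exact: cvg_join (cvg_cst _) (@cvg_id _ _).
    by apply: Gcont => //; rewrite (lt_trans xc).
  have Ncc : - c <= c by rewrite ge0_cp // ltW.
  have f1 : f (- c) <= 0.
    have := Gb (- c); rewrite normrN gtr0_norm // => /(_ erefl).
    by rewrite ltr_norml /f => /andP[? ?]; lra.
  have f2 : 0 <= f c.
    have := Gb c; rewrite gtr0_norm // => /(_ erefl).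
    by rewrite ltr_norml /f => /andP[? ?]; lra.
  have [|y yc fy] := @IVT _ f (- c) c 0 Ncc fc.
    by rewrite ge_min le_max f1 f2 orbT.
  exists y => _; split; first by move: yc; rewrite in_itv /= ler_norml.
  by move: fy => /eqP; rewrite subr_eq0 => /eqP.
have gc x : `|x| < d' -> `|g x| < d.
  by move=> /gP[gx _]; rewrite (le_lt_trans gx).
have gce x : `|x| < d' -> `|g x| < Num.min e e1.
  by move=> /gP[gx _]; rewrite (le_lt_trans gx).
have xce (x : 'rV[R]_r) : `|x| < d' -> `|x| < Num.min e e1.
  by move=> /Gd'[xc _]; rewrite (lt_trans xc).
have xcd (x : 'rV[R]_r) : `|x| < d' -> `|x| < d.
  by move=> /Gd'[xc _]; rewrite (lt_trans xc).
have gG (x : 'rV[R]_r) : `|x| < d' -> G (join x (g x)) = g x by move=> /gP[].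
have ball_lt (x : 'rV[R]_r) : ball 0 d' x -> `|x| < d'.
  by rewrite -ball_normE /= sub0r normrN.
have near_ball (x : 'rV[R]_r) : `|x| < d' -> \forall y \near x, `|y| < d'.
  move=> xd'; have : nbhs x (ball 0 d').
    apply: open_nbhs_nbhs; split; first exact: ball_open.
    by rewrite -ball_normE /= sub0r normrN.
  by apply: filterS => y /ball_lt.
(* [|g x - g y| <= |G(x, g x) - G(y, g x)| + |g x - g y| / 2], and the last term is absorbed by the
   left side. *)
have gcont (x : 'rV[R]_r) : `|x| < d' -> {for x, continuous g}.
  move=> xd'; apply: continuous_dist => a a0.
  have a2 : 0 < a / 2 by rewrite divr_gt0.
  have : (fun y : 'rV[R]_r => G (join y (g x))) @ x --> G (join x (g x)).
    apply: (@continuous_comp _ _ _ (fun y => join y (g x)) G).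
      exact: continuous_joinl.
    by apply: Gcont; [exact: xce|exact: gce].
  move=> /cvgrPdist_lt/(_ _ a2) Ha; have Hb := near_ball _ xd'.
  near=> y; have yd' : `|y| < d' by near: y.
  have Hy : `|G (join x (g x)) - G (join y (g x))| < a / 2 by near: y.
  have Hc := Gd _ _ _ (xcd _ yd') (gc _ xd') (gc _ yd').
  have Ht := ler_normD (G (join x (g x)) - G (join y (g x)))
                       (G (join y (g x)) - G (join y (g y))).
  rewrite addrA subrK !gG // in Ht Hc Hy *; lra.
(* The formula of implicit differentiation, [d_k G / (1 - d_l G)]; the bound [|d_l G| < 1] on [V]
   keeps the denominator nonzero. *)
pose F k (z : 'rV[R]_(r + 1)) :=
  'D_(delta_mx 0 (lshift 1 k)) G z * (1 + (-1) * 'D_(delta_mx 0 l) G z)^-1.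
have gder (x : 'rV[R]_r) k : `|x| < d' ->
    is_derive x (delta_mx 0 k) g (F k (join x (g x))).
  move=> xd'; pose ek : 'rV[R]_r := delta_mx 0 k; pose z := join x (g x).
  pose X (h : R) := h *: ek + x; pose D (h : R) := g (X h) - g x.
  have Xx : X @ 0^' --> x.
    have Xc : {for 0, continuous X}.
      exact: continuousD (@scalel_continuous _ _ ek 0) (@cst_continuous _ _ x 0).
    by have /continuous_withinNx := Xc; rewrite {2}/X scale0r add0r.
  have near_X : \forall h \near 0^', `|X h| < d' by exact: Xx (near_ball _ xd').
  have Dx : D @ 0^' --> 0.
    rewrite -[X in _ --> X](subrr (g x)).
    have gX : (g \o X) @ 0^' --> g x by apply: cvg_comp Xx _; exact: gcont.
    by apply: cvgB gX _; exact: cvg_cst.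
  (* The increment [D h] occurs on both sides of the fixed-point equation. The mean value theorem in
     the last variable makes it a factor on the right, so that the equation can be solved for [D h];
     the points [s h] tend to [0] with [D h]. *)
  have /choice[s sP] : forall h, exists s : R, `|X h| < d' -> `|s| <= `|D h| /\
      G (join (X h) (g x + D h)) - G (join (X h) (g x)) =
      D h * 'D_(delta_mx 0 l) G (join (X h) (g x + s)).
    move=> h; have [Xd|] := ltP `|X h| d'; last by exists 0.
    have [s sD|s sD E] := @MVT_line _ _ G (join (X h) (g x)) (delta_mx 0 l) (D h).
      have [_ /(_ l)[dG _]] := GV 1%N; apply: dG; apply: VP.
      rewrite -joinDr join_norm xce //= (le_lt_trans _ c3) //.
      have [[gx _] [gX _]] := (gP _ xd', gP _ Xd).
      rewrite (le_trans (ler_normD _ _)) // lerD // (le_trans sD) //.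
      by rewrite (le_trans (ler_normB _ _)) // lerD.
    by exists s => _; split=> //; rewrite !joinDr.
  have s0 : s @ 0^' --> 0.
    apply/cvgrPdist_lt => /= a a0; have /cvgrPdist_lt/(_ _ a0) Da := Dx.
    near=> h; have [sD _] : `|s h| <= `|D h| /\
      G (join (X h) (g x + D h)) - G (join (X h) (g x)) =
      D h * 'D_(delta_mx 0 l) G (join (X h) (g x + s h)) by apply: sP; near: h.
    rewrite sub0r normrN (le_lt_trans sD) //.
    suff : `|0 - D h| < a by rewrite sub0r normrN.
    by near: h.
  pose y h := join (X h) (g x + s h).
  have yz : y @ 0^' --> z.
    by apply: cvg_join => //; rewrite -[X in _ --> X]addr0; apply: cvgD => //; exact: cvg_cst.
  have zV : V z by apply: VP; rewrite join_norm xce //= gce.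
  have Dl0 u : V u -> 1 + -1 * 'D_(delta_mx 0 l) G u != 0.
    move=> /Vl Hu; rewrite mulN1r; apply: lt0r_neq0; rewrite subr_gt0.
    by rewrite (le_lt_trans (ler_norm _)).
  have L : (fun h => (h^-1 *: (G (h *: delta_mx 0 (lshift 1 k) + z) - G z)) *
      (1 + (-1) * 'D_(delta_mx 0 l) G (y h))^-1) @ 0^' --> F k z.
    apply: cvgM.
      have [_ /(_ (lshift 1 k))[dG _]] := GV 1%N.
      exact: dG.
    apply: cvgV; first exact: Dl0.
    apply: cvgD; first exact: cvg_cst.
    apply: cvgM; first exact: cvg_cst.
    have DG : ('D_(delta_mx 0 l) G \o y) @ 0^' --> 'D_(delta_mx 0 l) G z.
      apply: cvg_comp yz _.
      have cG : Ck 0 V ('D_(delta_mx 0 l) G) by have [_ /(_ l)[]] := GV 1%N.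
      exact: Ck_cont cG zV.
    exact: DG.
  have yV : \forall h \near 0^', V (y h).
    exact: (yz V (open_nbhs_nbhs (conj oV zV))).
  have Q : (fun h => h^-1 *: (g (h *: ek + x) - g x)) @ 0^' --> F k z.
    apply: cvg_trans L; apply: near_eq_cvg; near=> h.
    have Xd : `|X h| < d' by near: h.
    have yh : V (y h) by near: h.
    have [_] := sP h Xd.
    rewrite -/(y h) -joinDl -[_ *: _ + x]/(X h) (addrC (g x)) [D h]/D subrK.
    rewrite !gG // => E.
    have {}E : g (X h) - g x =
        (G (join (X h) (g x)) - g x) / (1 + -1 * 'D_(delta_mx 0 l) G (y h)).
      apply/esym/(canLR (mulfK (Dl0 _ yh))).
      by rewrite mulrDr mulr1 mulN1r mulrN -E; ring.
    by rewrite E scalerAl.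
  apply: DeriveDef; first by apply/cvg_ex; exists (F k z).
  by apply/cvg_lim.
exists g; split.
(* Bootstrap: the partial derivatives of [g] are the functions [F k] along the graph of [g]. If [g]
   has class [C^n], so have they, and [g] has class [C^(n+1)]. *)
- apply/smooth_germP; exists d' => // n; elim: n => [|n IH].
    by split=> // x /ball_lt; exact: gcont.
  split=> [x /ball_lt|k]; first exact: gcont.
  split=> [x /ball_lt xd'|]; first by have [] := gder x k xd'.
  apply: (@Ck_ext _ _ _ _ (fun x => F k (join x (g x)))); first exact: ball_open.
    by move=> x /ball_lt xd'; have [_ ->] := gder x k xd'.
  apply: (@Ck_comp _ _ _ _ V) => //; first exact: ball_open.
  + move=> x /ball_lt xd'; apply: VP; rewrite join_norm xce //=; exact: gce.
  + apply: CkM => //; first by have [_ /(_ (lshift 1 k))[]] := GV n.+1.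
    apply: CkV => // [z /Vl|].
      rewrite mulN1r => Hz; apply: lt0r_neq0; rewrite subr_gt0.
      by rewrite (le_lt_trans (ler_norm _)).
    apply: CkD => //; first exact: Ck_cst.
    apply: CkM => //; first exact: Ck_cst.
    by have [_ /(_ l)[]] := GV n.+1.
  + by move=> j; exact: Ck_join.
- have [_ g0G] : `|g 0| <= c /\ G (join 0 (g 0)) = g 0.
    by apply: gP; rewrite normr0.
  have := Gd 0 (g 0) 0; rewrite g0G join0 G0 !subr0 !normr0.
  move=> /(_ d0 _ d0); rewrite gc ?normr0 // => /(_ isT) H.
  by apply/eqP; rewrite -normr_le0; have := normr_ge0 (g 0); lra.
- by apply/near0_cubeP; exists d' => // x /gG.
Unshelve. all: by end_near. Qed.

(** * The Euler equation *)

(** Continuity is two-sided even at the ends, since the integrands are functions on all of [R]; the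
    closure rules are then pointwise. *)
Definition cont01 (R : realType) (f : R -> R) :=
  forall t, 0 <= t <= 1 -> {for t, continuous f}.

Definition int01 (R : realType) (f : R -> R) : R :=
  \int[lebesgue_measure]_(t in `[0, 1]) f t.

Lemma cont01_within (R : realType) (f : R -> R) :
  cont01 f -> {within `[0, 1], continuous f}.
Proof.
move=> fc; apply: continuous_in_subspaceT => t.
by rewrite inE /= in_itv /=; exact: fc.
Qed.

Lemma cont01_integrable (R : realType) (f : R -> R) :
  cont01 f -> lebesgue_measure.-integrable `[0, 1] (EFin \o f).
Proof.
move=> fc; apply: continuous_compact_integrable; first exact: segment_compact.
exact: cont01_within.
Qed.

Lemma int01D (R : realType) (f g : R -> R) : cont01 f -> cont01 g ->
  int01 (fun t => f t + g t) = int01 f + int01 g.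
Proof.
by move=> fc gc; apply: RintegralD => //; exact: cont01_integrable.
Qed.

Lemma int01Z (R : realType) (f : R -> R) c : cont01 f ->
  int01 (fun t => c * f t) = c * int01 f.
Proof. by move=> fc; apply: RintegralZl => //; exact: cont01_integrable. Qed.

Lemma cont01D (R : realType) (f g : R -> R) : cont01 f -> cont01 g ->
  cont01 (fun t => f t + g t).
Proof. by move=> fc gc t t01; exact: (continuousD (fc t t01) (gc t t01)). Qed.

Lemma cont01M (R : realType) (f g : R -> R) : cont01 f -> cont01 g ->
  cont01 (fun t => f t * g t).
Proof. by move=> fc gc t t01; exact: (continuousM (fc t t01) (gc t t01)). Qed.

Lemma cont01_cst (R : realType) (c : R) : cont01 (fun=> c).
Proof. by move=> t _; exact: cst_continuous. Qed.

Lemma cont01_exp (R : realType) n : cont01 (fun t : R => t ^+ n).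
Proof. by move=> t _; exact: exprn_continuous. Qed.

Lemma cont01_sum (R : realType) (I : Type) (s : seq I) (f : I -> R -> R) :
  (forall i, cont01 (f i)) -> cont01 (fun t => \sum_(i <- s) f i t).
Proof.
move=> fc; elim: s => [|i s IH].
  rewrite (_ : (fun _ => _) = fun=> 0); first exact: cont01_cst.
  by apply/funext => t; rewrite big_nil.
rewrite (_ : (fun _ => _) = fun t => f i t + \sum_(i <- s) f i t).
  exact: cont01D.
by apply/funext => t; rewrite big_cons.
Qed.

Lemma int01_sum (R : realType) (I : Type) (s : seq I) (f : I -> R -> R) :
  (forall i, cont01 (f i)) ->
  int01 (fun t => \sum_(i <- s) f i t) = \sum_(i <- s) int01 (f i).
Proof.
move=> fc; elim: s => [|i s IH].
  rewrite (_ : (fun _ => _) = fun=> 0 * 0).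
    by rewrite int01Z ?mul0r ?big_nil //; exact: cont01_cst.
  by apply/funext => t; rewrite big_nil mul0r.
rewrite (_ : (fun _ => _) = fun t => f i t + \sum_(i <- s) f i t).
  by rewrite int01D // ?IH ?big_cons //; exact: cont01_sum.
by apply/funext => t; rewrite big_cons.
Qed.

Lemma int01_cst (R : realType) (c : R) : int01 (fun=> c) = c.
Proof.
have L1 : lebesgue_measure (`[0, 1]%classic : set R) = 1%E.
  by rewrite lebesgue_measure_itv /= lte_fin ltr01 oppr0 adde0.
by rewrite /int01 Rintegral_cst // [X in fine X]L1 mulr1.
Qed.

Lemma int01_norm_le (R : realType) (f : R -> R) M : cont01 f ->
  (forall t, 0 <= t <= 1 -> `|f t| <= M) -> `|int01 f| <= M.
Proof.
move=> fc fM; apply: le_trans (le_normr_Rintegral _ _) _ => //.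
  exact: cont01_integrable.
rewrite -[leRHS]int01_cst; apply: le_Rintegral => //.
- apply: (@cont01_integrable _ (fun t => `|f t|)) => t t01.
  by apply: continuous_comp; [exact: fc|exact: norm_continuous].
- by apply: (@cont01_integrable _ (fun=> M)); exact: cont01_cst.
Qed.

Lemma int01_derive (R : realType) (F f : R -> R) : cont01 f ->
  (forall t : R, 0 <= t <= 1 -> is_derive t 1 F (f t)) -> int01 f = F 1 - F 0.
Proof.
move=> fc Ff.
have Fc (t : R) : 0 <= t <= 1 -> {for t, continuous F}.
  by move=> /Ff [dF _]; apply: differentiable_continuous; exact/derivable1_diffP.
have t01 (t : R) : t \in `]0, 1[%R -> 0 <= t <= 1.
  by rewrite in_itv /= => /andP[t0 t1]; rewrite !ltW.
have := @continuous_FTC2 _ f F 0 1 ltr01 (cont01_within fc).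
rewrite /int01 /Rintegral => -> //.
- split=> [t /t01 /Ff[] //||].
  + by apply: cvg_at_right_filter; apply: Fc; rewrite lexx ler01.
  + by apply: cvg_at_left_filter; apply: Fc; rewrite lexx ler01.
- by move=> t /t01 /Ff[_ <-]; rewrite derive1E.
Qed.

Lemma bounded_on_cube (R : realType) r (f : 'rV[R]_r -> R) e d :
  Ck 0 (ball 0 e) f -> d < e ->
  exists M, forall x : 'rV[R]_r, `|x| <= d -> `|f x| <= M.
Proof.
move=> [fc _] de; pose A := [set x : 'rV[R]_r | `|x| <= d].
have [d0|d0] := leP 0 d; last first.
  by exists 0 => x xd; have := le_lt_trans (le_trans (normr_ge0 x) xd) d0; rewrite ltxx.
have [|||c _ cP] := @EVT_max_rV _ _ (fun x => `|f x|) A.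
- by exists 0; rewrite /A /= normr0.
- apply: bounded_closed_compact.
    exists d; split; first exact: num_real.
    by move=> M dM x /= xd; rewrite (le_trans xd) // ltW.
  rewrite (_ : A = Num.Def.normr @^-1` [set y : R | y <= d]) //.
  apply: preimage_closed; last exact: closed_le.
  by move=> x _; exact: norm_continuous.
- apply: continuous_in_subspaceT => x; rewrite inE /A /= => xd.
  apply: continuous_comp; last exact: norm_continuous.
  by apply: fc; rewrite -ball_normE /= sub0r normrN (le_lt_trans xd).
exists `|f c| => x xd; apply: cP; rewrite inE //.
Qed.

(** The action written [t . x]. A coordinate of weight [0] is fixed, also at [t = 0]. *)
Definition weighted_scale (R : realType) r (mu : 'I_r -> nat) (t : R)
    (x : 'rV[R]_r) : 'rV[R]_r := \row_k (t ^+ mu k * x 0 k).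

Lemma weighted_scaleE (R : realType) r (mu : 'I_r -> nat) (t : R) x k :
  weighted_scale mu t x 0 k = t ^+ mu k * x 0 k.
Proof. by rewrite mxE. Qed.

Lemma weighted_scale_norm (R : realType) r (mu : 'I_r -> nat) (t : R) x :
  0 <= t <= 1 -> `|weighted_scale mu t x| <= `|x|.
Proof.
move=> /andP[t0 t1]; apply/rV_norm_le => // k.
rewrite weighted_scaleE normrM (ger0_norm (exprn_ge0 _ t0)).
by rewrite (le_trans _ (rV_coord_le x k)) // ler_piMl // exprn_ile1.
Qed.

Lemma weighted_scale_line (R : realType) r (mu : 'I_r -> nat) (t s : R) x k :
  weighted_scale mu t (x + s *: delta_mx 0 k) =
  weighted_scale mu t x + s *: (t ^+ mu k *: delta_mx 0 k).
Proof.
apply/rowP => j; rewrite weighted_scaleE [RHS]mxE weighted_scaleE coord_line.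
rewrite mulrDr; congr (_ + _); rewrite !mxE eqxx /=.
by have [->|] := eqVneq j k; rewrite ?mulr0 // !mulr1 mulrC.
Qed.

Section euler_operator.
Context {R : realType} {r : nat} (mu : 'I_r -> nat) (e : R).
Implicit Types w : 'rV[R]_r -> R.
Let U : set 'rV[R]_r := ball 0 e.

Let UP (x : 'rV[R]_r) : U x <-> `|x| < e.
Proof. by rewrite /U -ball_normE /= sub0r normrN. Qed.

(* [u(x) = N * \int_0^1 t^(N-1) w(t . x) dt] solves [N u + E u = N w], where [E]
   is the Euler field of the weights [mu] (integrate the derivative in [t] of
   [t^N w(t . x)]); here [a = N - 1]. *)
Definition euler_integral a w (x : 'rV[R]_r) : R :=
  int01 (fun t => t ^+ a * w (weighted_scale mu t x)).

Let scaleU t x : U x -> 0 <= t <= 1 -> U (weighted_scale mu t x).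
Proof.
by move=> /UP xe t01; apply/UP; rewrite (le_lt_trans _ xe) // weighted_scale_norm.
Qed.

Lemma weighted_scale_continuous (x : 'rV[R]_r) (t : R) :
  {for t, continuous (fun t => weighted_scale mu t x)}.
Proof.
apply: continuous_rV => k.
rewrite (_ : (fun _ => _) = fun t => t ^+ mu k * x 0 k).
  by apply: continuousM; [exact: exprn_continuous|exact: cst_continuous].
by apply/funext => s; rewrite weighted_scaleE.
Qed.

Lemma euler_integrand_cont a w x : Ck 0 U w -> U x ->
  cont01 (fun t => t ^+ a * w (weighted_scale mu t x)).
Proof.
move=> wC Ux; apply: cont01M; first exact: cont01_exp.
move=> t t01; apply: continuous_comp; first exact: weighted_scale_continuous.
exact: Ck_cont wC (scaleU Ux t01).
Qed.

(** Differentiating [w(t . x)] in [x_k] produces the factor [t^(mu k)], so the derivative is again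
    an Euler integral, with another exponent and another function. This stability drives the
    induction on the class of differentiability. *)
Lemma euler_integral_derive a w x k : Ck 1 U w -> U x ->
  is_derive x (delta_mx 0 k) (euler_integral a w)
    (euler_integral (a + mu k) ('D_(delta_mx 0 k) w) x).
Proof.
move=> wC Ux; pose ek : 'rV[R]_r := delta_mx 0 k.
have [w0 w1] : Ck 0 U w /\ Ck 0 U ('D_ek w).
  by split; [exact: CkS|have [_ /(_ k)[]] := wC].
have xe : `|x| < e by exact/UP.
(* Half of the margin: the closed cube of radius [|x| + eta] stays inside [U], and the maximum of
   ['D_ek w] on it dominates the differentiated integrand for all [|s| < eta]. *)
pose eta := (e - `|x|) / 2.
have eta0 : 0 < eta by rewrite divr_gt0 // subr_gt0.
have xeta : `|x| + eta < e by rewrite /eta; lra.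
have [M MP] := bounded_on_cube w1 xeta.
pose f (s t : R) := t ^+ a * w (weighted_scale mu t (x + s *: ek)).
have line s : `|s| < eta -> `|x + s *: ek| <= `|x| + eta.
  move=> se; rewrite (le_trans (ler_normD _ _)) // lerD2l normrZ.
  rewrite (le_trans _ (ltW se)) // ler_piMr //; exact: norm_delta_mx.
have lineU s : `|s| < eta -> U (x + s *: ek).
  by move=> /line H; apply/UP; exact: le_lt_trans xeta.
have I_eta (s : R) : `]- eta, eta[%classic s -> `|s| < eta.
  by rewrite /= in_itv /= ltr_norml.
have in01 (t : R) : `[0, 1]%classic t -> 0 <= t <= 1 by rewrite /= in_itv.
have df (s t : R) : `|s| < eta -> 0 <= t <= 1 ->
    is_derive s 1 (f ^~ t)
      (t ^+ (a + mu k) * 'D_ek w (weighted_scale mu t (x + s *: ek))).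
  move=> se t01.
  have Uy : U (weighted_scale mu t (x + s *: ek)) by apply: scaleU => //; exact: lineU.
  have dw := differentiable_partials (ball_open _ _) wC Uy.
  have dl : derivable w (weighted_scale mu t x + s *: (t ^+ mu k *: ek)) (t ^+ mu k *: ek).
    by rewrite -weighted_scale_line; exact: diff_derivable.
  have H := is_derive_line dl.
  rewrite -weighted_scale_line (deriveE _ dw) linearZ /= -(deriveE _ dw) in H.
  have -> : f ^~ t = t ^+ a *: (fun s => w (weighted_scale mu t x + s *: (t ^+ mu k *: ek))).
    by apply/funext => s'; rewrite /f weighted_scale_line.
  have Z := @is_deriveZ _ _ _ _ (t ^+ a) _ _ _ H.
  apply: (@is_derive_eq _ _ _ _ _ _ _ _ Z).
  by rewrite exprD -mulrA.
have J0 : euler_integral a w x = int01 (f 0).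
  by rewrite /f scale0r addr0.
have := @cvg_differentiation_under_integral R _ _ lebesgue_measure f `[0, 1]%classic
  (measurable_itv _) 0 (- eta) eta.
rewrite /= in_itv /= oppr_lt0 eta0 => /(_ isT).
move=> /(_ _ _ (fun=> M)) H.
have {}H : h^-1 *: (int01 (f (h + 0)) - int01 (f 0)) @[h --> 0^'] -->
    int01 (fun t => t ^+ (a + mu k) * 'D_ek w (weighted_scale mu t x)).
  have E : int01 (fun t => t ^+ (a + mu k) * 'D_ek w (weighted_scale mu t x)) =
    \int[lebesgue_measure]_(t in `[0, 1]) (partial1of2 f) 0 t.
    apply: eq_Rintegral => t; rewrite inE => /in01 t01.
    rewrite partial1of2E; have [|_ ->] := df 0 t _ t01; first by rewrite normr0.
    by rewrite scale0r addr0.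
  rewrite E; apply: H.
  - move=> s /I_eta se; apply: cont01_integrable.
    by apply: euler_integrand_cont w0 _; exact: lineU.
  - by move=> s t /I_eta se /in01 t01; have [] := df s t se t01.
  - move=> _; apply: le_trans (MP x _); first exact: normr_ge0.
    by rewrite lerDl ltW.
  - by apply: (@cont01_integrable _ (fun=> M)); exact: cont01_cst.
  - move=> s t /I_eta se /in01 t01; rewrite partial1of2E.
    have [_ ->] := df s t se t01.
    have /andP[t0 t1] := t01.
    rewrite normrM ger0_norm ?exprn_ge0 //.
    apply: le_trans (MP _ _); last exact: le_trans (weighted_scale_norm _ _ t01) (line _ se).
    by rewrite ler_piMl // exprn_ile1.
have {}H : h^-1 *: (euler_integral a w (h *: ek + x) - euler_integral a w x)
    @[h --> 0^'] --> euler_integral (a + mu k) ('D_ek w) x.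
  rewrite J0; apply: cvg_trans H; apply: near_eq_cvg; near=> h.
  by rewrite addr0 (addrC _ x).
apply: DeriveDef; last by apply/cvg_lim.
by apply/cvg_ex; exists (euler_integral (a + mu k) ('D_ek w) x).
Unshelve. all: by end_near. Qed.

(** The partial derivatives are Euler integrals of functions bounded near [x], hence bounded, and
    the mean value formula gives a Lipschitz estimate at [x]. *)
Lemma euler_integral_cont a w x : Ck 1 U w -> U x ->
  {for x, continuous (euler_integral a w)}.
Proof.
move=> wC Ux; have xe : `|x| < e by exact/UP.
pose eta := (e - `|x|) / 2.
have eta0 : 0 < eta by rewrite divr_gt0 // subr_gt0.
have xeta : `|x| + eta < e by rewrite /eta; lra.
have w1 k : Ck 0 U ('D_(delta_mx 0 k) w) by have [_ /(_ k)[]] := wC.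
have /choice[M MP] := fun k => bounded_on_cube (w1 k) xeta.
have JM k y : `|y| <= `|x| + eta ->
    `|euler_integral (a + mu k) ('D_(delta_mx 0 k) w) y| <= M k.
  move=> yx; have Uy : U y by apply/UP; exact: le_lt_trans xeta.
  apply: int01_norm_le; first exact: (@euler_integrand_cont _ _ _ (w1 k) Uy).
  move=> t t01; have /andP[t0 t1] := t01.
  rewrite normrM ger0_norm ?exprn_ge0 //.
  apply: le_trans (MP k _ (le_trans (weighted_scale_norm mu _ t01) yx)).
  by rewrite ler_piMl // exprn_ile1.
pose S := 1 + \sum_k M k.
have M0 k : 0 <= M k.
  by apply: le_trans (MP k x _); rewrite ?normr_ge0 // lerDl ltW.
have S0 : 0 < S by rewrite ltr_pwDl // sumr_ge0.
apply: continuous_dist => a' a'0.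
have m0 : 0 < Num.min eta (a' / S) by rewrite lt_min eta0 divr_gt0.
apply/nbhs_normP; exists (Num.min eta (a' / S)) => //= y.
move=> xy; have {xy} : `|x - y| < Num.min eta (a' / S) by [].
rewrite lt_min => /andP[xy1 xy2]; rewrite distrC.
have near_xU z : `|z - x| <= `|y - x| -> `|z| <= `|x| + eta.
  move=> zy; rewrite -[z](subrK x) addrC (le_trans (ler_normD _ _)) //.
  by rewrite lerD2l (le_trans zy) // distrC ltW.
have [|xi xiP] := @mean_value_rV _ _ (euler_integral a w) x (y - x).
  move=> z j /near_xU zx.
  have Uz : U z by apply/UP; exact: le_lt_trans xeta.
  by have [] := euler_integral_derive a j wC Uz.
rewrite (addrC x) subrK => ->; apply: le_lt_trans (ler_norm_sum _ _ _) _.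
apply: (@le_lt_trans _ _ (\sum_k `|y - x| * M k)).
  apply: ler_sum => k _; rewrite normrM ler_pM ?rV_coord_le //.
  have zx := near_xU _ (xiP k).
  have Uz : U (xi k) by apply/UP; exact: le_lt_trans xeta.
  by have [_ ->] := euler_integral_derive a k wC Uz; exact: JM.
rewrite -mulr_sumr; apply: (@le_lt_trans _ _ (`|y - x| * S)).
  by rewrite ler_wpM2l // lerDr.
by rewrite -ltr_pdivlMr // distrC.
Qed.

Lemma euler_integral_Ck a w n : (forall m, Ck m U w) -> Ck n U (euler_integral a w).
Proof.
elim: n a w => [|n IH] a w wC; split=> //.
- by move=> x; exact: euler_integral_cont.
- by move=> x; exact: euler_integral_cont.
move=> k; split=> [x Ux|]; first by have [] := euler_integral_derive a k (wC 1%N) Ux.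
apply: (@Ck_ext _ _ _ _ (euler_integral (a + mu k) ('D_(delta_mx 0 k) w))).
- exact: ball_open.
- by move=> x Ux; have [_ ->] := euler_integral_derive a k (wC 1%N) Ux.
- by apply: IH => m; have [_ /(_ k)[]] := wC m.+1.
Qed.

Lemma euler_integral_eq a w x : (forall m, Ck m U w) -> U x ->
  a.+1%:R * euler_integral a w x +
  \sum_k (mu k)%:R * x 0 k * euler_integral (a + mu k) ('D_(delta_mx 0 k) w) x
  = w x.
Proof.
move=> wC Ux.
have c1 b : cont01 (fun t => t ^+ b * w (weighted_scale mu t x)).
  by apply: euler_integrand_cont => //; exact: wC.
have c2 b k : cont01 (fun t => t ^+ b * 'D_(delta_mx 0 k) w (weighted_scale mu t x)).
  by apply: (@euler_integrand_cont _ ('D_(delta_mx 0 k) w)) => //; have [_ /(_ k)[]] := wC 1%N.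
pose f t := a.+1%:R * (t ^+ a * w (weighted_scale mu t x)) +
  \sum_k (mu k)%:R * x 0 k *
    (t ^+ (a + mu k) * 'D_(delta_mx 0 k) w (weighted_scale mu t x)).
have fc : cont01 f.
  apply: cont01D; first by apply: cont01M => //; exact: cont01_cst.
  by apply: cont01_sum => k; apply: cont01M => //; exact: cont01_cst.
have -> : a.+1%:R * euler_integral a w x +
  \sum_k (mu k)%:R * x 0 k * euler_integral (a + mu k) ('D_(delta_mx 0 k) w) x
  = int01 f.
  rewrite int01D; last 2 first.
  - by apply: cont01M => //; exact: cont01_cst.
  - by apply: cont01_sum => k; apply: cont01M => //; exact: cont01_cst.
  rewrite int01Z // int01_sum; last first.
    by move=> k; apply: cont01M => //; exact: cont01_cst.
  by congr (_ + _); apply: eq_bigr => k _; rewrite int01Z.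
suff D (t : R) : 0 <= t <= 1 ->
    is_derive t 1 (fun t => t ^+ a.+1 * w (weighted_scale mu t x)) (f t).
  rewrite (int01_derive fc D) expr0n mul0r subr0 expr1n mul1r; congr w.
  by apply/rowP => k; rewrite weighted_scaleE expr1n mul1r.
move=> t01; have Uy := scaleU Ux t01.
have dw := differentiable_partials (ball_open _ _) (wC 1%N) Uy.
have dX m : is_derive t 1 (fun t : R => t ^+ m) (m%:R * t ^+ m.-1).
  by apply: DeriveDef; [exact: exprn_derivable|rewrite exp_derive [LHS]mulr1].
have ds k : is_derive t 1 (fun t : R => weighted_scale mu t x 0 k)
    ((mu k)%:R * t ^+ (mu k).-1 * x 0 k).
  have -> : (fun t : R => weighted_scale mu t x 0 k) =
      x 0 k *: (fun t : R => t ^+ mu k).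
    by apply/funext => s; rewrite weighted_scaleE mulrC.
  have Z := @is_deriveZ _ _ _ _ (x 0 k) _ _ _ (dX (mu k)).
  by apply: (@is_derive_eq _ _ _ _ _ _ _ _ Z); rewrite [LHS]mulrC.
have dc : is_derive t 1 (fun t => w (weighted_scale mu t x))
   (\sum_j 'D_(delta_mx 0 j) w (weighted_scale mu t x) * ((mu j)%:R * t ^+ (mu j).-1 * x 0 j)).
  have dd j : derivable (fun t : R => weighted_scale mu t x 0 j) t 1.
    by have [] := ds j.
  have H := @is_derive_comp _ _ _ w (fun t => weighted_scale mu t x) t 1 dw dd.
  apply: (@is_derive_eq _ _ _ _ _ _ _ _ H).
  by apply: eq_bigr => j _; have [_ ->] := ds j.
have Z := @is_deriveM _ _ _ _ _ _ _ _ (dX a.+1) dc.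
apply: (@is_derive_eq _ _ _ _ _ _ _ _ Z).
rewrite addrC; congr (_ + _); first by rewrite [LHS]mulrC mulrA.
rewrite [LHS]mulr_sumr; apply: eq_bigr => j _.
(* For weight [0] the predecessor [(mu j).-1] is truncated, but the factor [(mu j)%:R] kills the
   term. *)
case: (mu j) => [|m] /=; first by rewrite !mul0r !mulr0.
by rewrite addnS !exprS exprD; ring.
Qed.

End euler_operator.

Lemma smooth_germ_euler (R : realType) r (mu : 'I_r -> nat) a (w : 'rV[R]_r -> R)
    (u := fun x => a.+1%:R * euler_integral mu a w x) :
  smooth_germ w -> smooth_germ u /\
    \forall x \near (0 : 'rV[R]_r),
      a.+1%:R * u x + \sum_k (mu k)%:R * x 0 k * 'D_(delta_mx 0 k) u x
      = a.+1%:R * w x.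
Proof.
move=> /smooth_germP[e e0 wC].
have uC n : Ck n (ball 0 e) u.
  apply: CkM; first exact: ball_open.
    exact: Ck_cst.
  exact: euler_integral_Ck.
split; first by apply/smooth_germP; exists e.
apply: (@filterS _ _ _ (ball 0 e)); last exact: nbhsx_ballx.
move=> x Ux; rewrite -[in RHS](euler_integral_eq mu a wC Ux) mulrDr mulr_sumr.
congr (_ + _); apply: eq_bigr => k _; rewrite [RHS]mulrCA; congr (_ * _).
have H := euler_integral_derive mu a k (wC 1%N) Ux.
have [_ ->] := @is_deriveZ _ _ _ _ a.+1%:R _ _ _ H.
by [].
Qed.

(** * Unconditional sums and power series *)

Lemma big_fsetIDE (R : realType) (I : choiceType) (A B : {fset I}) (F : I -> R) :
  \sum_(i <- A) F i =
  \sum_(i <- (A `&` B)%fset) F i + \sum_(i <- (A `\` B)%fset) F i.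
Proof.
rewrite (big_fsetID _ (fun x => x \in B)) /=; congr (_ + _); congr (\sum_(i <- _) F i).
  by congr (finmap.enum_fset _); apply/fsetP => i; rewrite !inE.
by congr (finmap.enum_fset _); apply/fsetP => i; rewrite !inE andbC.
Qed.

Lemma big_fset_subE (R : realType) (I : choiceType) (A B : {fset I}) (F : I -> R) :
  (B `<=` A)%fset ->
  \sum_(i <- A) F i = \sum_(i <- B) F i + \sum_(i <- (A `\` B)%fset) F i.
Proof. by move=> /fsetIidPr BA; rewrite (big_fsetIDE A B) BA. Qed.

Lemma ler_fset_sum (R : realType) (I : choiceType) (A B : {fset I}) (F : I -> R) :
  (forall i, 0 <= F i) -> (B `<=` A)%fset ->
  \sum_(i <- B) F i <= \sum_(i <- A) F i.
Proof. by move=> F0 /big_fset_subE ->; rewrite lerDl sumr_ge0. Qed.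

Definition sum_to (R : realType) (I : choiceType) (a : I -> R) (l : R) :=
  partial_sum a A @[A --> totally] --> l.

(** The bound is an explicit constant rather than the value of the sum, so that norm estimates for
    power series compose by plain arithmetic. *)
Definition abs_sum_le (R : realType) (I : choiceType) (a : I -> R) (C : R) :=
  forall A : {fset I}, \sum_(i <- A) `|a i| <= C.

Lemma partial_sumE (R : realType) (I : choiceType) (a : I -> R) (A : {fset I}) :
  partial_sum a A = \sum_(i <- A) a i.
Proof. by rewrite big_seq_fsetE. Qed.

Lemma sum_toP (R : realType) (I : choiceType) (a : I -> R) (l : R) :
  sum_to a l <-> forall e, 0 < e -> exists A0 : {fset I}, forall A : {fset I},
    (A0 `<=` A)%fset -> `|l - \sum_(i <- A) a i| <= e.
Proof.
have ? := @totally_filter I; split=> [al e e0|H].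
  have /cvgrPdist_le/(_ _ e0)[A0 _ A0P] := al.
  by exists A0 => A A0A; rewrite -partial_sumE; exact: A0P.
apply/cvgrPdist_le => e e0; have [A0 A0P] := H _ e0.
by exists A0 => // A A0A; rewrite /= partial_sumE; exact: A0P.
Qed.

Lemma sum_to_unique (R : realType) (I : choiceType) (a : I -> R) (l l' : R) :
  sum_to a l -> sum_to a l' -> l = l'.
Proof. by have ? := @totally_filter I; apply: cvg_unique. Qed.

Lemma sum_to_ext (R : realType) (I : choiceType) (a b : I -> R) (l : R) :
  (forall i, a i = b i) -> sum_to a l -> sum_to b l.
Proof. by move=> /funext ->. Qed.

Lemma sum_toD (R : realType) (I : choiceType) (a b : I -> R) (l l' : R) :
  sum_to a l -> sum_to b l' -> sum_to (fun i => a i + b i) (l + l').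
Proof.
have ? := @totally_filter I; rewrite /sum_to => al bl.
have -> : partial_sum (fun i => a i + b i) = partial_sum a \+ partial_sum b.
  by apply/funext => A /=; rewrite !partial_sumE big_split.
exact: cvgD.
Qed.

Lemma sum_toZ (R : realType) (I : choiceType) (a : I -> R) (l c : R) :
  sum_to a l -> sum_to (fun i => c * a i) (c * l).
Proof.
have ? := @totally_filter I; rewrite /sum_to => al.
have -> : partial_sum (fun i => c * a i) = (fun A => c * partial_sum a A).
  by apply/funext => A /=; rewrite !partial_sumE mulr_sumr.
by apply: cvgM => //; exact: cvg_cst.
Qed.

Lemma sum_to_sum (R : realType) (I : choiceType) (J : Type) (s : seq J)
    (a : J -> I -> R) (l : J -> R) :
  (forall j, sum_to (a j) (l j)) ->
  sum_to (fun i => \sum_(j <- s) a j i) (\sum_(j <- s) l j).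
Proof.
move=> al; elim: s => [|j s IH].
  apply/sum_toP => e e0; exists fset0 => A _.
  by rewrite big_nil big1 ?subr0 ?normr0 ?ltW // => i _; rewrite big_nil.
rewrite big_cons (_ : (fun _ => _) = fun i => a j i + \sum_(j <- s) a j i).
  exact: sum_toD.
by apply/funext => i; rewrite big_cons.
Qed.

Lemma sum_to_le (R : realType) (I : choiceType) (a : I -> R) (l C : R) :
  (exists A0 : {fset I}, forall A, (A0 `<=` A)%fset ->
     `|\sum_(i <- A) a i| <= C) -> sum_to a l -> `|l| <= C.
Proof.
move=> [A0 A0C] /sum_toP al; apply/ler_addgt0Pr => e /al[A1 A1P].
have H1 := A1P (A0 `|` A1)%fset (fsubsetUr _ _).
have H0 := A0C (A0 `|` A1)%fset (fsubsetUl _ _).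
rewrite -(subrK (\sum_(i <- (A0 `|` A1)%fset) a i) l) (le_trans (ler_normD _ _)) //.
by rewrite addrC lerD.
Qed.

Lemma sum_to_abs_le (R : realType) (I : choiceType) (a : I -> R) (l C : R) :
  abs_sum_le a C -> sum_to a l -> `|l| <= C.
Proof.
move=> aC; apply: sum_to_le; exists fset0 => A _.
by rewrite (le_trans (ler_norm_sum _ _ _)).
Qed.

Lemma abs_sum_le_ge0 (R : realType) (I : choiceType) (a : I -> R) C :
  abs_sum_le a C -> 0 <= C.
Proof. by move=> /(_ fset0); rewrite big_seq_fset0. Qed.

(** [A0] is a finite set whose sum of absolute values is within [e] of the supremum; a set disjoint
    from it cannot add more than [e]. *)
Lemma abs_sum_le_tail (R : realType) (I : choiceType) (a : I -> R) C e :
  abs_sum_le a C -> 0 < e -> exists A0 : {fset I}, forall A : {fset I},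
    [disjoint A & A0]%fset -> \sum_(i <- A) `|a i| <= e.
Proof.
move=> aC e0; pose S := [set \sum_(i <- A) `|a i| | A in [set: {fset I}]].
have Ss : has_sup S.
  split; first by exists (\sum_(i <- fset0) `|a i|), fset0.
  by exists C => _ [A _ <-]; exact: aC.
have [_ [A0 _ <-] A0P] := sup_adherent e0 Ss.
exists A0 => A AA0.
have : \sum_(i <- (A `|` A0)%fset) `|a i| <= sup S.
  by apply: (sup_upper_bound Ss); exists (A `|` A0)%fset.
rewrite (big_fset_subE _ (fsubsetUr A A0)) fsetDUl fsetDv fsetU0.
have -> : (A `\` A0)%fset = A by apply/fsetDidPl.
lra.
Qed.

(** A nonnegative family converges to the supremum of its finite sums. In general [a] is the
    difference of its positive and negative parts, which are [half] at [s = 1] and at [s = -1]. *)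
Lemma sum_to_ex (R : realType) (I : choiceType) (a : I -> R) C :
  abs_sum_le a C -> exists l, sum_to a l.
Proof.
suff pos (b : I -> R) : (forall i, 0 <= b i) -> abs_sum_le b C -> exists l, sum_to b l.
  move=> aC.
  have half (s : R) : `|s| <= 1 -> exists l, sum_to (fun i => (`|a i| + s * a i) / 2) l.
    move=> s1; have sa i : `|s * a i| <= `|a i| by rewrite normrM ler_piMl.
    apply: pos => [i|A].
      by have := sa i; rewrite ler_norml => /andP[? _]; rewrite divr_ge0 //; lra.
    apply: le_trans (aC A); apply: ler_sum => i _.
    by have := sa i; rewrite !ler_norml => /andP[? ?]; apply/andP; split; lra.
  have [|l1 l1P] := half 1; first by rewrite normr1.
  have [|l2 l2P] := half (-1); first by rewrite normrN1.
  exists (l1 + (-1) * l2).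
  have -> : a = (fun i => (`|a i| + 1 * a i) / 2 + (-1) * ((`|a i| + (-1) * a i) / 2)).
    by apply/funext => i; field.
  by apply: sum_toD l1P _; exact: (@sum_toZ _ _ _ _ (-1) l2P).
move=> b0 bC; pose S := [set \sum_(i <- A) b i | A in [set: {fset I}]].
have Ss : has_sup S.
  split; first by exists (\sum_(i <- fset0) b i), fset0.
  exists C => _ [A _ <-]; apply: le_trans (bC A).
  by apply: ler_sum => i _; exact: ler_norm.
exists (sup S); apply/sum_toP => e e0.
have [_ [A0 _ <-] A0P] := sup_adherent e0 Ss.
exists A0 => A A0A.
have H1 : \sum_(i <- A) b i <= sup S by apply: (sup_upper_bound Ss); exists A.
have H2 := ler_fset_sum b0 A0A.
by rewrite ger0_norm ?subr_ge0 //; lra.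
Qed.

(** Unconditional convergence is absolute: beyond [A0] every finite sum is at most [2], as the
    difference of two sums within [1] of [l]. Separating the terms by sign bounds the absolute
    values there by [2 + 2]. *)
Lemma abs_sum_le_partial (R : realType) (I : choiceType) (a : I -> R) l :
  sum_to a l -> exists C, abs_sum_le a C.
Proof.
move=> /sum_toP/(_ 1 ltr01)[A0 A0P]; exists (\sum_(i <- A0) `|a i| + 4) => A.
have bound (B : {fset I}) : [disjoint B & A0]%fset -> `|\sum_(i <- B) a i| <= 2.
  move=> BA0; have := A0P _ (fsubsetUr B A0); have := A0P _ (fsubset_refl A0).
  rewrite (big_fset_subE _ (fsubsetUr B A0)) fsetDUl fsetDv fsetU0.
  have -> : (B `\` A0)%fset = B by apply/fsetDidPl.
  by rewrite !ler_norml => /andP[? ?] /andP[? ?]; lra.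
have dis (P : pred I) : [disjoint [fset i in (A `\` A0)%fset | P i] & A0]%fset.
  by apply/fdisjointP => i; rewrite !inE => /andP[/andP[]].
rewrite (big_fsetIDE A A0); apply: lerD.
  by apply: ler_fset_sum => //; exact: fsubsetIr.
rewrite (big_fsetID _ (fun i => 0 <= a i)) /=.
have -> : 4 = 2 + 2 :> R by rewrite -natrD.
apply: lerD.
  apply: le_trans (bound _ (dis (fun i => 0 <= a i))); rewrite ler_normr.
  apply/orP; left; rewrite big_seq [leRHS]big_seq; apply: ler_sum => i.
  by rewrite !inE => /andP[_ ai]; rewrite ger0_norm.
apply: le_trans (bound _ (dis (fun i => ~~ (0 <= a i)))); rewrite ler_normr.
apply/orP; right; rewrite -sumrN big_seq [leRHS]big_seq; apply: ler_sum => i.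
by rewrite !inE -ltNge => /andP[_ ai]; rewrite ltr0_norm.
Qed.

Lemma sum_to_delta (R : realType) (I : choiceType) (p : I) (c : R) :
  sum_to (fun i => if i == p then c else 0) c.
Proof.
apply/sum_toP => e e0; exists [fset p]%fset => A; rewrite fsub1set => pA.
rewrite (big_fsetD1 p) //= eqxx big_seq big1 ?addr0 ?subrr ?normr0 ?ltW // => i.
by rewrite !inE => /andP[/negbTE ->].
Qed.

(** The remainder is the sum of the family cut off to the complement of [A]. The set [A0] depends
    only on the majorant [b], so one [A0] serves all families below [b]: this uniformity later
    allows a sum to be exchanged with an integral. *)
Lemma sum_to_tail (R : realType) (I : choiceType) (a b : I -> R) l e (A0 : {fset I}) :
  (forall i, `|a i| <= b i) ->
  (forall A, [disjoint A & A0]%fset -> \sum_(i <- A) b i <= e) ->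
  sum_to a l -> forall A, (A0 `<=` A)%fset -> `|l - \sum_(i <- A) a i| <= e.
Proof.
move=> ab be al A A0A.
pose c i := if i \in A then 0 else a i.
have cA i : a i = (if i \in A then a i else 0) + c i.
  by rewrite /c; case: ifP; rewrite ?addr0 ?add0r.
have fin : sum_to (fun i => if i \in A then a i else 0) (\sum_(i <- A) a i).
  apply/sum_toP => e' e'0; exists A => B AB.
  rewrite (big_fset_subE _ AB).
  have -> : \sum_(i <- (B `\` A)%fset) (if i \in A then a i else 0) = 0.
    by rewrite big_seq big1 // => i; rewrite !inE => /andP[/negbTE ->].
  have -> : \sum_(i <- A) (if i \in A then a i else 0) = \sum_(i <- A) a i.
    by rewrite big_seq [RHS]big_seq; apply: eq_bigr => i ->.
  by rewrite addr0 subrr normr0 ltW.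
have : sum_to c (l - \sum_(i <- A) a i).
  have -> : c = (fun i => a i + (-1) * (if i \in A then a i else 0)).
    by apply/funext => i; rewrite {1}cA; ring.
  by rewrite -[X in l + X]mulN1r; apply: sum_toD al _; exact: (@sum_toZ _ _ _ _ (-1) fin).
apply: sum_to_le; exists fset0 => B _.
rewrite (big_fsetIDE B A) [X in X + _]big_seq [X in X + _]big1 ?add0r; last first.
  by move=> i; rewrite !inE /c => /andP[_ ->].
apply: le_trans (be (B `\` A)%fset _).
  rewrite (le_trans (ler_norm_sum _ _ _)) //; apply: ler_sum => i _.
  by rewrite /c; case: ifP => // _; rewrite normr0 (le_trans _ (ab i)).
by apply/fdisjointP => i; rewrite !inE => /andP[/negP iA _]; apply/negP => /(fsubsetP A0A).
Qed.

Definition mdeg r (m : {ffun 'I_r -> nat}) : nat := \sum_k m k.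

(* [C] bounds the weighted l^1-norm of the coefficients, so that power series
   with this property form a Banach algebra of functions on the closed cube. *)
Definition power_series (R : realType) r (rho C : R) (f : 'rV[R]_r -> R) :=
  exists2 c : {ffun 'I_r -> nat} -> R,
    abs_sum_le (fun m => c m * rho ^+ mdeg m) C &
    forall x, `|x| <= rho -> sum_to (fun m => c m * monomial m x) (f x).

Lemma monomial_norm_le (R : realType) r (rho : R) m (x : 'rV[R]_r) :
  `|x| <= rho -> `|monomial m x| <= rho ^+ mdeg m.
Proof.
move=> xr; have r0 : 0 <= rho by rewrite (le_trans _ xr).
rewrite /monomial normr_prod /mdeg -prodrXr; apply: ler_prod => k _.
by rewrite normr_ge0 normrX lerXn2r ?nnegrE // (le_trans (rV_coord_le _ _)).
Qed.

Lemma monomialM (R : realType) r (m p : {ffun 'I_r -> nat}) (x : 'rV[R]_r) :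
  monomial [ffun k => m k + p k]%N x = monomial m x * monomial p x.
Proof.
by rewrite /monomial -big_split; apply: eq_bigr => k _; rewrite ffunE exprD.
Qed.

Lemma mdegD r (m p : {ffun 'I_r -> nat}) :
  mdeg [ffun k => m k + p k]%N = (mdeg m + mdeg p)%N.
Proof. by rewrite /mdeg -big_split; apply: eq_bigr => k _; rewrite ffunE. Qed.

Lemma power_series_term_le (R : realType) r (rho c : R) m (x : 'rV[R]_r) :
  `|x| <= rho -> `|c * monomial m x| <= `|c * rho ^+ mdeg m|.
Proof.
move=> xr; have r0 : 0 <= rho by rewrite (le_trans _ xr).
rewrite !normrM ler_wpM2l // [leRHS]ger0_norm ?exprn_ge0 //.
exact: monomial_norm_le.
Qed.

Lemma power_series_ge0 (R : realType) r (rho C : R) (f : 'rV[R]_r -> R) :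
  power_series rho C f -> 0 <= C.
Proof. by case=> c cC _; exact: abs_sum_le_ge0 cC. Qed.

Lemma power_series_bound (R : realType) r (rho C : R) (f : 'rV[R]_r -> R) x :
  power_series rho C f -> `|x| <= rho -> `|f x| <= C.
Proof.
move=> [c cC fc] xr; apply: sum_to_abs_le (fc x xr) => A; apply: le_trans (cC A).
by apply: ler_sum => m _; exact: power_series_term_le.
Qed.

Lemma power_series_le (R : realType) r (rho rho' C C' : R) (f : 'rV[R]_r -> R) :
  0 <= rho' -> rho' <= rho -> C <= C' -> power_series rho C f ->
  power_series rho' C' f.
Proof.
move=> r0 rr CC [c cC fc]; exists c => [A|x xr]; last by apply: fc; exact: le_trans rr.
apply: le_trans CC; apply: le_trans (cC A); apply: ler_sum => m _.
rewrite !normrM ler_wpM2l // !ger0_norm ?exprn_ge0 ?(le_trans r0 rr) //.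
by rewrite lerXn2r ?nnegrE // (le_trans r0 rr).
Qed.

Lemma power_series_ext (R : realType) r (rho C : R) (f g : 'rV[R]_r -> R) :
  (forall x, `|x| <= rho -> f x = g x) -> power_series rho C f ->
  power_series rho C g.
Proof. by move=> fg [c cC fc]; exists c => // x xr; rewrite -fg //; exact: fc. Qed.

Lemma power_series_monomial (R : realType) r (rho a C : R) p : 0 <= rho ->
  `|a| * rho ^+ mdeg p <= C ->
  power_series rho C (fun x : 'rV[R]_r => a * monomial p x).
Proof.
move=> r0 aC; exists (fun m => if m == p then a else 0) => [A|x _].
  apply: le_trans aC; have [pA|pA] := boolP (p \in A).
    rewrite (big_fsetD1 p) //= eqxx big_seq big1 ?addr0.
      by rewrite normrM [X in _ * X]ger0_norm ?exprn_ge0.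
    by move=> i; rewrite !inE => /andP[/negbTE -> _]; rewrite mul0r normr0.
  rewrite big_seq big1 ?mulr_ge0 ?exprn_ge0 // => m mA.
  by case: eqP mA pA => [-> ->|]; rewrite // mul0r normr0.
have -> : (fun m => (if m == p then a else 0) * monomial m x) =
    (fun m => if m == p then a * monomial p x else 0).
  by apply/funext => m; case: eqP => [->|]; rewrite ?mul0r.
exact: sum_to_delta.
Qed.

(* Fubini for absolutely summable families of power series. *)
Lemma power_series_sum (R : realType) r (rho C : R) (I : choiceType)
    (K : I -> R) (F : I -> 'rV[R]_r -> R) (f : 'rV[R]_r -> R) : 0 < rho ->
  (forall i, power_series rho (K i) (F i)) ->
  (forall A : {fset I}, \sum_(i <- A) K i <= C) ->
  (forall x, `|x| <= rho -> sum_to (fun i => F i x) (f x)) ->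
  power_series rho C f.
Proof.
move=> r0 FK KC Ff.
have K0 i : 0 <= K i := power_series_ge0 (FK i).
have /choice[c cP] : forall i, exists c : {ffun 'I_r -> nat} -> R,
    abs_sum_le (fun m => c m * rho ^+ mdeg m) (K i) /\
    forall x, `|x| <= rho -> sum_to (fun m => c m * monomial m x) (F i x).
  by move=> i; have [c ? ?] := FK i; exists c.
have cK i m : `|c i m| * rho ^+ mdeg m <= K i.
  have [/(_ [fset m]%fset)] := cP i.
  by rewrite big_seq_fset1 normrM [X in _ * X]ger0_norm // exprn_ge0 // ltW.
have KabsC : abs_sum_le K C.
  by move=> A; apply: le_trans (KC A); apply: ler_sum => i _; rewrite ger0_norm.
have /choice[d dP] : forall m, exists l, sum_to (fun i => c i m) l.
  move=> m; apply: (@sum_to_ex _ _ _ (C / rho ^+ mdeg m)) => A.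
  rewrite ler_pdivlMr ?exprn_gt0 // mulr_suml; apply: le_trans (KC A).
  by apply: ler_sum => i _; exact: cK.
exists d => [A|x xr].
  (* The signs turn [|d m|] into a linear expression, so that a finite sum of absolute values is the
     sum over [i] of a family bounded by [K]. *)
  pose s m := Num.sg (d m) * rho ^+ mdeg m.
  have -> : \sum_(m <- A) `|d m * rho ^+ mdeg m| = \sum_(m <- A) s m * d m.
    apply: eq_bigr => m _; rewrite normrM [X in _ * X]ger0_norm ?exprn_ge0 ?ltW //.
    by rewrite /s mulrAC -normrEsg.
  apply: le_trans (ler_norm _) _.
  have := @sum_to_sum _ _ _ A (fun m i => s m * c i m) (fun m => s m * d m).
  move=> /(_ (fun m => @sum_toZ _ _ _ _ (s m) (dP m))).
  apply: sum_to_abs_le => J; apply: le_trans (KC J); apply: ler_sum => i _.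
  have [cKi _] := cP i; apply: le_trans (cKi A).
  apply: le_trans (ler_norm_sum _ _ _) _; apply: ler_sum => m _.
  rewrite /s -mulrA [rho ^+ _ * _]mulrC normrM ler_piMl // normr_sg.
  by case: (_ != 0); rewrite ?ler01.
apply/sum_toP => e e0.
(* [J] leaves less than [e / 4] of the total of [K]. Outside [J] each error is at most [2 * K i], in
   total [e / 2]; for the finitely many [i] in [J] the errors are made small one by one, for another
   [e / 2]. *)
have e4 : 0 < e / 4 by rewrite divr_gt0.
have [J JP] := abs_sum_le_tail KabsC e4.
have eJ : 0 < e / (2 * (size J).+1%:R) by rewrite divr_gt0 // mulr_gt0.
have /choice[A AP] : forall i, exists A0 : {fset {ffun 'I_r -> nat}},
    forall A, (A0 `<=` A)%fset ->
    `|F i x - \sum_(m <- A) c i m * monomial m x| <= e / (2 * (size J).+1%:R).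
  by move=> i; have [_ /(_ x xr)/sum_toP/(_ _ eJ)] := cP i.
exists (\bigcup_(i <- J) A i)%fset => B AB.
pose g i := F i x + (-1) * \sum_(m <- B) c i m * monomial m x.
have gsum : sum_to g (f x - \sum_(m <- B) d m * monomial m x).
  rewrite -[X in f x + X]mulN1r; apply: sum_toD; first exact: Ff.
  apply: (@sum_toZ _ _ (fun i => \sum_(m <- B) c i m * monomial m x)).
  apply: sum_to_sum => m; rewrite mulrC.
  by under eq_fun do rewrite mulrC; exact: sum_toZ.
have gK i : `|g i| <= 2 * K i.
  have [cKi cFi] := cP i.
  rewrite /g mulN1r (le_trans (ler_normB _ _)) // mulr_natl mulr2n lerD //.
    exact: power_series_bound (FK i) xr.
  apply: le_trans (ler_norm_sum _ _ _) _; apply: le_trans (cKi B).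
  by apply: ler_sum => m _; exact: power_series_term_le.
apply: sum_to_abs_le gsum => L; rewrite (big_fsetIDE L J).
rewrite [leRHS](splitr e); apply: lerD.
  apply: (@le_trans _ _ (\sum_(i <- J) e / (2 * (size J).+1%:R))).
    apply: (@le_trans _ _ (\sum_(i <- (L `&` J)%fset) e / (2 * (size J).+1%:R))).
      rewrite big_seq [leRHS]big_seq; apply: ler_sum => i.
      rewrite inE => /andP[_ iJ]; rewrite /g mulN1r; apply: AP.
      by apply: fsubset_trans AB; exact: bigfcup_sup.
    by apply: ler_fset_sum; [move=> _; exact: ltW|exact: fsubsetIr].
  rewrite big_const_seq count_predT iter_addr addr0 -[_ *+ _]mulr_natr.
  have -> : e / (2 * (size J).+1%:R) * (size J)%:R =
     e / 2 * ((size J)%:R / (size J).+1%:R) by field.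
  rewrite ler_piMr ?divr_ge0 ?(ltW e0) // ler_pdivrMr // mul1r ler_nat //.
apply: (@le_trans _ _ (\sum_(i <- (L `\` J)%fset) 2 * K i)).
  by apply: ler_sum => i _; exact: gK.
rewrite -mulr_sumr; have : \sum_(i <- (L `\` J)%fset) K i <= e / 4.
  under eq_bigr do rewrite -[K _]ger0_norm //; apply: JP.
  by apply/fdisjointP => i; rewrite !inE => /andP[].
lra.
Qed.

Lemma power_series_cst (R : realType) r (rho a : R) : 0 <= rho ->
  power_series rho `|a| (fun _ : 'rV[R]_r => a).
Proof.
move=> r0; pose p : {ffun 'I_r -> nat} := [ffun=> 0%N].
have mp : mdeg p = 0%N by rewrite /mdeg big1 // => k _; rewrite ffunE.
apply: (@power_series_ext _ _ _ _ (fun x => a * monomial p x)).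
  by move=> x _; rewrite /monomial big1 ?mulr1 // => k _; rewrite ffunE expr0.
by apply: power_series_monomial; rewrite // mp expr0 mulr1.
Qed.

Lemma power_series_coord (R : realType) r (rho : R) (k : 'I_r) : 0 <= rho ->
  power_series rho rho (fun x : 'rV[R]_r => x 0 k).
Proof.
move=> r0; pose p : {ffun 'I_r -> nat} := [ffun j => (j == k : nat)].
have mp : mdeg p = 1%N.
  by rewrite /mdeg (bigD1 k) //= ffunE eqxx big1 // => j /negbTE jk; rewrite ffunE jk.
apply: (@power_series_ext _ _ _ _ (fun x => 1 * monomial p x)).
  move=> x _; rewrite /monomial mul1r (bigD1 k) //= ffunE eqxx expr1 big1 ?mulr1 //.
  by move=> j /negbTE jk; rewrite ffunE jk expr0.
by apply: power_series_monomial; rewrite // mp expr1 normr1 mul1r.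
Qed.

Lemma power_seriesD (R : realType) r (rho C D : R) (f g : 'rV[R]_r -> R) :
  power_series rho C f -> power_series rho D g ->
  power_series rho (C + D) (fun x => f x + g x).
Proof.
move=> [c cC fc] [d dD gd]; exists (fun m => c m + d m) => [A|x xr].
  apply: le_trans (lerD (cC A) (dD A)); rewrite -big_split; apply: ler_sum => m _.
  by rewrite mulrDl; exact: ler_normD.
have -> : (fun m => (c m + d m) * monomial m x) =
    (fun m => c m * monomial m x + d m * monomial m x).
  by apply/funext => m; rewrite mulrDl.
by apply: sum_toD; [exact: fc|exact: gd].
Qed.

(** The Cauchy product is obtained in two summations, by [power_series_sum]: first a single monomial
    times [g], then the sum over the monomials of [f]. *)
Lemma power_seriesM_monomial (R : realType) r (rho D a : R) p (g : 'rV[R]_r -> R) :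
  0 < rho -> power_series rho D g ->
  power_series rho (`|a| * rho ^+ mdeg p * D) (fun x => a * monomial p x * g x).
Proof.
move=> r0 [d dD gd]; have r0' := ltW r0.
apply: (@power_series_sum _ _ _ _ _
  (fun m => `|a| * rho ^+ mdeg p * `|d m * rho ^+ mdeg m|)
  (fun m x => (a * d m) * monomial [ffun k => m k + p k]%N x)) => //.
- move=> m; apply: power_series_monomial => //.
  rewrite !normrM mdegD exprD (ger0_norm (exprn_ge0 _ r0')).
  by rewrite le_eqVlt; apply/orP; left; apply/eqP; ring.
- by move=> A; rewrite -mulr_sumr ler_wpM2l // mulr_ge0 ?exprn_ge0.
move=> x xr; have := @sum_toZ _ _ _ _ (a * monomial p x) (gd x xr).
by apply: sum_to_ext => m; rewrite monomialM; ring.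
Qed.

Lemma power_seriesM (R : realType) r (rho C D : R) (f g : 'rV[R]_r -> R) :
  0 < rho -> power_series rho C f -> power_series rho D g ->
  power_series rho (C * D) (fun x => f x * g x).
Proof.
move=> r0 [c cC fc] gD; have D0 := power_series_ge0 gD.
apply: (@power_series_sum _ _ _ _ _ (fun m => `|c m| * rho ^+ mdeg m * D)
  (fun m x => c m * monomial m x * g x)) => //.
- by move=> m; exact: power_seriesM_monomial.
- move=> A; rewrite -mulr_suml ler_wpM2r //; apply: le_trans (cC A).
  apply: ler_sum => m _; rewrite normrM ler_wpM2l //; exact: ler_norm.
move=> x xr; rewrite mulrC; have := @sum_toZ _ _ _ _ (g x) (fc x xr).
by apply: sum_to_ext => m; rewrite mulrC.
Qed.

Lemma power_series_exp (R : realType) r (rho C : R) (f : 'rV[R]_r -> R) n :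
  0 < rho -> power_series rho C f -> power_series rho (C ^+ n) (fun x => f x ^+ n).
Proof.
move=> r0 fC; elim: n => [|n IH].
  by rewrite expr0 -(normr1 R); apply: power_series_cst; exact: ltW.
rewrite exprS.
have -> : (fun x => f x ^+ n.+1) = (fun x => f x * f x ^+ n).
  by apply/funext => x; rewrite exprS.
exact: power_seriesM.
Qed.

Lemma power_series_prod (R : realType) r (rho : R) (J : Type) (s : seq J)
    (C : J -> R) (f : J -> 'rV[R]_r -> R) : 0 < rho ->
  (forall j, power_series rho (C j) (f j)) ->
  power_series rho (\prod_(j <- s) C j) (fun x => \prod_(j <- s) f j x).
Proof.
move=> r0 fC; elim: s => [|j s IH].
  rewrite big_nil -(normr1 R).
  apply: power_series_ext (power_series_cst r 1 (ltW r0)) => x _.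
  by rewrite big_nil normr1.
rewrite big_cons; apply: power_series_ext (power_seriesM r0 (fC j) IH) => x _.
by rewrite big_cons.
Qed.

(** Each coordinate of [Phi] has norm at most [rho], so a monomial of degree [d] in them has norm at
    most [rho ^ d]: the substituted series is dominated term by term by the series of [f]. *)
Lemma power_series_comp (R : realType) q r (rho rho' C : R) (f : 'rV[R]_q -> R)
    (Phi : 'rV[R]_r -> 'rV[R]_q) : 0 <= rho -> 0 < rho' ->
  power_series rho C f ->
  (forall j, power_series rho' rho (fun x => Phi x 0 j)) ->
  power_series rho' C (fun x => f (Phi x)).
Proof.
move=> r0 r'0 [c cC fc] PC.
apply: (@power_series_sum _ _ _ _ _ (fun m => `|c m * rho ^+ mdeg m|)
  (fun m x => c m * monomial m (Phi x))) => //.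
- move=> m; rewrite normrM [X in _ * X]ger0_norm ?exprn_ge0 //.
  apply: power_seriesM => //; first by apply: power_series_cst; exact: ltW.
  rewrite /mdeg -prodrXr; apply: power_series_prod => // k.
  exact: power_series_exp.
move=> x xr; apply: fc; apply/rV_norm_le => // k.
exact: power_series_bound (PC k) xr.
Qed.

(* The constant term being zero, every monomial gains a factor [rho' / rho]. *)
Lemma power_series_shrink (R : realType) r (rho rho' C : R) (f : 'rV[R]_r -> R) :
  f 0 = 0 -> 0 <= rho' -> rho' <= rho -> 0 < rho -> power_series rho C f ->
  power_series rho' (C * (rho' / rho)) f.
Proof.
move=> f0 r'0 rr r0 [c cC fc].
have c0 m : mdeg m = 0%N -> c m = 0.
  move=> m0; have mE : m = [ffun=> 0%N].
    apply/ffunP => k; rewrite ffunE; apply/eqP.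
    by have /eqP := m0; rewrite /mdeg sum_nat_eq0 => /forallP/(_ k).
  have := fc 0; rewrite normr0 f0 (ltW r0) => /(_ isT) H.
  apply: sum_to_unique H; rewrite mE.
  have -> : (fun m => c m * monomial m (0 : 'rV[R]_r)) =
      (fun m => if m == [ffun=> 0%N] then c [ffun=> 0%N] else 0).
    apply/funext => p; case: eqP => [->|p0].
      by rewrite /monomial big1 ?mulr1 // => k _; rewrite ffunE.
    have [k pk] : exists k, p k != 0%N.
      apply/existsP; rewrite -negb_forall; apply/negP => /forallP H'.
      by apply: p0; apply/ffunP => k; rewrite ffunE; apply/eqP.
    by rewrite /monomial (bigD1 k) //= mxE expr0n (negbTE pk) mul0r mulr0.
  exact: sum_to_delta.
exists c => [A|x xr]; last by apply: fc; exact: le_trans rr.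
apply: (@le_trans _ _ ((\sum_(m <- A) `|c m * rho ^+ mdeg m|) * (rho' / rho))).
  rewrite mulr_suml; apply: ler_sum => m _.
  case mE : (mdeg m) => [|n]; first by rewrite c0 // !mul0r normr0 mul0r.
  rewrite !normrM (ger0_norm (exprn_ge0 _ (ltW r0))) (ger0_norm (exprn_ge0 _ r'0)).
  rewrite -mulrA ler_wpM2l //.
  have -> : rho ^+ n.+1 * (rho' / rho) = rho ^+ n * rho'.
    by rewrite exprSr; field; rewrite gt_eqF.
  by rewrite exprSr ler_wpM2r // lerXn2r ?nnegrE // ltW.
by rewrite ler_wpM2r // divr_ge0 // ltW.
Qed.

(** * Hadamard quotients, differentiation and recentring of power series *)

(** Monomials free of [z_k] make up the restriction to [z_k = 0]; from the others one factor [z_k]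
    is removed. The degree lost costs the factor [1 / rho] in the norm. *)
Lemma power_series_hadamard (R : realType) r (k : 'I_r) (rho C : R)
    (F : 'rV[R]_r -> R) : 0 < rho -> power_series rho C F ->
  exists2 Q, power_series rho (C / rho) Q &
    forall z, `|z| <= rho ->
      F z = F (\row_j (if j == k then 0 else z 0 j)) + z 0 k * Q z.
Proof.
move=> r0 [c cC Fc]; have r0' := ltW r0.
pose lower (m : {ffun 'I_r -> nat}) := [ffun j => (m j - (j == k))%N].
pose one : {ffun 'I_r -> nat} := [ffun j => (j == k : nat)].
have oneE : forall z : 'rV[R]_r, monomial one z = z 0 k.
  move=> z; rewrite /monomial (bigD1 k) //= ffunE eqxx expr1 big1 ?mulr1 //.
  by move=> j /negbTE jk; rewrite ffunE jk expr0.
have lowerK (m : {ffun 'I_r -> nat}) : m k != 0%N -> m = [ffun j => lower m j + one j]%N.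
  move=> mk; apply/ffunP => j; rewrite !ffunE; case: eqP => [->|_] /=.
    by rewrite subnK // lt0n.
  by rewrite subn0 addn0.
have monE (m : {ffun 'I_r -> nat}) (z : 'rV[R]_r) :
    m k != 0%N -> monomial m z = z 0 k * monomial (lower m) z.
  by move=> /lowerK {1}->; rewrite monomialM oneE mulrC.
have degE (m : {ffun 'I_r -> nat}) : m k != 0%N -> mdeg m = (mdeg (lower m)).+1.
  move=> /lowerK {1}->; rewrite mdegD -addn1; congr (_ + _)%N.
  rewrite /mdeg (bigD1 k) //= ffunE eqxx big1 // => j /negbTE jk.
  by rewrite ffunE jk.
pose b (m : {ffun 'I_r -> nat}) := if m k == 0%N then 0 else c m.
pose G m (z : 'rV[R]_r) := b m * monomial (lower m) z.
have bK m : `|b m| * rho ^+ mdeg (lower m) <= `|c m * rho ^+ mdeg m| / rho.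
  rewrite /b; case: ifPn => [_|mk]; first by rewrite normr0 mul0r divr_ge0.
  rewrite normrM (ger0_norm (exprn_ge0 _ r0')) (degE _ mk) exprSr -mulrA -mulrA.
  by rewrite divff ?gt_eqF // mulr1.
have GP m : power_series rho (`|c m * rho ^+ mdeg m| / rho) (G m).
  exact: power_series_monomial.
have KC (A : {fset {ffun 'I_r -> nat}}) :
    \sum_(m <- A) `|c m * rho ^+ mdeg m| / rho <= C / rho.
  by rewrite -mulr_suml ler_wpM2r ?invr_ge0.
have /choice[Q QP] : forall z, exists l, `|z| <= rho -> sum_to (fun m => G m z) l.
  move=> z; have [zr|] := leP `|z| rho; last by exists 0.
  have [|l lP] := @sum_to_ex _ _ (fun m => G m z) (C / rho).
    move=> A; apply: le_trans (KC A); apply: ler_sum => m _.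
    exact: power_series_bound (GP m) zr.
  by exists l.
exists Q; first exact: power_series_sum r0 GP KC QP.
move=> z zr; set z0 := \row_j _.
have z0r : `|z0| <= rho.
  apply/rV_norm_le => // j; rewrite mxE; case: ifP => _; first by rewrite normr0.
  by rewrite (le_trans (rV_coord_le _ _)).
have := sum_toD (Fc _ z0r) (@sum_toZ _ _ _ _ (z 0 k) (QP z zr)).
apply: sum_to_unique; apply: sum_to_ext (Fc z zr) => m.
have [mk|mk] := eqVneq (m k) 0%N.
  rewrite /G /b mk eqxx mul0r mulr0 addr0; congr (_ * _).
  apply: eq_bigr => j _; rewrite mxE; case: eqP => // ->.
  by rewrite mk !expr0.
rewrite /G /b (negbTE mk) monE // [monomial m z0]monE // mxE eqxx mul0r mulr0 add0r.
by rewrite mulrCA.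
Qed.

(** Hadamard's lemma in the extra variable [h] is applied to [f(x + h e_k)], which is a power series
    in [(x, h)] on the cube of half the radius. A second application, to [Q], shows that the
    difference quotient [Q(x, h)] differs from [Q(x, 0)] by [O(h)]. *)
Lemma power_series_increment (R : realType) r (k : 'I_r) (rho C : R)
    (f : 'rV[R]_r -> R) : 0 < rho -> power_series rho C f ->
  exists Q, exists2 D, power_series (rho / 2) D Q &
    (forall x h, `|x| <= rho / 2 -> `|h| <= rho / 2 ->
       f (x + h *: delta_mx 0 k) = f x + h * Q (join x h)) /\
    (forall x, `|x| <= rho / 2 ->
       is_derive x (delta_mx 0 k) f (Q (join x 0))).
Proof.
move=> r0 fC; have r2 : 0 < rho / 2 by rewrite divr_gt0.
have joinle (x : 'rV[R]_r) y :
    `|x| <= rho / 2 -> `|y| <= rho / 2 -> `|join x y| <= rho / 2.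
  move=> xr yr; apply/rV_norm_le; first exact: ltW.
  move=> j; case: (split_ordP j) => i ->; last by rewrite ord1 joinr.
  by rewrite joinl (le_trans (rV_coord_le _ _)).
pose F (z : 'rV[R]_(r + 1)) :=
  f (lsubmx z + z 0 (rshift r 0) *: delta_mx 0 k).
have FC : power_series (rho / 2) C F.
  apply: power_series_comp (fC) _ => // [|j]; first exact: ltW.
  apply: (@power_series_le _ _ (rho / 2) _ (rho / 2 + rho / 2 * `|(j == k)%:R|)).
  - exact: ltW.
  - by [].
  - rewrite [leRHS](splitr rho) lerD2l ler_piMr ?(ltW r2) //.
    by case: (j == k); rewrite ?normr1 ?normr0.
  apply: (@power_series_ext _ _ _ _
    (fun z => z 0 (lshift 1 j) + z 0 (rshift r 0) * (j == k)%:R)).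
    by move=> z _; rewrite coord_line mxE.
  apply: power_seriesD; first by apply: power_series_coord; exact: ltW.
  apply: power_seriesM => //; first by apply: power_series_coord; exact: ltW.
  by apply: power_series_cst; exact: ltW.
have FE x h : F (join x h) = f (x + h *: delta_mx 0 k).
  by rewrite /F joinr /join row_mxKl.
have join_last (x : 'rV[R]_r) h :
    \row_j (if j == rshift r 0 then 0 else join x h 0 j) = join x 0.
  apply/rowP => j; rewrite mxE; case: (split_ordP j) => i ->.
    by rewrite eq_lrshift !joinl.
  by rewrite ord1 eqxx joinr.
have [Q QC QE] := power_series_hadamard (rshift r 0) r2 FC.
have [Q2 Q2C Q2E] := power_series_hadamard (rshift r 0) r2 QC.
have incr x h : `|x| <= rho / 2 -> `|h| <= rho / 2 ->
    f (x + h *: delta_mx 0 k) = f x + h * Q (join x h).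
  move=> xr hr; have := QE _ (joinle _ _ xr hr).
  by rewrite join_last joinr !FE scale0r addr0.
exists Q, (C / (rho / 2)) => //; split=> // x xr.
suff L : h^-1 *: (f (h *: delta_mx 0 k + x) - f x) @[h --> 0^'] --> Q (join x 0).
  apply: DeriveDef; last by apply/cvg_lim.
  by apply/cvg_ex; exists (Q (join x 0)).
pose D2 := C / (rho / 2) / (rho / 2).
have D20 : 0 <= D2 := power_series_ge0 Q2C.
have hsmall (a : R) : 0 < a -> \forall h \near 0^', `|h : R| <= a.
  move=> a0; apply: nbhs_dnbhs; apply/nbhs_normP; exists a => //= y.
  by rewrite /= sub0r normrN => /ltW.
apply/cvgrPdist_le => e e0; near=> h.
have h0 : h != 0 by near: h; exact: nbhs_dnbhs_neq.
have hr : `|h| <= rho / 2 by near: h; exact: hsmall.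
have he : `|h| <= e / (D2 + 1).
  by near: h; apply: hsmall; rewrite divr_gt0 // ltr_wpDl.
rewrite (addrC (h *: _)) incr // (addrC (f x)) addrK.
rewrite [_ *: _]mulrA mulVf // mul1r (Q2E (join x h)); last exact: joinle.
rewrite join_last joinr opprD addrA subrr sub0r normrN normrM.
apply: (@le_trans _ _ (e / (D2 + 1) * D2)).
  by rewrite ler_pM //; exact: power_series_bound Q2C (joinle _ _ xr hr).
by rewrite mulrAC ler_pdivrMr ?ltr_wpDl // ler_wpM2l ?ltW // ltrDl.
Unshelve. all: by end_near. Qed.

Lemma power_series_joinl0 (R : realType) r (rho D : R) (Q : 'rV[R]_(r + 1) -> R) :
  0 < rho -> power_series rho D Q -> power_series rho D (fun x => Q (join x 0)).
Proof.
move=> r0 QD; apply: power_series_comp QD _ => // [|j]; first exact: ltW.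
case: (split_ordP j) => i ->.
  apply: (@power_series_ext _ _ _ _ (fun z => z 0 i)) => [z _|].
    by rewrite joinl.
  by apply: power_series_coord; exact: ltW.
apply: (@power_series_ext _ _ _ _ (fun=> 0)) => [z _|].
  by rewrite ord1 joinr.
apply: (@power_series_le _ _ rho _ `|0 : R|) => //; rewrite ?normr0 ?ltW //.
by rewrite -{1}(normr0 R); apply: power_series_cst; exact: ltW.
Qed.

(** Recentring is composition with [z |-> p + z], whose coordinates have norm at most
    [|p| + (rho - |p|) = rho]. *)
Lemma power_series_translate (R : realType) r (rho C : R) (f : 'rV[R]_r -> R) p :
  `|p| < rho -> power_series rho C f ->
  power_series (rho - `|p|) C (fun z => f (p + z)).
Proof.
move=> pr fC; have r0 : 0 < rho by rewrite (le_lt_trans _ pr).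
have pr' : 0 < rho - `|p| by rewrite subr_gt0.
apply: power_series_comp (fC) _ => // [|j]; first exact: ltW.
apply: (@power_series_le _ _ (rho - `|p|) _ (`|p 0 j| + (rho - `|p|))) => //.
- exact: ltW.
- by have := rV_coord_le p j; lra.
apply: (@power_series_ext _ _ _ _ (fun z => p 0 j + z 0 j)) => [z _|].
  by rewrite mxE.
apply: power_seriesD; first by apply: power_series_cst; exact: ltW.
by apply: power_series_coord; exact: ltW.
Qed.

Lemma is_derive_translate (R : realType) r (f : 'rV[R]_r -> R) (p z v : 'rV[R]_r) df :
  is_derive z v (fun y => f (p + y)) df -> is_derive (p + z) v f df.
Proof.
have E : (fun h : R => h^-1 *: (f (p + (h *: v + z)) - f (p + z))) =
    (fun h : R => h^-1 *: (f (h *: v + (p + z)) - f (p + z))).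
  by apply/funext => h; rewrite addrCA.
by case; rewrite /derivable /derive /= E => ? ?; apply: DeriveDef.
Qed.

(** An expansion is assumed around every point of [U], because this condition passes to the partial
    derivatives and so allows induction on [n]. Continuity at [p] follows from the shrinking of
    [f(p + z) - f(p)], which has no constant term. *)
Lemma power_series_Ck (R : realType) r (U : set 'rV[R]_r) n (f : 'rV[R]_r -> R) :
  open U ->
  (forall p, U p -> exists rho, exists2 C, 0 < rho &
     power_series rho C (fun z => f (p + z))) ->
  Ck n U f.
Proof.
move=> oU; elim: n f => [|n IH] f fU.
  split=> // p Up; have [rho [C r0 fC]] := fU p Up.
  apply: continuous_dist => e e0.
  have gC : power_series rho (C + `|- f p|) (fun z => f (p + z) + - f p).
    by apply: power_seriesD fC _; apply: power_series_cst; exact: ltW.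
  pose K := C + `|- f p|; have K0 : 0 <= K := power_series_ge0 gC.
  have m0 : 0 < Num.min rho (e / ((K + 1) / rho)).
    by rewrite lt_min r0 !divr_gt0 // ltr_wpDl.
  apply/nbhs_normP; exists (Num.min rho (e / ((K + 1) / rho))) => // y py.
  have {py} : `|p - y| < Num.min rho (e / ((K + 1) / rho)) by [].
  rewrite lt_min => /andP[py1 py2]; rewrite distrC in py1; rewrite distrC.
  have g0 : f (p + 0) + - f p = 0 by rewrite addr0 subrr.
  have H := power_series_shrink g0 (normr_ge0 (y - p)) (ltW py1) r0 gC.
  have := power_series_bound H (lexx _); rewrite (addrC p) subrK => H'.
  rewrite -/K in H'; rewrite (le_lt_trans H') //.
  rewrite ltr_pdivlMr ?divr_gt0 ?ltr_wpDl // distrC in py2.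
  apply: le_lt_trans py2.
  have -> : K * (`|y - p| / rho) = `|y - p| * (K / rho) by ring.
  by rewrite ler_wpM2l // ler_wpM2r ?invr_ge0 ?(ltW r0) // lerDl.
have D p k : U p -> exists f' rho, exists2 C, 0 < rho & power_series rho C f' /\
    forall z, `|z| <= rho -> is_derive (p + z) (delta_mx 0 k) f (f' z).
  move=> Up; have [rho [C r0 fC]] := fU p Up.
  have [Q [C' QC [_ dQ]]] := power_series_increment k r0 fC.
  have r2 : 0 < rho / 2 by rewrite divr_gt0.
  exists (fun z => Q (join z 0)), (rho / 2), C' => //; split.
    exact: power_series_joinl0.
  by move=> z /dQ H; exact: is_derive_translate.
split=> [x Ux|]; first exact: Ck_cont (IH f fU) Ux.
move=> k; split.
  move=> p Up; have [f' [rho [C r0 [_ /(_ 0)]]]] := D p k Up.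
  by rewrite normr0 addr0 (ltW r0) => /(_ isT)[].
apply: IH => p Up; have [f' [rho [C r0 [f'C df]]]] := D p k Up.
exists rho, C => //; apply: power_series_ext f'C => z /df[_ ->] //.
Qed.

(** * Analytic germs *)

(** Convergence at the single diagonal point [(e/2, ..., e/2)] is already absolute, and each
    monomial takes there the value [(e/2)^deg]: this is the weighted bound for the radius
    [e / 2]. *)
Lemma analytic_germP (R : realType) r (f : 'rV[R]_r -> R) :
  analytic_germ f <-> exists rho, exists2 C, 0 < rho & power_series rho C f.
Proof.
split=> [[c /near0_cubeP[e e0 ec]]|[rho [C r0 [c cC cf]]]]; last first.
  by exists c; apply/near0_cubeP; exists rho => // x /ltW /cf.
have e2 : 0 < e / 2 by rewrite divr_gt0.
have e2e : e / 2 < e by rewrite ltr_pdivrMr // ltr_pMr // ltr1n.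
pose x : 'rV[R]_r := const_mx (e / 2).
have xe : `|x| < e by apply/rV_norm_lt => // k; rewrite mxE gtr0_norm.
have monx m : monomial m x = (e / 2) ^+ mdeg m.
  by rewrite /monomial /mdeg -prodrXr; apply: eq_bigr => k _; rewrite mxE.
have [C CP] := abs_sum_le_partial (ec x xe).
exists (e / 2), C => //; exists c => [A|y ye].
  by apply: le_trans (CP A); apply: ler_sum => m _; rewrite monx.
by apply: ec; exact: le_lt_trans e2e.
Qed.

Lemma analytic_germ_smooth (R : realType) r (f : 'rV[R]_r -> R) :
  analytic_germ f -> smooth_germ f.
Proof.
move=> /analytic_germP[rho [C r0 fC]]; apply/smooth_germP; exists rho => // n.
apply: power_series_Ck; first exact: ball_open.
move=> p; rewrite -ball_normE /= sub0r normrN => pr.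
by exists (rho - `|p|), C; [rewrite subr_gt0|exact: power_series_translate].
Qed.

Lemma analytic_germ_near (R : realType) r (f g : 'rV[R]_r -> R) :
  (\forall x \near (0 : 'rV[R]_r), f x = g x) -> analytic_germ f -> analytic_germ g.
Proof.
move=> fg [c fc]; exists c; apply: filterS2 fg fc => x -> //.
Qed.

Lemma analytic_germ_pair (R : realType) q r (f : 'rV[R]_q -> R) (g : 'rV[R]_r -> R) :
  analytic_germ f -> analytic_germ g -> exists rho, exists2 C, 0 < rho &
    power_series rho C f /\ power_series rho C g.
Proof.
move=> /analytic_germP[a [C a0 fC]] /analytic_germP[b [D b0 gD]].
have m0 : 0 < Num.min a b by rewrite lt_min a0.
exists (Num.min a b), (Num.max C D) => //; split.
  by apply: power_series_le fC; rewrite ?(ltW m0) ?ge_min ?le_max ?lexx.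
by apply: power_series_le gD; rewrite ?(ltW m0) ?ge_min ?le_max ?lexx ?orbT.
Qed.

Lemma analytic_germ_cst (R : realType) r (a : R) :
  analytic_germ (fun _ : 'rV[R]_r => a).
Proof.
by apply/analytic_germP; exists 1, `|a| => //; exact: power_series_cst.
Qed.

Lemma analytic_germ_coord (R : realType) r (k : 'I_r) :
  analytic_germ (fun x : 'rV[R]_r => x 0 k).
Proof. by apply/analytic_germP; exists 1, 1 => //; exact: power_series_coord. Qed.

Lemma analytic_germD (R : realType) r (f g : 'rV[R]_r -> R) :
  analytic_germ f -> analytic_germ g -> analytic_germ (fun x => f x + g x).
Proof.
move=> fa ga; have [rho [C r0 [fC gC]]] := analytic_germ_pair fa ga.
by apply/analytic_germP; exists rho, (C + C) => //; exact: power_seriesD.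
Qed.

Lemma analytic_germM (R : realType) r (f g : 'rV[R]_r -> R) :
  analytic_germ f -> analytic_germ g -> analytic_germ (fun x => f x * g x).
Proof.
move=> fa ga; have [rho [C r0 [fC gC]]] := analytic_germ_pair fa ga.
by apply/analytic_germP; exists rho, (C * C) => //; exact: power_seriesM.
Qed.

Lemma analytic_germ_partial (R : realType) r (f : 'rV[R]_r -> R) k :
  analytic_germ f -> analytic_germ ('D_(delta_mx 0 k) f).
Proof.
move=> /analytic_germP[rho [C r0 fC]].
have [Q [D QD [_ dQ]]] := power_series_increment k r0 fC.
have r2 : 0 < rho / 2 by rewrite divr_gt0.
apply/analytic_germP; exists (rho / 2), D => //.
by apply: power_series_ext (power_series_joinl0 r2 QD) => x /dQ[_ ->].
Qed.

(** Since the norm of a series without constant term shrinks at least linearly with the radius, it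
    can be made smaller than any [eta]; composition and iteration rely on this. *)
Lemma analytic_germ_small (R : realType) r (f : 'rV[R]_r -> R) eta :
  analytic_germ f -> f 0 = 0 -> 0 < eta -> exists2 d : R, 0 < d &
    forall rho, 0 < rho -> rho <= d -> power_series rho eta f.
Proof.
move=> /analytic_germP[rho0 [C r0 fC]] f0 eta0; have C0 := power_series_ge0 fC.
exists (Num.min rho0 (eta * rho0 / (C + 1))).
  by rewrite lt_min r0 divr_gt0 ?mulr_gt0 // ltr_wpDl.
move=> rho rho_gt0; rewrite le_min => /andP[rr reta].
have H := power_series_shrink f0 (ltW rho_gt0) rr r0 fC.
apply: power_series_le H => //; first exact: ltW.
rewrite ler_pdivlMr ?ltr_wpDl // in reta.
rewrite mulrA ler_pdivrMr //; apply: le_trans reta.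
by rewrite mulrC ler_wpM2l ?(ltW rho_gt0) // lerDl.
Qed.

Lemma analytic_germ_comp (R : realType) q r (f : 'rV[R]_q -> R)
    (Phi : 'rV[R]_r -> 'rV[R]_q) :
  analytic_germ f -> (forall j, analytic_germ (fun x => Phi x 0 j)) -> Phi 0 = 0 ->
  analytic_germ (fun x => f (Phi x)).
Proof.
move=> /analytic_germP[rho [C r0 fC]] Pa P0.
have /fin_all_exists2 [d d0 dP] : forall j, exists2 d : R, 0 < d &
    forall s, 0 < s -> s <= d -> power_series s rho (fun x => Phi x 0 j).
  by move=> j; apply: analytic_germ_small => //; rewrite P0 mxE.
pose m := \big[Num.min/1]_j d j.
have m0 : 0 < m by apply: lt_bigmin.
apply/analytic_germP; exists m, C => //.
apply: power_series_comp fC _ => // [|j]; first exact: ltW.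
by apply: dP => //; exact: bigmin_le.
Qed.

(** * Fixed points and the Euler integral, analytic case *)

Lemma sum_geometric_half (R : realType) (A : {fset nat}) :
  \sum_(d <- A) (2^-1 ^+ d.+1 : R) <= 1.
Proof.
pose n := (\max_(d <- A) d).+1.
have An : (A `<=` [fset d in iota 0 n])%fset.
  apply/fsubsetP => d dA; suff : d \in iota 0 n by rewrite in_fset.
  by rewrite mem_iota add0n ltnS; exact: leq_bigmax_seq.
apply: le_trans (ler_fset_sum _ An) _ => [d|]; first by rewrite exprn_ge0.
have -> : \sum_(d <- [fset d in iota 0 n]%fset) (2^-1 ^+ d.+1 : R) =
    \sum_(d <- iota 0 n) 2^-1 ^+ d.+1.
  apply: perm_big; apply: uniq_perm; rewrite ?fset_uniq ?iota_uniq // => d.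
  by rewrite in_fset.
have : \sum_(d <- iota 0 n) (2^-1 ^+ d.+1 : R) = 1 - 2^-1 ^+ n.
  elim: n {An} => [|n IH]; first by rewrite big_nil expr0 subrr.
  rewrite -addn1 iotaD big_cat /= IH big_seq1 add0n addn1 exprS.
  set a := 2^-1 ^+ n; lra.
by move=> ->; rewrite gerDl oppr_le0 exprn_ge0.
Qed.

(* The Picard iterates of [G] converge in the Banach algebra of power series:
   by Hadamard's lemma the increment of [G] in the last variable is a multiple,
   by a series of norm at most 1/2, of the increment of the variable. *)
Lemma analytic_fixed_point (R : realType) r (G : 'rV[R]_(r + 1) -> R) :
  analytic_germ G -> G 0 = 0 -> 'D_(delta_mx 0 (rshift r 0)) G 0 = 0 ->
  exists g : 'rV[R]_r -> R, [/\ analytic_germ g, g 0 = 0 &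
    \forall x \near (0 : 'rV[R]_r), G (join x (g x)) = g x].
Proof.
move=> Ga G0 DG0; have /analytic_germP[rho [C r0 GC]] := Ga.
have [Q [D QD [incr dQ]]] := power_series_increment (rshift r 0) r0 GC.
have r2 : 0 < rho / 2 by rewrite divr_gt0.
have Q0 : Q 0 = 0.
  rewrite -DG0; have [|_ ->] := dQ 0; last by rewrite join0.
  by rewrite normr0 ltW.
have Qa : analytic_germ Q by apply/analytic_germP; exists (rho / 2), D.
have half0 : 0 < 2^-1 :> R by rewrite invr_gt0.
have [d1 d10 d1P] := analytic_germ_small Qa Q0 half0.
pose s := Num.min d1 (rho / 2).
have s0 : 0 < s by rewrite lt_min d10.
have srho : s <= rho / 2 by rewrite ge_min lexx orbT.
have Qs : power_series s 2^-1 Q by apply: d1P => //; rewrite ge_min lexx.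
have G0a : analytic_germ (fun x : 'rV[R]_r => G (join x 0)).
  apply: (@analytic_germ_comp _ _ _ G (fun x => join x 0)) => //; last exact: join0.
  move=> j; case: (split_ordP j) => i ->.
    by under eq_fun do rewrite joinl; exact: analytic_germ_coord.
  have -> : (fun x : 'rV[R]_r => join x 0 0 (rshift r i)) = fun=> 0.
    by apply/funext => x; rewrite ord1 joinr.
  exact: analytic_germ_cst.
have G00 : G (join (0 : 'rV[R]_r) 0) = 0 by rewrite join0.
(* The first increment is made at most [s / 2]; halving at every step, all increments together are
   at most [s]. The iterates thus stay in the cube of radius [s], where [Q] has norm at most
   [2^-1]. *)
have s20 : 0 < s / 2 by rewrite divr_gt0.
have [d2 d20 d2P] := analytic_germ_small G0a G00 s20.
pose t := Num.min d2 s.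
have t0 : 0 < t by rewrite lt_min d20.
have ts : t <= s by rewrite ge_min lexx orbT.
have Gt : power_series t (s / 2) (fun x : 'rV[R]_r => G (join x 0)).
  by apply: d2P => //; rewrite ge_min lexx.
pose gs := fix gs (d : nat) : 'rV[R]_r -> R :=
  if d is d'.+1 then fun x => G (join x (gs d' x)) else fun=> 0.
pose Del d x := gs d.+1 x - gs d x.
have p2 d : 2^-1 ^+ d.+1 <= 2^-1 :> R.
  by rewrite exprS ler_piMr // exprn_ile1 // invf_le1 // ler1n.
have H d : power_series t (s * (1 - 2^-1 ^+ d)) (gs d) /\
    power_series t (s * 2^-1 ^+ d.+1) (Del d).
  elim: d => [|d [IH1 IH2]].
    rewrite expr0 subrr mulr0 expr1; split.
      by have := power_series_cst r (0 : R) (ltW t0); rewrite normr0.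
    by apply: power_series_ext Gt => x _; rewrite /Del /= subr0.
  have H1 : power_series t (s * (1 - 2^-1 ^+ d.+1)) (gs d.+1).
    have -> : s * (1 - 2^-1 ^+ d.+1) = s * (1 - 2^-1 ^+ d) + s * 2^-1 ^+ d.+1.
      by rewrite exprS; field.
    by apply: power_series_ext (power_seriesD IH1 IH2) => x _; rewrite /Del addrC subrK.
  split=> //.
  have IH1s : power_series t s (gs d).
    apply: power_series_le IH1 => //; first exact: ltW.
    by rewrite ler_piMr ?(ltW s0) // gerBl exprn_ge0.
  have IH2s : power_series t s (Del d).
    apply: power_series_le IH2 => //; first exact: ltW.
    by rewrite ler_piMr ?(ltW s0) // exprn_ile1 // invf_le1 // ler1n.
  have QP : power_series t 2^-1 (fun x => Q (join (join x (gs d x)) (Del d x))).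
    apply: power_series_comp Qs _ => // [|j]; first exact: ltW.
    case: (split_ordP j) => i -> {j}; last first.
      by apply: power_series_ext IH2s => x _; rewrite ord1 joinr.
    case: (split_ordP i) => j -> {i}; last first.
      by apply: power_series_ext IH1s => x _; rewrite joinl ord1 joinr.
    apply: (@power_series_ext _ _ _ _ (fun x => x 0 j)) => [x _|].
      by rewrite !joinl.
    apply: (@power_series_le _ _ t _ t) => //; first exact: ltW.
    by apply: power_series_coord; exact: ltW.
  have -> : s * 2^-1 ^+ d.+2 = s * 2^-1 ^+ d.+1 * 2^-1 by rewrite exprSr mulrA.
  apply: power_series_ext (power_seriesM t0 IH2 QP) => x xt.
  have xs : `|x| <= s := le_trans xt ts.
  have gx := power_series_bound IH1s xt; have Dx := power_series_bound IH2s xt.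
  have jx : `|join x (gs d x)| <= rho / 2.
    apply/rV_norm_le; first exact: ltW.
    move=> j; case: (split_ordP j) => i ->.
      by rewrite joinl (le_trans (rV_coord_le _ _)) // (le_trans xs).
    by rewrite ord1 joinr (le_trans gx).
  have := incr (join x (gs d x)) (Del d x) jx (le_trans Dx srho).
  rewrite -joinDr {1}/Del addrC subrK => E.
  by rewrite -[RHS]/(G (join x (gs d.+1 x)) - G (join x (gs d x))) E addrC addKr.
have sumK (A : {fset nat}) : \sum_(d <- A) s * 2^-1 ^+ d.+1 <= s.
  by rewrite -mulr_sumr ler_piMr ?(ltW s0) // sum_geometric_half.
have /choice[g gP] : forall x : 'rV[R]_r, exists l,
    `|x| <= t -> sum_to (fun d => Del d x) l.
  move=> x; have [xt|] := leP `|x| t; last by exists 0.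
  have [|l lP] := @sum_to_ex _ _ (fun d => Del d x) s.
    move=> A; apply: le_trans (sumK A); apply: ler_sum => d _.
    by apply: power_series_bound xt; have [] := H d.
  by exists l.
have gC : power_series t s g.
  by apply: (power_series_sum t0 _ sumK gP) => d; have [] := H d.
have gs_sum n x : \sum_(d <- [fset d in iota 0 n]%fset) Del d x = gs n x.
  have -> : \sum_(d <- [fset d in iota 0 n]%fset) Del d x =
      \sum_(d <- iota 0 n) Del d x.
    apply: perm_big; apply: uniq_perm; rewrite ?fset_uniq ?iota_uniq // => d.
    by rewrite in_fset.
  elim: n => [|n IH]; first by rewrite big_nil.
  by rewrite -addn1 iotaD big_cat /= IH big_seq1 add0n addn1 /Del addrC subrK.
exists g; split.
- by apply/analytic_germP; exists t, s.
- have gs0 n : gs n 0 = 0 by elim: n => //= n ->.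
  have := gP 0; rewrite normr0 (ltW t0) => /(_ isT) /sum_to_unique; apply.
  apply/sum_toP => e e0; exists fset0 => A _.
  rewrite big1 ?subr0 ?normr0 ?ltW // => d _.
  by rewrite /Del !gs0 subrr.
apply/near0_cubeP; exists t => // x /ltW xt.
apply/eqP; rewrite -subr_eq0 -normr_le0; apply/ler_addgt0Pr => e e0; rewrite add0r.
have D0 : 0 <= D := power_series_ge0 QD.
(* Both [gs n] and [gs n.+1] are within [e'] of [g] at [x]. Comparing [G(x, g x)] with
   [G(x, gs n x)] costs [e' * D], returning from [gs n.+1] to [g] costs [e']. *)
pose e' := Num.min (rho / 2) (e / (D + 1)).
have e'0 : 0 < e' by rewrite lt_min r2 divr_gt0 // ltr_wpDl.
have /sum_toP/(_ _ e'0)[A AP] := gP x xt.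
pose n := (\max_(d <- A) d).+1.
have Am m : (n <= m)%N -> `|g x - gs m x| <= e'.
  move=> nm; rewrite -gs_sum; apply: AP; apply/fsubsetP => d dA.
  suff : d \in iota 0 m by rewrite in_fset.
  by rewrite mem_iota add0n (leq_trans _ nm) // ltnS; exact: leq_bigmax_seq.
have E1 := Am n (leqnn n); have E2 := Am n.+1 (leqnSn n).
have xs : `|x| <= s := le_trans xt ts.
have gnx : `|gs n x| <= s.
  have [Hn _] := H n; apply: le_trans (power_series_bound Hn xt) _.
  by rewrite ler_piMr ?(ltW s0) // gerBl exprn_ge0.
have jx : `|join x (gs n x)| <= rho / 2.
  apply/rV_norm_le; first exact: ltW.
  move=> j; case: (split_ordP j) => i ->.
    by rewrite joinl (le_trans (rV_coord_le _ _)) // (le_trans xs).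
  by rewrite ord1 joinr (le_trans gnx).
have E1' : `|g x - gs n x| <= rho / 2 by rewrite (le_trans E1) // ge_min lexx.
have := incr (join x (gs n x)) (g x - gs n x) jx E1'.
rewrite -joinDr (addrC (gs n x)) subrK => ->; rewrite -[G _]/(gs n.+1 x).
have Qb : `|Q (join (join x (gs n x)) (g x - gs n x))| <= D.
  apply: power_series_bound QD _; apply/rV_norm_le; first exact: ltW.
  move=> j; case: (split_ordP j) => i ->; last by rewrite ord1 joinr.
  by rewrite joinl (le_trans (rV_coord_le _ _)).
have -> : gs n.+1 x + (g x - gs n x) * Q (join (join x (gs n x)) (g x - gs n x)) - g x
    = (g x - gs n x) * Q (join (join x (gs n x)) (g x - gs n x)) - (g x - gs n.+1 x).
  by ring.
apply: le_trans (ler_normB _ _) _.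
have H1 : `|(g x - gs n x) * Q (join (join x (gs n x)) (g x - gs n x))| <= e' * D.
  by rewrite normrM ler_pM.
apply: le_trans (lerD H1 E2) _.
have -> : e' * D + e' = e' * (D + 1) by rewrite mulrDr mulr1.
by rewrite -ler_pdivlMr ?ltr_wpDl // ge_min lexx orbT.
Qed.

(** Monomials are eigenvectors: the coefficient of index [m] is multiplied by
    [(a+1) / (a + 1 + wt m) <= 1], so the norm does not grow. Sum and integral are exchanged by a
    tail estimate uniform in [t]. The smaller radius keeps the points [t . x] in the open ball where
    [w] is known to be continuous. *)
Lemma power_series_euler (R : realType) r (mu : 'I_r -> nat) a (rho C : R)
    (w : 'rV[R]_r -> R) : 0 < rho -> power_series rho C w ->
  power_series (rho / 2) C (fun x => a.+1%:R * euler_integral mu a w x).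
Proof.
move=> r0 wC; have [c cC wc] := wC.
have r2 : 0 < rho / 2 by rewrite divr_gt0.
have r2r : rho / 2 < rho by rewrite ltr_pdivrMr // ltr_pMr // ltr1n.
pose wt (m : {ffun 'I_r -> nat}) := (\sum_k mu k * m k)%N.
have monE t x m : monomial m (weighted_scale mu t x : 'rV[R]_r) =
    t ^+ wt m * monomial m x.
  rewrite /wt -prodrXr -big_split /=; apply: eq_bigr => k _.
  by rewrite weighted_scaleE exprMn exprM.
have int_exp n : int01 (fun t : R => t ^+ n) = n.+1%:R^-1.
  have D (t : R) : 0 <= t <= 1 ->
      is_derive t 1 (fun t : R => n.+1%:R^-1 * t ^+ n.+1) (t ^+ n).
    move=> _; have dX : is_derive t 1 (fun t : R => t ^+ n.+1) (n.+1%:R * t ^+ n).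
      by apply: DeriveDef; [exact: exprn_derivable|rewrite exp_derive [LHS]mulr1].
    have Z := @is_deriveZ _ _ _ _ (n.+1%:R^-1) _ _ _ dX.
    apply: (@is_derive_eq _ _ _ _ _ _ _ _ Z).
    by rewrite [LHS]mulrA mulVf ?mul1r // pnatr_eq0.
  by rewrite (int01_derive (@cont01_exp R n) D) expr1n expr0n !mulr1 mulr0 subr0.
pose q m : R := a.+1%:R / (a + wt m).+1%:R.
have q0 m : 0 <= q m by rewrite divr_ge0.
have q1 m : q m <= 1 by rewrite ler_pdivrMr // mul1r ler_nat ltnS leq_addr.
exists (fun m => c m * q m) => [A|x xr].
  apply: le_trans (cC A); apply: ler_sum => m _.
  rewrite (normrM (c m * q m)) (normrM (c m) (q m)) (normrM _ (rho ^+ _)).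
  rewrite -mulrA ler_wpM2l // (ger0_norm (q0 m)).
  rewrite (ger0_norm (exprn_ge0 _ (ltW r2))) (ger0_norm (exprn_ge0 _ (ltW r0))).
  apply: (@le_trans _ _ (1 * rho ^+ mdeg m)); last by rewrite mul1r.
  rewrite ler_pM ?exprn_ge0 ?(ltW r2) // lerXn2r ?nnegrE ?(ltW r2) ?(ltW r0) //.
  exact: ltW.
have xrho : `|x| < rho by rewrite (le_lt_trans xr).
have Ux : ball (0 : 'rV[R]_r) rho x by rewrite -ball_normE /= sub0r normrN.
have w0 : Ck 0 (ball 0 rho) w.
  apply: power_series_Ck; first exact: ball_open.
  move=> p; rewrite -ball_normE /= sub0r normrN => pr.
  by exists (rho - `|p|), C; [rewrite subr_gt0|exact: power_series_translate].
apply/sum_toP => e e0.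
have e'0 : 0 < e / a.+1%:R by rewrite divr_gt0.
have [A0 A0P] := abs_sum_le_tail cC e'0.
exists A0 => A A0A.
have wtail t : 0 <= t <= 1 ->
    `|w (weighted_scale mu t x) - \sum_(m <- A) c m * (t ^+ wt m * monomial m x)|
    <= e / a.+1%:R.
  move=> t01; pose y := weighted_scale mu t x.
  have yr : `|y| <= rho by rewrite (le_trans (weighted_scale_norm _ _ t01)) // ltW.
  have := sum_to_tail (fun m => power_series_term_le (c m) m yr) A0P (wc _ yr) A0A.
  by under eq_bigr do rewrite monE.
have c1 : cont01 (fun t => t ^+ a * w (weighted_scale mu t x)).
  exact: euler_integrand_cont w0 Ux.
pose p t := \sum_(m <- A) (c m * monomial m x) * t ^+ (a + wt m).
have pc : cont01 p.
  by apply: cont01_sum => m; apply: cont01M; [exact: cont01_cst|exact: cont01_exp].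
have pI : int01 p = \sum_(m <- A) (c m * monomial m x) / (a + wt m).+1%:R.
  rewrite int01_sum => [|m]; last first.
    by apply: cont01M; [exact: cont01_cst|exact: cont01_exp].
  by apply: eq_bigr => m _; rewrite int01Z ?int_exp //; exact: cont01_exp.
have -> : \sum_(m <- A) c m * q m * monomial m x = a.+1%:R * int01 p.
  rewrite pI mulr_sumr; apply: eq_bigr => m _; rewrite /q; ring.
rewrite -mulrBr normrM ger0_norm // mulrC -ler_pdivlMr //.
have -> : euler_integral mu a w x - int01 p =
    int01 (fun t => t ^+ a * w (weighted_scale mu t x) + (-1) * p t).
  rewrite int01D //; last by apply: cont01M => //; exact: cont01_cst.
  by rewrite int01Z // mulN1r.
apply: int01_norm_le.
  by apply: cont01D => //; apply: cont01M => //; exact: cont01_cst.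
move=> t t01; have /andP[t0 t1] := t01.
have -> : t ^+ a * w (weighted_scale mu t x) + -1 * p t = t ^+ a *
    (w (weighted_scale mu t x) - \sum_(m <- A) c m * (t ^+ wt m * monomial m x)).
  rewrite mulrBr mulN1r; congr (_ - _); rewrite mulr_sumr; apply: eq_bigr => m _.
  by rewrite exprD; ring.
rewrite normrM ger0_norm ?exprn_ge0 //.
apply: le_trans (wtail t t01); rewrite ler_piMl // exprn_ile1 //.
Qed.

(** * Germs in either category *)

Lemma fun_germ_near C (R : realType) r (f g : 'rV[R]_r -> R) :
  (\forall x \near (0 : 'rV[R]_r), f x = g x) -> fun_germ C f -> fun_germ C g.
Proof. by case: C; [exact: smooth_germ_near|exact: analytic_germ_near]. Qed.

Lemma fun_germ_smooth C (R : realType) r (f : 'rV[R]_r -> R) :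
  fun_germ C f -> smooth_germ f.
Proof. by case: C => //; exact: analytic_germ_smooth. Qed.

Lemma fun_germ_cst C (R : realType) r (a : R) :
  fun_germ C (fun _ : 'rV[R]_r => a).
Proof. by case: C; [exact: smooth_germ_cst|exact: analytic_germ_cst]. Qed.

Lemma fun_germ_coord C (R : realType) r (k : 'I_r) :
  fun_germ C (fun x : 'rV[R]_r => x 0 k).
Proof. by case: C; [exact: smooth_germ_coord|exact: analytic_germ_coord]. Qed.

Lemma fun_germD C (R : realType) r (f g : 'rV[R]_r -> R) :
  fun_germ C f -> fun_germ C g -> fun_germ C (fun x => f x + g x).
Proof. by case: C; [exact: smooth_germD|exact: analytic_germD]. Qed.

Lemma fun_germM C (R : realType) r (f g : 'rV[R]_r -> R) :
  fun_germ C f -> fun_germ C g -> fun_germ C (fun x => f x * g x).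
Proof. by case: C; [exact: smooth_germM|exact: analytic_germM]. Qed.

Lemma fun_germ_comp C (R : realType) q r (f : 'rV[R]_q -> R)
    (Phi : 'rV[R]_r -> 'rV[R]_q) :
  fun_germ C f -> (forall j, fun_germ C (fun x => Phi x 0 j)) -> Phi 0 = 0 ->
  fun_germ C (fun x => f (Phi x)).
Proof. by case: C; [exact: smooth_germ_comp|exact: analytic_germ_comp]. Qed.

Lemma fun_germ_partial C (R : realType) r (f : 'rV[R]_r -> R) k :
  fun_germ C f -> fun_germ C ('D_(delta_mx 0 k) f).
Proof. by case: C; [exact: smooth_germ_partial|exact: analytic_germ_partial]. Qed.

Lemma fun_germ_cont0 C (R : realType) r (f : 'rV[R]_r -> R) :
  fun_germ C f -> {for (0 : 'rV[R]_r), continuous f}.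
Proof. by move/fun_germ_smooth/smooth_germ_cont0. Qed.

Lemma fun_germ_fixed_point C (R : realType) r (G : 'rV[R]_(r + 1) -> R) :
  fun_germ C G -> G 0 = 0 -> 'D_(delta_mx 0 (rshift r 0)) G 0 = 0 ->
  exists g : 'rV[R]_r -> R, [/\ fun_germ C g, g 0 = 0 &
    \forall x \near (0 : 'rV[R]_r), G (join x (g x)) = g x].
Proof. by case: C; [exact: smooth_fixed_point|exact: analytic_fixed_point]. Qed.

(** Analytic germs are smooth, so the equation comes from the smooth case; for the same integral
    formula only analyticity remains to be shown. *)
Lemma fun_germ_euler C (R : realType) r (mu : 'I_r -> nat) N (w : 'rV[R]_r -> R) :
  (0 < N)%N -> fun_germ C w ->
  exists2 u : 'rV[R]_r -> R, fun_germ C u &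
    \forall x \near (0 : 'rV[R]_r),
      N%:R * u x + \sum_k (mu k)%:R * x 0 k * 'D_(delta_mx 0 k) u x
      = N%:R * w x.
Proof.
case: N => // a _ wg.
have [us ueq] := smooth_germ_euler mu a (fun_germ_smooth wg).
exists (fun x => a.+1%:R * euler_integral mu a w x) => //.
case: C wg us ueq => //= /analytic_germP[rho [D r0 wD]] _ _.
apply/analytic_germP; exists (rho / 2), D; first by rewrite divr_gt0.
exact: power_series_euler.
Qed.

Lemma fun_germN C (R : realType) r (f : 'rV[R]_r -> R) :
  fun_germ C f -> fun_germ C (fun x => - f x).
Proof.
move=> fg; have := fun_germM (fun_germ_cst C r (-1)) fg.
by apply: fun_germ_near; apply/near0_cubeP; exists 1 => // x _; rewrite mulN1r.
Qed.

Lemma fun_germ_ext C (R : realType) r (f g : 'rV[R]_r -> R) :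
  (forall x, f x = g x) -> fun_germ C f -> fun_germ C g.
Proof. by move=> /funext ->. Qed.

Lemma fun_germ_exp C (R : realType) r (f : 'rV[R]_r -> R) n :
  fun_germ C f -> fun_germ C (fun x => f x ^+ n).
Proof.
move=> fg; elim: n => [|n IH]; first exact: fun_germ_cst.
by apply: fun_germ_ext (fun_germM fg IH) => x; rewrite exprS.
Qed.

Lemma fun_germ_sum C (R : realType) r (I : Type) (s : seq I) (P : pred I)
    (f : I -> 'rV[R]_r -> R) :
  (forall i, fun_germ C (f i)) -> fun_germ C (fun x => \sum_(i <- s | P i) f i x).
Proof.
move=> fg; elim: s => [|i s IH].
  by apply: fun_germ_ext (fun_germ_cst C r 0) => x; rewrite big_nil.
have [Pi|nPi] := boolP (P i).
  by apply: fun_germ_ext (fun_germD (fg i) IH) => x; rewrite big_cons Pi.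
by apply: fun_germ_ext IH => x; rewrite big_cons (negbTE nPi).
Qed.

Lemma fun_germ_prod C (R : realType) r (I : Type) (s : seq I) (P : pred I)
    (f : I -> 'rV[R]_r -> R) :
  (forall i, fun_germ C (f i)) -> fun_germ C (fun x => \prod_(i <- s | P i) f i x).
Proof.
move=> fg; elim: s => [|i s IH].
  by apply: fun_germ_ext (fun_germ_cst C r 1) => x; rewrite big_nil.
have [Pi|nPi] := boolP (P i).
  by apply: fun_germ_ext (fun_germM (fg i) IH) => x; rewrite big_cons Pi.
by apply: fun_germ_ext IH => x; rewrite big_cons (negbTE nPi).
Qed.

(** * Scalar implicit equations, inverses and roots in either category *)

Lemma lsubmx_join (R : realType) r (x : 'rV[R]_r) y : lsubmx (join x y) = x.
Proof. exact: row_mxKl. Qed.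

Lemma fun_germ_lsubmx C (R : realType) r (f : 'rV[R]_r -> R) :
  fun_germ C f -> fun_germ C (fun z : 'rV[R]_(r + 1) => f (lsubmx z)).
Proof.
move=> fg; apply: fun_germ_comp => // [j|]; last exact: linear0.
apply: (@fun_germ_ext _ _ _ (fun z => z 0 (lshift 1 j))) => [z|].
  by rewrite mxE.
exact: fun_germ_coord.
Qed.

Lemma derive_line0 (R : realType) r (F : 'rV[R]_r -> R) v :
  'D_v F 0 = 'D_1 (fun h : R => F (h *: v)) 0.
Proof.
rewrite /derive /=; set f := fun h => _; set g := fun h => _.
suff -> : f = g by [].
by apply/funext => h; rewrite /f /g !addr0 scale0r [h *: 1]mulr1.
Qed.

Lemma join0_line (R : realType) r (h : R) :
  join (0 : 'rV[R]_r) h = h *: delta_mx 0 (rshift r 0).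
Proof. by rewrite -[h in LHS]add0r joinDr join0 add0r. Qed.

Lemma smooth_germ_derivable0 (R : realType) r (f : 'rV[R]_r -> R) k :
  smooth_germ f -> derivable f 0 (delta_mx 0 k).
Proof. by move/nbhs_singleton => /(_ [::])[_]. Qed.

(** A Newton step: the zeros of [F] are the fixed points in [y] of [G = y - F / c], whose derivative
    in [y] at [0] is [1 - c / c = 0]. The derivative [c] is taken along the line [h |-> F(0, h)],
    which is explicit in every application. *)
Lemma fun_germ_implicit C (R : realType) r (F : 'rV[R]_(r + 1) -> R) (c : R) :
  fun_germ C F -> c != 0 ->
  is_derive (0 : R) 1 (fun h : R => F (join 0 h)) c -> F 0 = 0 ->
  exists g : 'rV[R]_r -> R, [/\ fun_germ C g, g 0 = 0,
    \forall x \near (0 : 'rV[R]_r), F (join x (g x)) = 0 &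
    \forall z \near (0 : 'rV[R]_(r + 1)), F z = 0 ->
      z 0 (rshift r 0) = g (lsubmx z)].
Proof.
move=> Fg c0 DF F0; set l : 'I_(r + 1) := rshift r 0.
pose G (z : 'rV[R]_(r + 1)) := z 0 l + (- c^-1) * F z.
have Gg : fun_germ C G.
  apply: fun_germD; first exact: fun_germ_coord.
  by apply: fun_germM => //; exact: fun_germ_cst.
have G0 : G 0 = 0 by rewrite /G F0 mxE mulr0 addr0.
have DG : 'D_(delta_mx 0 l) G 0 = 0.
  have := smooth_germ_derivable0 (fun_germ_smooth Fg) (k := l).
  have D1 := derive_coord l (0 : 'rV[R]_(r + 1)) (delta_mx 0 l).
  move=> /derivableP; rewrite derive_line0.
  have -> : (fun h : R => F (h *: delta_mx 0 l)) = fun h => F (join 0 h).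
    by apply/funext => h; rewrite join0_line.
  have [_ ->] := DF => D2.
  have D3 := @is_deriveD _ _ _ _ _ _ _ _ _ D1 (@is_deriveZ _ _ _ _ (- c^-1) _ _ _ D2).
  have [_ ->] := D3.
  by rewrite mxE !eqxx /= [_ *: _]mulNr mulVf // subrr.
have [g [gg g0 gG]] := fun_germ_fixed_point Gg G0 DG.
have FG z : F z = c * (z 0 l - G z).
  by rewrite /G opprD addrA subrr sub0r mulNr opprK mulrA divff // mul1r.
exists g; split=> //.
  by apply: filterS gG => x Gx; rewrite FG Gx joinr subrr mulr0.
have := smooth_last_unique (fun_germ_smooth Gg) DG (fun_germ_smooth gg) g0 gG.
by apply: filterS => z H Fz; apply: H; rewrite /G Fz mulr0 addr0.
Qed.

(** The unknown is the deviation [y] of the inverse from its value at [0], in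
    [(f(0)^-1 + y) f(x) = 1]; over [x = 0] the equation is linear in [y]. *)
Lemma fun_germV C (R : realType) r (f : 'rV[R]_r -> R) :
  fun_germ C f -> f 0 != 0 -> fun_germ C (fun x => (f x)^-1).
Proof.
move=> fg f0; pose l : 'I_(r + 1) := rshift r 0.
pose F (z : 'rV[R]_(r + 1)) := ((f 0)^-1 + z 0 l) * f (lsubmx z) + (-1).
have Fg : fun_germ C F.
  apply: fun_germD; last exact: fun_germ_cst.
  apply: fun_germM; last exact: fun_germ_lsubmx.
  by apply: fun_germD; [exact: fun_germ_cst|exact: fun_germ_coord].
have Fline h : F (join 0 h) = f 0 * h.
  by rewrite /F joinr lsubmx_join mulrDl mulVf // addrAC subrr add0r mulrC.
have DF : is_derive (0 : R) 1 (fun h : R => F (join 0 h)) (f 0).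
  have -> : (fun h : R => F (join 0 h)) = f 0 *: id.
    by apply/funext => h; rewrite Fline.
  have Z := @is_deriveZ _ _ _ _ (f 0) _ _ _ (is_derive_id (0 : R) 1).
  by apply: (@is_derive_eq _ _ _ _ _ _ _ _ Z); rewrite [LHS]mulr1.
have [|g [gg g0 gF _]] := fun_germ_implicit Fg f0 DF.
  by rewrite -(join0 R r) Fline mulr0.
have := fun_germD (fun_germ_cst C r (f 0)^-1) gg.
apply: fun_germ_near; apply: filterS gF => x.
rewrite /F joinr lsubmx_join => /eqP; rewrite subr_eq0 => /eqP E.
have fx : f x != 0.
  by apply/eqP => fx; move: E; rewrite fx mulr0 => /eqP; rewrite eq_sym oner_eq0.
by apply/(mulIf fx); rewrite E mulVf.
Qed.

(** The equation is [(b + y)^(n+1) = u(x)], with [b] the positive root of [u(0)]; its derivative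
    [(n+1) b^n] in [y] is nonzero since [b > 0]. *)
Lemma fun_germ_root C (R : realType) r (u : 'rV[R]_r -> R) n :
  fun_germ C u -> 0 < u 0 -> exists v : 'rV[R]_r -> R,
    [/\ fun_germ C v, 0 < v 0 &
        \forall x \near (0 : 'rV[R]_r), v x ^+ n.+1 = u x].
Proof.
move=> ug u0; pose l : 'I_(r + 1) := rshift r 0.
pose b := u 0 `^ (n.+1%:R^-1).
have b0 : 0 < b by rewrite powR_gt0.
have bn : b ^+ n.+1 = u 0.
  rewrite -powR_mulrn; last exact: ltW.
  by rewrite /b -powRrM mulVf ?pnatr_eq0 // powRr1 // ltW.
pose F (z : 'rV[R]_(r + 1)) := (b + z 0 l) ^+ n.+1 + - u (lsubmx z).
have Fg : fun_germ C F.
  apply: fun_germD; last by apply: fun_germN; exact: fun_germ_lsubmx.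
  apply: fun_germ_exp.
  by apply: fun_germD; [exact: fun_germ_cst|exact: fun_germ_coord].
have c0 : n.+1%:R * b ^+ n != 0 by rewrite mulf_neq0 ?pnatr_eq0 ?expf_neq0 ?gt_eqF.
have DF : is_derive (0 : R) 1 (fun h : R => F (join 0 h)) (n.+1%:R * b ^+ n).
  have -> : (fun h : R => F (join 0 h)) = (cst b + id) ^+ n.+1 + cst (- u 0).
    by apply/funext => h; rewrite /F joinr lsubmx_join !fctE.
  have D1 := @is_deriveD _ _ _ _ _ _ _ _ _ (is_derive_cst b (0 : R) 1) (is_derive_id (0 : R) 1).
  have D2 := @is_deriveX _ _ _ n.+1 _ _ _ D1.
  have D3 := @is_deriveD _ _ _ _ _ _ _ _ _ D2 (is_derive_cst (- u 0) (0 : R) 1).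
  apply: (@is_derive_eq _ _ _ _ _ _ _ _ D3).
  by rewrite !fctE !addr0 add0r [LHS]mulr1.
have [|g [gg g0 gF _]] := fun_germ_implicit Fg c0 DF.
  by rewrite /F mxE addr0 bn linear0 subrr.
exists (fun x => b + g x); split.
- by apply: fun_germD => //; exact: fun_germ_cst.
- by rewrite g0 addr0.
- apply: filterS gF => x; rewrite /F joinr lsubmx_join => /eqP.
  by rewrite subr_eq0 => /eqP.
Qed.

(** * Matrix-valued germs *)

Lemma mx_germM C (R : realType) r m n p (F : 'rV[R]_r -> 'M[R]_(m, n))
    (G : 'rV[R]_r -> 'M[R]_(n, p)) :
  mx_germ C F -> mx_germ C G -> mx_germ C (fun x => F x *m G x).
Proof.
move=> Fg Gg i j; apply: (@fun_germ_ext _ _ _ (fun x => \sum_k F x i k * G x k j)).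
  by move=> x; rewrite mxE.
by apply: fun_germ_sum => k; apply: fun_germM.
Qed.

Lemma fun_germ_det C (R : realType) r n (F : 'rV[R]_r -> 'M[R]_n) :
  mx_germ C F -> fun_germ C (fun x => \det (F x)).
Proof.
move=> Fg; apply: fun_germ_sum => s; apply: fun_germM; first exact: fun_germ_cst.
by apply: fun_germ_prod => i.
Qed.

Lemma mx_germ_inv C (R : realType) r n (F : 'rV[R]_r -> 'M[R]_n) :
  GL_germ C F -> GL_germ C (fun x => invmx (F x)).
Proof.
move=> [Fg Fu]; split; last first.
  by apply: filterS Fu => x; rewrite unitmx_inv.
have d0 : \det (F 0) != 0.
  by have := nbhs_singleton Fu; rewrite unitmxE unitfE.
have dg := fun_germV (fun_germ_det Fg) d0.
move=> i j; apply: (@fun_germ_near _ _ _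
    (fun x => (\det (F x))^-1 * cofactor (F x) j i)).
  by apply: filterS Fu => x Ux; rewrite /invmx Ux !mxE.
apply: fun_germM => //; apply: fun_germM; first exact: fun_germ_cst.
apply: fun_germ_det => i' j'.
by apply: fun_germ_ext (Fg (lift j i') (lift i j')) => x; rewrite !mxE.
Qed.

Lemma GL_germM C (R : realType) r n (F G : 'rV[R]_r -> 'M[R]_n) :
  GL_germ C F -> GL_germ C G -> GL_germ C (fun x => F x *m G x).
Proof.
move=> [Fg Fu] [Gg Gu]; split; first exact: mx_germM.
by apply: filterS2 Fu Gu => x; rewrite unitmx_mul => -> ->.
Qed.

Lemma mx_germ_comp C (R : realType) q r m n (F : 'rV[R]_q -> 'M[R]_(m, n))
    (Phi : 'rV[R]_r -> 'rV[R]_q) :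
  mx_germ C F -> mx_germ C Phi -> Phi 0 = 0 -> mx_germ C (fun x => F (Phi x)).
Proof.
by move=> Fg Pg P0 i j; apply: (fun_germ_comp (Fg i j)) => // k; exact: Pg.
Qed.

Lemma mx_germ_continuous0 C (R : realType) q r (Phi : 'rV[R]_r -> 'rV[R]_q) :
  mx_germ C Phi -> {for (0 : 'rV[R]_r), continuous Phi}.
Proof. by move=> Pg; apply: continuous_rV => j; apply: fun_germ_cont0 (Pg 0 j). Qed.

Lemma near_comp C (R : realType) q r (Phi : 'rV[R]_r -> 'rV[R]_q)
    (P : 'rV[R]_q -> Prop) :
  mx_germ C Phi -> Phi 0 = 0 -> (\forall x \near (0 : 'rV[R]_q), P x) ->
  \forall x \near (0 : 'rV[R]_r), P (Phi x).
Proof.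
by move=> Pg P0 H; apply: (mx_germ_continuous0 Pg); rewrite P0.
Qed.

Lemma GL_germ_comp C (R : realType) q r n (F : 'rV[R]_q -> 'M[R]_n)
    (Phi : 'rV[R]_r -> 'rV[R]_q) :
  GL_germ C F -> mx_germ C Phi -> Phi 0 = 0 -> GL_germ C (fun x => F (Phi x)).
Proof.
move=> [Fg Fu] Pg P0; split; first exact: mx_germ_comp.
exact: near_comp Pg P0 Fu.
Qed.

(** * Jacobians and volume forms *)

Lemma smooth_germ_differentiable (R : realType) r (f : 'rV[R]_r -> R) :
  smooth_germ f -> \forall x \near (0 : 'rV[R]_r), differentiable f x.
Proof.
move=> /smooth_germP[e e0 fC]; apply: filterS (nbhsx_ballx _ _ e0) => x xe.
exact: differentiable_partials (ball_open _ _) (fC 1%N) xe.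
Qed.

Lemma differentiable_rV (R : realType) q (V : normedModType R)
    (F : V -> 'rV[R]_q) x :
  (forall l, differentiable (fun y => F y 0 l) x) -> differentiable F x.
Proof.
move=> dF.
have -> : F = \sum_(l < q) (fun y => F y 0 l *: (delta_mx 0 l : 'rV[R]_q)).
  by apply/funext => y; rewrite fct_sumE; exact: row_sum_delta.
by apply: differentiable_sum => l; exact: differentiableZl.
Qed.

Lemma mx_germ_jacobian C (R : realType) q r (Phi : 'rV[R]_r -> 'rV[R]_q) :
  mx_germ C Phi -> \forall x \near (0 : 'rV[R]_r), differentiable Phi x /\
    'J Phi x = \matrix_(k, l) 'D_(delta_mx 0 k) (fun y => Phi y 0 l) x.
Proof.
move=> Pg.
have : \forall x \near (0 : 'rV[R]_r), forall l : 'I_q, differentiable (fun y => Phi y 0 l) x.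
  have H (l : 'I_q) : \forall x \near (0 : 'rV[R]_r), differentiable (fun y => Phi y 0 l) x.
    by apply: smooth_germ_differentiable; exact: fun_germ_smooth (Pg 0 l).
  exact: filter_forall H.
apply: filterS => x dP; have dPhi : differentiable Phi x by exact: differentiable_rV.
split=> //; apply/matrixP => k l; rewrite mxE.
have := deriveEjacobian (delta_mx 0 k) dPhi; rewrite -rowE derive_mx; last first.
  exact: diff_derivable.
by move=> /matrixP/(_ 0 l); rewrite !mxE => <-.
Qed.

Lemma mx_germ_det_jacobian C (R : realType) r (Phi : 'rV[R]_r -> 'rV[R]_r) :
  mx_germ C Phi -> fun_germ C (fun x => \det ('J Phi x)).
Proof.
move=> Pg; apply: (@fun_germ_near _ _ _
  (fun x => \det (\matrix_(k, l) 'D_(delta_mx 0 k) (fun y => Phi y 0 l) x))).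
  by apply: filterS (mx_germ_jacobian Pg) => x [_ ->].
apply: fun_germ_det => k l.
by apply: fun_germ_ext (fun_germ_partial k (Pg 0 l)) => x; rewrite mxE.
Qed.

Lemma jacobian_comp (R : realType) p q r (Phi : 'rV[R]_r -> 'rV[R]_q)
    (Psi : 'rV[R]_q -> 'rV[R]_p) x :
  differentiable Phi x -> differentiable Psi (Phi x) ->
  'J (fun y => Psi (Phi y)) x = 'J Phi x *m 'J Psi (Phi x).
Proof.
move=> dPhi dPsi; apply/row_matrixP => i; rewrite !rowE mulmxA !mul_rV_lin1 /=.
by rewrite (_ : (fun y => _) = Psi \o Phi) // diff_comp.
Qed.

Lemma near_det_jacobian_comp C (R : realType) r (Phi Psi : 'rV[R]_r -> 'rV[R]_r) :
  mx_germ C Phi -> mx_germ C Psi -> Phi 0 = 0 ->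
  \forall x \near (0 : 'rV[R]_r),
    \det ('J (fun y => Psi (Phi y)) x) = \det ('J Phi x) * \det ('J Psi (Phi x)).
Proof.
move=> Pg Sg P0; have := near_comp Pg P0 (mx_germ_jacobian Sg).
apply: filterS2 (mx_germ_jacobian Pg) => x [dP _] [dS _].
by rewrite jacobian_comp // det_mulmx.
Qed.

Lemma jacobian_near_id C (R : realType) r (Phi : 'rV[R]_r -> 'rV[R]_r) :
  mx_germ C Phi -> (\forall x \near (0 : 'rV[R]_r), Phi x = x) ->
  \forall x \near (0 : 'rV[R]_r), 'J Phi x = 1%:M.
Proof.
move=> Pg /near_join Pid; apply: filterS2 (mx_germ_jacobian Pg) Pid => x [_ ->] Px.
apply/matrixP => k l; rewrite !mxE.
rewrite (@near_eq_derive _ _ _ _ (fun y : 'rV[R]_r => y 0 l)); last first.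
  by apply: filterS Px => y ->.
by have [_ ->] := derive_coord l x (delta_mx 0 k); rewrite mxE eqxx eq_sym.
Qed.

Definition set_row (R : Type) r (i : 'I_r) (v : 'rV[R]_r) (V : 'M[R]_r) : 'M[R]_r :=
  \matrix_(k, l) if k == i then v 0 l else V k l.

Lemma row_set_row (R : Type) r (i k : 'I_r) (v : 'rV[R]_r) (V : 'M[R]_r) :
  row k (set_row i v V) = if k == i then v else row k V.
Proof. by apply/rowP => l; rewrite !mxE; case: eqP => // _; rewrite mxE. Qed.

Lemma multilinear_set_row (R : realType) r (w : 'M[R]_r -> R) i V :
  multilinear w -> forall (a b : R) u v,
  w (set_row i (a *: u + b *: v) V) = a * w (set_row i u V) + b * w (set_row i v V).
Proof.
move=> wm a b u v; apply: (wm _ _ _ i); first by rewrite !row_set_row eqxx.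
- by apply/matrixP => k l; rewrite !mxE eq_sym (negbTE (neq_lift _ _)).
- by apply/matrixP => k l; rewrite !mxE eq_sym (negbTE (neq_lift _ _)).
Qed.

Lemma multilinear_set_row_sum (R : realType) r (w : 'M[R]_r -> R) i V
    (I : Type) (s : seq I) (a : I -> R) (u : I -> 'rV[R]_r) : multilinear w ->
  w (set_row i (\sum_(j <- s) a j *: u j) V) = \sum_(j <- s) a j * w (set_row i (u j) V).
Proof.
move=> wm; have wl := multilinear_set_row i V wm.
elim: s => [|j s IH].
  by rewrite !big_nil -[X in set_row i X V](scale0r 0) -[X in set_row i X V]addr0
     -[X in _ + X](scale0r (0 : 'rV[R]_r)) wl !mul0r addr0.
by rewrite !big_cons -IH -[X in _ + X](scale1r) wl mul1r.
Qed.

(** Polarisation: with [a + b] in both rows the form vanishes, and of the four terms of the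
    expansion only the two mixed ones survive. *)
Lemma multilinear_alternating_swap (R : realType) r (w : 'M[R]_r -> R) i j V :
  multilinear w -> Defs.alternating w -> i != j -> w (xrow i j V) = - w V.
Proof.
move=> wm wa ij; pose S u v := set_row i u (set_row j v V).
have ji : (j == i) = false by rewrite eq_sym; exact: negbTE.
have Sr1 u v : row i (S u v) = u by rewrite row_set_row eqxx.
have Sr2 u v : row j (S u v) = v by rewrite !row_set_row ji eqxx.
have S0 u : w (S u u) = 0 by apply: (wa _ i j) => //; rewrite Sr1 Sr2.
have Scomm u v : S u v = set_row j v (set_row i u V).
  apply/matrixP => k l; rewrite !mxE; have [->|//] := eqVneq k i.
  by rewrite (negbTE ij).
have Sl a b : w (S (a + b) (a + b)) =
    w (S a a) + w (S a b) + (w (S b a) + w (S b b)).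
  have add k c d W : w (set_row k (c + d) W) = w (set_row k c W) + w (set_row k d W).
    by rewrite -[c in LHS]scale1r -[d in LHS]scale1r multilinear_set_row // !mul1r.
  by rewrite {1}/S add -!/(S _ _) !Scomm !add.
have := Sl (row i V) (row j V); rewrite !S0 add0r addr0 => /eqP.
rewrite eq_sym addr_eq0 => /eqP H; rewrite (_ : xrow i j V = S (row j V) (row i V)).
  rewrite (_ : S (row i V) (row j V) = V) in H; first by rewrite H opprK.
  apply/row_matrixP => k; rewrite !row_set_row; have [->//|_] := eqVneq k i.
  by have [->|] := eqVneq k j.
apply/row_matrixP => k; rewrite !row_set_row; apply/rowP => l; rewrite !mxE.
by have [->|ki] := eqVneq k i; [rewrite tpermL !mxE|
   have [->|kj] := eqVneq k j; [rewrite tpermR !mxE|rewrite tpermD ?mxE // eq_sym]].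
Qed.

(* Expand the rows one at a time in the canonical basis: [M S f V] is [V] with
   the rows [i \in S] replaced by the basis vectors of index [f i]. *)
Lemma multilinear_alternating_eq0 (R : realType) r (w : 'M[R]_r -> R) :
  multilinear w -> Defs.alternating w -> w 1%:M = 0 -> forall V, w V = 0.
Proof.
move=> wm wa w1.
have wperm (s : 'S_r) : w (perm_mx s) = 0.
  have [ts -> dts] := prod_tpermP s; elim: ts dts => [|t ts IH] /=.
    by rewrite big_nil perm_mx1.
  move=> /andP[dt dts]; rewrite big_cons perm_mxM.
  by rewrite -[perm_mx _]/(tperm_mx _ _) -xrowE multilinear_alternating_swap // IH ?oppr0.
pose M (S : {set 'I_r}) (f : {ffun 'I_r -> 'I_r}) (V : 'M[R]_r) : 'M[R]_r :=
  \matrix_(i, j) if i \in S then (f i == j)%:R else V i j.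
(* All rows are now basis vectors: either [f] is injective and they form a permutation matrix, or
   two of them coincide. *)
have base f V : w (M [set: 'I_r]%SET f V) = 0.
  have [/injectiveP finj|/injectivePn[i [j ij fij]]] := boolP (injectiveb f).
    rewrite (_ : M _ _ _ = perm_mx (perm finj)) //.
    by apply/matrixP => i j; rewrite !mxE inE permE.
  by apply: (wa _ i j) => //; apply/rowP => l; rewrite !mxE !inE fij.
move=> V; suff H n (S : {set 'I_r}) f : #|(~: S)%SET| = n -> w (M S f V) = 0.
  have := H _ finset.set0 [ffun i => i] erefl; congr (w _ = _).
  by apply/matrixP => i j; rewrite mxE inE.
elim: n S f => [|n IH] S f.
  by move/cards0_eq => /(congr1 (@finset.setC _)); rewrite finset.setCK finset.setC0 => ->.
move=> Sn; have [i iS] : exists i, i \in ~: S.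
  by apply/set0Pn; rewrite -card_gt0 Sn.
rewrite inE in iS.
have -> : M S f V = set_row i (\sum_j V i j *: delta_mx 0 j) (M S f V).
  apply/row_matrixP => k; rewrite row_set_row; case: eqP => [->|//].
  rewrite [LHS]row_sum_delta; apply: eq_bigr => j _; by rewrite !mxE (negbTE iS).
rewrite multilinear_set_row_sum // big1 // => j _.
have -> : set_row i (delta_mx 0 j) (M S f V) =
    M (i |: S)%SET [ffun k => if k == i then j else f k] V.
  apply/matrixP => k l; rewrite !mxE !inE ffunE.
  by case: (k == i) => //=; rewrite eq_sym.
rewrite IH ?mulr0 //; have := cardsC1 i; have := Sn.
rewrite (cardsD1 i) !inE iS add1n => -[<-] _; apply: eq_card => k.
by rewrite !inE negb_or.
Qed.

(** The difference of the two sides is itself multilinear and alternating in [V], and it vanishes at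
    the identity. *)
Lemma alternating_form_det (R : realType) r (w : 'M[R]_r -> R) :
  multilinear w -> Defs.alternating w -> forall V, w V = \det V * w 1%:M.
Proof.
move=> wm wa V; apply/eqP; rewrite -subr_eq0; apply/eqP.
pose u V := w V - \det V * w 1%:M.
apply: (@multilinear_alternating_eq0 _ _ u).
- move=> W W1 W2 i a b H H1 H2; rewrite /u (wm W W1 W2 i a b) //.
  by rewrite (determinant_multilinear H H1 H2); ring.
- move=> W i j ij Wij; rewrite /u (wa W i j) //.
  rewrite (determinant_alternate ij) ?mul0r ?subr0 // => l.
  by have /rowP/(_ l) := Wij; rewrite !mxE.
- by rewrite /u det1 mul1r subrr.
Qed.

(** * Weighted scalings *)

(** The matrix determinant lemma, from a block identity with unimodular triangular factors that
    carries [1 + c p] to the scalar [1 + p c]. *)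
Lemma det_rank_one (R : comNzRingType) r (c : 'cV[R]_r) (p : 'rV[R]_r) :
  \det (1%:M + c *m p) = 1 + (p *m c) 0 0.
Proof.
have E : block_mx (1%:M + c *m p) c 0 1%:M *m block_mx 1%:M 0 (- p) 1%:M =
    block_mx 1%:M 0 (- p) 1%:M *m block_mx 1%:M c 0 (1%:M + p *m c) :> 'M[R]_(r + 1).
  rewrite !mulmx_block !mul1mx !mulmx1 !mulmx0 !mul0mx !add0r !addr0 mulmxN mulNmx.
  by rewrite addrK addrCA addNr addr0.
have := congr1 determinant E; rewrite !det_mulmx !det_ublock !det_lblock !det1.
by rewrite !mulr1 !mul1r => ->; rewrite det_mx11 !mxE eqxx.
Qed.

Lemma weighted_scale_comp (R : realType) r (mu : 'I_r -> nat) (s t : R) x :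
  weighted_scale mu s (weighted_scale mu t x) = weighted_scale mu (s * t) x.
Proof. by apply/rowP => k; rewrite !mxE exprMn mulrA. Qed.

Lemma weighted_scale_1 (R : realType) r (mu : 'I_r -> nat) (x : 'rV[R]_r) :
  weighted_scale mu 1 x = x.
Proof. by apply/rowP => k; rewrite !mxE expr1n mul1r. Qed.

Lemma weighted_scale_0 (R : realType) r (mu : 'I_r -> nat) (t : R) :
  weighted_scale mu t 0 = 0.
Proof. by apply/rowP => k; rewrite !mxE mulr0. Qed.

Lemma mx_germ_weighted_scale C (R : realType) q r (mu : 'I_q -> nat)
    (v : 'rV[R]_r -> R) (F : 'rV[R]_r -> 'rV[R]_q) :
  fun_germ C v -> mx_germ C F -> mx_germ C (fun x => weighted_scale mu (v x) (F x)).
Proof.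
move=> vg Fg i k; apply: fun_germ_ext (fun_germM (fun_germ_exp (mu k) vg) (Fg 0 k)) => x.
by rewrite mxE.
Qed.

Lemma mx_germ_id C (R : realType) r : mx_germ C (fun x : 'rV[R]_r => x).
Proof. by move=> i k; rewrite ord1; exact: fun_germ_coord. Qed.

Lemma mx_germ_lsubmx C (R : realType) r : mx_germ C (fun z : 'rV[R]_(r + 1) => lsubmx z).
Proof.
move=> i k; apply: fun_germ_ext (fun_germ_coord C R (lshift 1 k)) => z.
by rewrite ord1 mxE.
Qed.

Lemma mx_germ_join C (R : realType) q r (F : 'rV[R]_q -> 'rV[R]_r) g :
  mx_germ C F -> fun_germ C g -> mx_germ C (fun x => join (F x) (g x)).
Proof.
move=> Fg gg i k; rewrite ord1; case: (split_ordP k) => j ->.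
  by apply: fun_germ_ext (Fg 0 j) => x; rewrite joinl.
by apply: fun_germ_ext gg => x; rewrite ord1 joinr.
Qed.

(* The inverse is again a weighted scaling [x |-> s(x) . x], where [s] solves the
   scalar implicit equation [s(x) * v(s(x) . x) = 1]. *)
Lemma diffeo_germ_weighted_scale C (R : realType) r (mu : 'I_r -> nat)
    (v : 'rV[R]_r -> R) :
  fun_germ C v -> v 0 != 0 -> diffeo_germ C (fun x => weighted_scale mu (v x) x).
Proof.
move=> vg v0; have Pg := mx_germ_weighted_scale mu vg (@mx_germ_id C R r).
split=> //; first by rewrite weighted_scale_0.
pose l : 'I_(r + 1) := rshift r 0; pose s (z : 'rV[R]_(r + 1)) := (v 0)^-1 + z 0 l.
have sg : fun_germ C s by apply: fun_germD; [exact: fun_germ_cst|exact: fun_germ_coord].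
pose F (z : 'rV[R]_(r + 1)) := s z * v (weighted_scale mu (s z) (lsubmx z)) + (-1).
have Fg : fun_germ C F.
  apply: fun_germD; last exact: fun_germ_cst.
  apply: fun_germM => //; apply: (fun_germ_comp vg); last by rewrite linear0 weighted_scale_0.
  by move=> j; exact: (mx_germ_weighted_scale mu sg (@mx_germ_lsubmx C R r)).
have Fline h : F (join 0 h) = v 0 * h.
  rewrite /F /s joinr lsubmx_join weighted_scale_0 mulrDl mulVf //.
  by rewrite addrAC subrr add0r mulrC.
have DF : is_derive (0 : R) 1 (fun h : R => F (join 0 h)) (v 0).
  have -> : (fun h : R => F (join 0 h)) = v 0 *: id.
    by apply/funext => h; rewrite Fline.
  have Z := @is_deriveZ _ _ _ _ (v 0) _ _ _ (is_derive_id (0 : R) 1).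
  by apply: (@is_derive_eq _ _ _ _ _ _ _ _ Z); rewrite [LHS]mulr1.
have [|g [gg g0 gF gu]] := fun_germ_implicit Fg v0 DF.
  by rewrite -(join0 R r) Fline mulr0.
exists (fun x => weighted_scale mu ((v 0)^-1 + g x) x); split.
- apply: mx_germ_weighted_scale; last exact: mx_germ_id.
  by apply: fun_germD => //; exact: fun_germ_cst.
- by rewrite weighted_scale_0.
(* Here uniqueness in the implicit equation is used: over the point [v(x) . x] the number [(v x)^-1]
   is a solution, because scaling by it returns to [x]. It must therefore be the solution given by
   [g]. *)
- pose Z x := join (weighted_scale mu (v x) x) ((v x)^-1 + - (v 0)^-1).
  have Zg : mx_germ C Z.
    apply: mx_germ_join => //; apply: fun_germD; last exact: fun_germ_cst.
    exact: fun_germV.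
  have Z0 : Z 0 = 0 by rewrite /Z weighted_scale_0 subrr join0.
  have vn0 : \forall x \near (0 : 'rV[R]_r), v x != 0.
    exact: (cvgr_neq0 (v 0) (fun_germ_cont0 vg)).
  apply: filterS2 vn0 (near_comp Zg Z0 gu) => x vx.
  have sZ : s (Z x) = (v x)^-1 by rewrite /s /Z joinr addrC subrK.
  rewrite /F sZ /Z lsubmx_join weighted_scale_comp mulVf // weighted_scale_1.
  rewrite mulVf // subrr => /(_ erefl); rewrite joinr => <-.
  by rewrite addrC subrK weighted_scale_comp mulVf // weighted_scale_1.
- apply: filterS gF => x; rewrite /F /s joinr lsubmx_join => /eqP.
  rewrite subr_eq0 => /eqP E.
  by rewrite weighted_scale_comp mulrC E weighted_scale_1.
Qed.

Lemma is_derive_fun_germ_near C (R : realType) r (v : 'rV[R]_r -> R) :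
  fun_germ C v -> \forall x \near (0 : 'rV[R]_r), forall k,
    is_derive x (delta_mx 0 k) v ('D_(delta_mx 0 k) v x).
Proof.
move/fun_germ_smooth => vg; apply: filterS vg => x /(_ [::])[_ dv] k.
exact/derivableP/dv.
Qed.

(** Entry [(k, l)] is [v^(mu_l) * (delta_kl + mu_l x_l d_k v / v)]: the identity plus a column times
    a row, followed by a diagonal matrix whose determinant is [v^(\sum mu)]. *)
Lemma det_jacobian_weighted_scale C (R : realType) r (mu : 'I_r -> nat)
    (v : 'rV[R]_r -> R) : fun_germ C v -> v 0 != 0 ->
  \forall x \near (0 : 'rV[R]_r),
    \det ('J (fun x => weighted_scale mu (v x) x) x) =
    (1 + (\sum_k (mu k)%:R * x 0 k * 'D_(delta_mx 0 k) v x) / v x)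
    * v x ^+ (\sum_k mu k).
Proof.
move=> vg v0; have Pg := mx_germ_weighted_scale mu vg (@mx_germ_id C R r).
have vn0 : \forall x \near (0 : 'rV[R]_r), v x != 0.
  exact: (cvgr_neq0 (v 0) (fun_germ_cont0 vg)).
apply: filterS3 (mx_germ_jacobian Pg) vn0 (is_derive_fun_germ_near vg) => x [_ ->] vx dv.
pose c : 'cV[R]_r := \col_k ('D_(delta_mx 0 k) v x / v x).
pose p : 'rV[R]_r := \row_k ((mu k)%:R * x 0 k).
have -> : (\matrix_(k, l) 'D_(delta_mx 0 k) (fun y => weighted_scale mu (v y) y 0 l) x) =
    (1%:M + c *m p) *m diag_mx (\row_k v x ^+ mu k).
  apply/matrixP => k l; rewrite mxE mul_mx_diag !mxE big_ord1 !mxE.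
  have D1 := @is_deriveX _ _ _ (mu l) _ _ _ (dv k).
  have D2 := @is_deriveM _ _ _ _ _ _ _ _ D1 (derive_coord l x (delta_mx 0 k)).
  have -> : (fun y => weighted_scale mu (v y) y 0 l) = v ^+ mu l * (fun y : 'rV[R]_r => y 0 l).
    by apply/funext => y; rewrite mxE fctE; congr (_ * _); rewrite exprfctE.
  have [_ ->] := D2; rewrite mxE eqxx /= exprfctE eq_sym.
  rewrite -![_ *: _]/(_ * _).
  case: (mu l) => [|m] /=; first by ring.
  by rewrite exprS; field.
rewrite det_mulmx det_rank_one det_diag; congr ((1 + _) * _).
  rewrite mxE mulr_suml; apply: eq_bigr => k _; rewrite !mxE; field; exact: vx.
by rewrite expr_sum; apply: eq_bigr => k _; rewrite mxE.
Qed.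

(* With [N = \sum_k mu k] and [u = v ^+ N], the Jacobian of [x |-> v(x) . x] is
   [u + N^-1 * \sum_k mu k * x_k * d_k u], so that it can be prescribed by
   solving an Euler equation and extracting an [N]-th root. *)
Lemma weighted_scale_prescribed_jacobian C (R : realType) r (mu : 'I_r -> nat)
    (w : 'rV[R]_r -> R) : (0 < \sum_k mu k)%N -> fun_germ C w -> 0 < w 0 ->
  exists v : 'rV[R]_r -> R, [/\ fun_germ C v, 0 < v 0 &
    \forall x \near (0 : 'rV[R]_r),
      \det ('J (fun x => weighted_scale mu (v x) x) x) = w x].
Proof.
move=> N0 wg w0; have [u ug uE] := fun_germ_euler mu N0 wg.
set N := (\sum_k mu k)%N in N0 uE *.
have Nn0 : N%:R != 0 :> R by rewrite pnatr_eq0 -lt0n.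
have u0 : u 0 = w 0.
  have := nbhs_singleton uE; rewrite big1 ?addr0; first by move/(mulfI Nn0).
  by move=> k _; rewrite mxE mulr0 mul0r.
have [|v [vg v0 vE]] := fun_germ_root N.-1 ug; first by rewrite u0.
rewrite prednK // in vE; exists v; split=> //.
have vn0 : \forall x \near (0 : 'rV[R]_r), v x != 0.
  exact: (cvgr_neq0 (v 0) (fun_germ_cont0 vg) (lt0r_neq0 v0)).
have Du : \forall x \near (0 : 'rV[R]_r), v x ^+ N = u x /\ forall k,
    'D_(delta_mx 0 k) u x = N%:R * v x ^+ N.-1 * 'D_(delta_mx 0 k) v x.
  apply: filterS2 (near_join vE) (is_derive_fun_germ_near vg) => x vEx dv.
  split=> [|k]; first exact: nbhs_singleton vEx.
  rewrite -(@near_eq_derive _ _ _ (v ^+ N)); last first.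
    by apply: filterS vEx => y; rewrite exprfctE.
  by have [_ ->] := @is_deriveX _ _ _ N _ _ _ (dv k).
have Jx := det_jacobian_weighted_scale mu vg (lt0r_neq0 v0).
apply: filterS2 (filterI vn0 Du) (filterI uE Jx) => x [vx [vEx Dux]] [uEx ->].
apply: (mulfI Nn0); rewrite -uEx.
have -> : \sum_k (mu k)%:R * x 0 k * 'D_(delta_mx 0 k) u x = N%:R * v x ^+ N.-1 *
    \sum_k (mu k)%:R * x 0 k * 'D_(delta_mx 0 k) v x.
  by rewrite mulr_sumr; apply: eq_bigr => k _; rewrite Dux; ring.
by rewrite -vEx -/N -(prednK N0) exprS; field.
Qed.

(** * Equivalence of matrix germs with densities *)

Lemma diffeo_germ_comp C (R : realType) r (Phi Psi : 'rV[R]_r -> 'rV[R]_r) :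
  diffeo_germ C Phi -> diffeo_germ C Psi -> diffeo_germ C (fun x => Psi (Phi x)).
Proof.
move=> [Pg P0 [P' [Pg' P0' PK PK']]] [Sg S0 [S' [Sg' S0' SK SK']]]; split.
- exact: mx_germ_comp.
- by rewrite P0.
exists (fun x => P' (S' x)); split.
- exact: mx_germ_comp.
- by rewrite S0'.
- by apply: filterS2 PK (near_comp Pg P0 SK) => x PKx ->.
- by apply: filterS2 SK' (near_comp Sg' S0' PK') => x SKx ->.
Qed.

Lemma diffeo_germ_inverse C (R : realType) r (Phi : 'rV[R]_r -> 'rV[R]_r) :
  diffeo_germ C Phi -> exists Psi : 'rV[R]_r -> 'rV[R]_r,
    [/\ diffeo_germ C Psi, \forall x \near (0 : 'rV[R]_r), Phi (Psi x) = x &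
      \forall x \near (0 : 'rV[R]_r), \det ('J Psi x) * \det ('J Phi (Psi x)) = 1].
Proof.
move=> [Pg P0 [Psi [Sg S0 SK PK]]]; exists Psi; split=> //.
  by split=> //; exists Phi.
have Cg : mx_germ C (fun x => Phi (Psi x)) by exact: mx_germ_comp.
apply: filterS2 (near_det_jacobian_comp Sg Pg S0) (jacobian_near_id Cg PK) => x.
by move=> <- ->; rewrite det1.
Qed.

Lemma diffeo_germ_det_jacobian0 C (R : realType) r (Phi : 'rV[R]_r -> 'rV[R]_r) :
  diffeo_germ C Phi -> \det ('J Phi 0) != 0.
Proof.
move=> /diffeo_germ_inverse[Psi [[_ S0 _] _ /nbhs_singleton]].
have neq0 (a b : R) : a * b = 1 -> b != 0.
  by apply: contra_eq_neq => ->; rewrite mulr0 eq_sym oner_eq0.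
by rewrite S0 => /neq0.
Qed.

Lemma equiv_via_comp C (R : realType) r n (A B D : 'rV[R]_r -> 'M[R]_n) Phi Psi :
  mx_germ C Psi -> Psi 0 = 0 -> equiv_via C A B Phi -> equiv_via C B D Psi ->
  equiv_via C A D (fun x => Phi (Psi x)).
Proof.
move=> Sg S0 [X Xg BE] [Y Yg DE]; exists (fun x => X (Psi x) *m Y x).
  by apply: GL_germM => //; exact: GL_germ_comp.
apply: filterS2 DE (near_comp Sg S0 BE) => x -> ->.
by rewrite trmx_mul !mulmxA.
Qed.

Lemma equiv_via_inverse C (R : realType) r n (A B : 'rV[R]_r -> 'M[R]_n) Phi Psi :
  mx_germ C Psi -> Psi 0 = 0 -> (\forall x \near (0 : 'rV[R]_r), Phi (Psi x) = x) ->
  equiv_via C A B Phi -> equiv_via C B A Psi.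
Proof.
move=> Sg S0 PK [X Xg BE]; have Xg' := GL_germ_comp Xg Sg S0.
exists (fun x => invmx (X (Psi x))); first exact: mx_germ_inv.
apply: filterS3 PK (near_comp Sg S0 BE) Xg'.2 => x -> -> Ux.
by rewrite trmx_inv !mulmxA mulVmx ?unitmx_tr // mul1mx mulmxK.
Qed.

(* [w] stands for the volume form of density [w] in the standard coordinates. *)
Definition density_equiv C (R : realType) r n (A : 'rV[R]_r -> 'M[R]_n)
    (w : 'rV[R]_r -> R) (B : 'rV[R]_r -> 'M[R]_n) (w' : 'rV[R]_r -> R) : Prop :=
  exists Phi, [/\ diffeo_germ C Phi, equiv_via C A B Phi &
    \forall x \near (0 : 'rV[R]_r), w (Phi x) * \det ('J Phi x) = w' x].

Lemma density_equiv_trans C (R : realType) r n (A B D : 'rV[R]_r -> 'M[R]_n) w w1 w2 :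
  density_equiv C A w B w1 -> density_equiv C B w1 D w2 -> density_equiv C A w D w2.
Proof.
move=> [Phi [Pd AB wP]] [Psi [Sd BD wS]]; have [[Pg P0 _] [Sg S0 _]] := (Pd, Sd).
exists (fun x => Phi (Psi x)); split; first exact: diffeo_germ_comp.
  exact: equiv_via_comp BD.
have mul_trans (a a1 a2 b d e : R) : a1 * b = a2 -> a * d = a1 -> e = b * d -> a * e = a2.
  by move=> <- <- ->; ring.
apply: filterS3 wS (near_comp Sg S0 wP) (near_det_jacobian_comp Sg Pg S0) => x.
exact: mul_trans.
Qed.

Lemma density_equiv_sym C (R : realType) r n (A B : 'rV[R]_r -> 'M[R]_n) w w' :
  density_equiv C A w B w' -> density_equiv C B w' A w.
Proof.
move=> [Phi [Pd AB wP]]; have [Psi [Sd PK detPS]] := diffeo_germ_inverse Pd.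
have [Sg S0 _] := Sd; exists Psi; split=> //; first exact: equiv_via_inverse AB.
apply: filterS3 PK detPS (near_comp Sg S0 wP) => x PKx dx <-.
by rewrite -mulrA [X in _ * X]mulrC dx mulr1 PKx.
Qed.

Lemma equiv_via_density C (R : realType) r n (A B : 'rV[R]_r -> 'M[R]_n) w Phi :
  diffeo_germ C Phi -> equiv_via C A B Phi ->
  density_equiv C A w B (fun x => w (Phi x) * \det ('J Phi x)).
Proof. by move=> Pd AB; exists Phi; split=> //; apply/near0_cubeP; exists 1. Qed.

Lemma fun_germ_pullback_density C (R : realType) r w (Phi : 'rV[R]_r -> 'rV[R]_r) :
  fun_germ C w -> mx_germ C Phi -> Phi 0 = 0 ->
  fun_germ C (fun x => w (Phi x) * \det ('J Phi x)).
Proof.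
move=> wg Pg P0; apply: fun_germM; last exact: mx_germ_det_jacobian.
by apply: fun_germ_comp => // j; exact: Pg.
Qed.

(** Top-degree forms have one degree of freedom at each point, so the form is replaced by the germ
    of its value on the standard basis, nonzero at [0]. *)
Lemma volume_form_density C (R : realType) r (Omega : dform R r) :
  volume_form_germ C Omega -> [/\ fun_germ C (fun x => Omega x 1%:M),
    Omega 0 1%:M != 0 &
    \forall x \near (0 : 'rV[R]_r), forall V, Omega x V = \det V * Omega x 1%:M].
Proof.
move=> [Oalt Og [V V0]].
have E : \forall x \near (0 : 'rV[R]_r), forall V, Omega x V = \det V * Omega x 1%:M.
  by apply: filterS Oalt => x [Om Oa] W; exact: alternating_form_det.
split=> //; apply: contra_neq V0 => O1.
by rewrite (nbhs_singleton E) O1 mulr0.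
Qed.

(** Tangent vectors are rows, so pushing them forward multiplies on the right by ['J Phi x]; the
    determinant then splits off. *)
Lemma preserves_formP C (R : realType) r (Omega : dform R r) Phi :
  volume_form_germ C Omega -> mx_germ C Phi -> Phi 0 = 0 ->
  preserves_form Omega Phi <->
  \forall x \near (0 : 'rV[R]_r), Omega (Phi x) 1%:M * \det ('J Phi x) = Omega x 1%:M.
Proof.
move=> /volume_form_density[_ _ OE] Pg P0.
have pullE : \forall x \near (0 : 'rV[R]_r), forall V,
    pullback Phi Omega x V = \det V * (Omega (Phi x) 1%:M * \det ('J Phi x)).
  apply: filterS (near_comp Pg P0 OE) => x OPx V; rewrite /pullback OPx.
  rewrite (_ : \matrix_i _ = V *m 'J Phi x); first by rewrite det_mulmx mulrAC mulrA.
  by apply/row_matrixP => i; rewrite rowK row_mul mul_rV_lin1.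
split=> H.
  by apply: filterS2 H pullE => x /(_ 1%:M) Hx PE; rewrite -Hx PE det1 mul1r.
by apply: filterS3 H pullE OE => x Hx PE OxE V; rewrite PE OxE Hx.
Qed.

Lemma volume_preserving_equivP C (R : realType) r n (Omega : dform R r)
    (A B : 'rV[R]_r -> 'M[R]_n) : volume_form_germ C Omega ->
  volume_preserving_equiv C Omega A B <->
  density_equiv C A (fun x => Omega x 1%:M) B (fun x => Omega x 1%:M).
Proof.
move=> vO; split=> -[Phi [Pd H1 H2]]; have [Pg P0 _] := Pd; exists Phi; split=> //.
  exact/(preserves_formP vO Pg P0).
exact/(preserves_formP vO Pg P0).
Qed.

(* Even weights are enough: with [t = (v x) ^+ 2] the factor
   [t ^ ((delta i + delta j) / 2)] is [v x ^+ delta i * v x ^+ delta j]. *)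
Lemma quasi_homogeneous_weighted_scale C (R : realType) r n (A : 'rV[R]_r -> 'M[R]_n) :
  sym_quasi_homogeneous C A -> exists Q psi mu,
    [/\ diffeo_germ C psi, equiv_via C A Q psi, (0 < \sum_k mu k)%N &
      forall v, fun_germ C v -> 0 < v 0 ->
        equiv_via C Q Q (fun x => weighted_scale mu (v x) x)].
Proof.
move=> [phi [lambda [delta [X [phid l0 Xg [U U0 BE]]]]]].
have [psi [psid phiK _]] := diffeo_germ_inverse phid.
have [psig psi0 _] := psid.
have [B BX] : exists B : 'rV[R]_r -> 'M[R]_n, forall p, B p = (X p)^T *m A p *m X p.
  by exists (fun p => (X p)^T *m A p *m X p).
exists (fun x => B (psi x)), psi, (fun k => lambda k * 2)%N; split=> //.
- exists (fun x => X (psi x)); first exact: GL_germ_comp.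
  by apply/near0_cubeP; exists 1 => // x _; rewrite BX.
- by rewrite -big_distrl muln_gt0 l0.
move=> v vg v0.
have vn0 : \forall x \near (0 : 'rV[R]_r), v x != 0.
  exact: (cvgr_neq0 (v 0) (fun_germ_cont0 vg) (lt0r_neq0 v0)).
(* The diagonal frame with entries [v^(-delta i)] cancels the factor gained by each entry of the
   quasi-homogeneous matrix. *)
exists (fun x => diag_mx (\row_i (v x)^-1 ^+ delta i)).
  split=> [i j|].
    have := fun_germ_exp (delta i) (fun_germV vg (lt0r_neq0 v0)).
    move=> /fun_germM/(_ (fun_germ_cst C r (i == j)%:R)).
    by apply: fun_germ_ext => x; rewrite !mxE mulr_natr.
  apply: filterS vn0 => x vx; rewrite unitmxE unitfE det_diag.
  by apply/prodf_neq0 => i _; rewrite mxE expf_neq0 // invr_eq0.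
pose Psi x := weighted_scale (fun k => lambda k * 2)%N (v x) x.
have Psig : mx_germ C Psi by apply: mx_germ_weighted_scale vg _; exact: mx_germ_id.
have Psi0 : Psi 0 = 0 by exact: weighted_scale_0.
have Upsi := near_comp psig psi0 U0.
have phiU : \forall x \near (0 : 'rV[R]_r), phi (psi x) = x /\ U (psi x).
  by apply: filterS2 phiK Upsi => x.
apply: filterS3 vn0 phiU (near_comp Psig Psi0 phiU) => x vx [phip Up] [phiq Uq].
rewrite tr_diag_mx; apply/matrixP => i j.
rewrite mul_mx_diag mxE mul_diag_mx !mxE.
have := BE i j; case: ifPn => [_ BE0|ev BEij]; first by rewrite !BX !BE0 // mulr0 mul0r.
rewrite !BX (BEij (v x ^+ 2) _ _ Up Uq) => [|k]; last first.
  by rewrite phip phiq mxE -exprM mulnC.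
rewrite -exprM mul2n even_halfK // exprD.
by rewrite !exprVn; field; rewrite !expf_neq0.
Qed.

(** Both densities are transported by [psi] to the normal form [Q], where every density can be
    scaled to the constant given by its sign at [0]. Transport multiplies both by the same Jacobian
    at [0], so the two signs still agree. *)
Lemma quasi_homogeneous_density_equiv C (R : realType) r n (A : 'rV[R]_r -> 'M[R]_n) w w' :
  sym_quasi_homogeneous C A -> fun_germ C w -> fun_germ C w' -> 0 < w 0 * w' 0 ->
  density_equiv C A w A w'.
Proof.
move=> /quasi_homogeneous_weighted_scale[Q [psi [mu [psid AQ mu0 Qv]]]] wg wg' ww'.
have [psig psi0 _] := psid.
(* The prescribed Jacobian is [Num.sg (u 0) * u], positive at [0]; multiplied by the constant
   density it gives back [u]. *)
have Qs u : fun_germ C u -> u 0 != 0 -> density_equiv C Q (fun _ => Num.sg (u 0)) Q u.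
  move=> ug u0; have ssu : Num.sg (u 0) * Num.sg (u 0) = 1.
    by rewrite -expr2 sqr_sg u0.
  have [|v [vg v0 Jv]] := weighted_scale_prescribed_jacobian mu0
    (fun_germM (fun_germ_cst C r (Num.sg (u 0))) ug).
    by rewrite -normrEsg normr_gt0.
  exists (fun x => weighted_scale mu (v x) x); split; last first.
  - by apply: filterS Jv => x ->; rewrite mulrA ssu mul1r.
  - exact: Qv.
  - exact: diffeo_germ_weighted_scale (lt0r_neq0 v0).
have /lt0r_neq0 := ww'; rewrite mulf_eq0 negb_or => /andP[w0 w0'].
have d0 := diffeo_germ_det_jacobian0 psid.
pose p u x := u (psi x) * \det ('J psi x).
have p0 u : u 0 != 0 -> p u 0 != 0 by move=> u0; rewrite /p psi0 mulf_neq0.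
have Ap u : fun_germ C u -> u 0 != 0 -> density_equiv C A u Q (fun _ => Num.sg (p u 0)).
  move=> ug u0; apply: density_equiv_trans (equiv_via_density u psid AQ) _.
  by apply/density_equiv_sym/Qs; [exact: fun_germ_pullback_density|exact: p0].
have sgE : Num.sg (p w 0) = Num.sg (p w' 0).
  rewrite /p psi0 !sgrM; congr (_ * _).
  have sgw : Num.sg (w 0) * Num.sg (w' 0) = 1 by rewrite -sgrM gtr0_sg.
  by move: sgw; case: sgrP w0 => // _ _; case: sgrP w0' => // _ _; lra.
apply: density_equiv_trans (Ap _ wg w0) _; rewrite sgE.
exact/density_equiv_sym/Ap.
Qed.

(** The inverse of the given equivalence carries the pair of [B] and the volume to the pair of [A]
    and another density. Preservation of orientation gives this density the same sign at [0], so a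
    symmetry of [A] corrects it. *)
Lemma orientation_preserving_volume_equiv C (R : realType) r n (Omega : dform R r)
    (A B : 'rV[R]_r -> 'M[R]_n) :
  volume_form_germ C Omega -> sym_quasi_homogeneous C A ->
  orientation_preserving_equiv C A B -> volume_preserving_equiv C Omega A B.
Proof.
move=> vO Aqh [Phi [Pd Pop AB]]; apply/(volume_preserving_equivP _ _ vO).
have [wg w0 _] := volume_form_density vO; set w := fun x => Omega x 1%:M.
have [Psi [Sd PK detPS]] := diffeo_germ_inverse Pd; have [Sg S0 _] := Sd.
have BA := equiv_via_inverse Sg S0 PK AB.
apply: density_equiv_trans (density_equiv_sym (equiv_via_density w Sd BA)).
apply: quasi_homogeneous_density_equiv => //.
  exact: fun_germ_pullback_density.
have JS : 0 < \det ('J Psi 0).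
  have := nbhs_singleton detPS; rewrite S0 => E.
  by rewrite -(pmulr_lgt0 _ Pop) E.
by rewrite S0 mulrA -expr2 pmulr_lgt0 // exprn_even_gt0.
Qed.

(** * The reflection in the first coordinate and the final case analysis *)

Definition reflection (R : realType) r (x : 'rV[R]_r) : 'rV[R]_r :=
  \row_(k < r) if val k == 0%N then - x 0 k else x 0 k.

Lemma reflectionK (R : realType) r : involutive (@reflection R r).
Proof. by move=> x; apply/rowP => k; rewrite !mxE; case: ifP => k0; rewrite ?k0 ?opprK. Qed.

Lemma diffeo_germ_reflection C (R : realType) r : diffeo_germ C (@reflection R r).
Proof.
have Sg : mx_germ C (@reflection R r).
  move=> i k; rewrite ord1; case: (boolP (val k == 0%N)) => k0.
    by apply: fun_germ_ext (fun_germN (fun_germ_coord C R k)) => x; rewrite mxE k0.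
  by apply: fun_germ_ext (fun_germ_coord C R k) => x; rewrite mxE (negbTE k0).
have S0 : @reflection R r 0 = 0.
  by apply/rowP => k; rewrite !mxE oppr0 if_same.
by split=> //; exists (@reflection R r); split=> //; apply/near0_cubeP; exists 1 => // x _;
  rewrite reflectionK.
Qed.

Lemma det_jacobian_reflection (R : realType) r : (0 < r)%N ->
  \det ('J (@reflection R r) 0) = -1.
Proof.
case: r => // r _; have [Sg _ _] := diffeo_germ_reflection Smooth R r.+1.
have [_ ->] := nbhs_singleton (mx_germ_jacobian Sg).
have -> : (\matrix_(k, l) 'D_(delta_mx 0 k) (fun y => reflection y 0 l) (0 : 'rV[R]_r.+1)) =
    diag_mx (\row_k if val k == 0%N then -1 else 1).
  apply/matrixP => k l; rewrite !mxE.
  have D := derive_coord l (0 : 'rV[R]_r.+1) (delta_mx 0 k).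
  case: (boolP (val l == 0%N)) => l0.
    rewrite (_ : (fun y => reflection y 0 l) = - (fun y : 'rV[R]_r.+1 => y 0 l)); last first.
      by apply/funext => y; rewrite mxE l0.
    have [_ ->] := @is_deriveN _ _ _ _ _ _ _ D.
    by rewrite mxE eqxx /= eq_sym; case: eqP => [->|]; rewrite ?l0 ?mulr0n ?oppr0 ?mulr1n.
  rewrite (_ : (fun y => reflection y 0 l) = (fun y : 'rV[R]_r.+1 => y 0 l)); last first.
    by apply/funext => y; rewrite mxE (negbTE l0).
  have [_ ->] := D.
  by rewrite mxE eqxx /= eq_sym; case: eqP => [->|]; rewrite ?(negbTE l0) ?mulr0n ?mulr1n.
rewrite det_diag big_ord_recl mxE eqxx big1 ?mulr1 // => i _.
by rewrite mxE.
Qed.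

(** In the reversed case [bar A] takes the role of [A], so it needs its own coordinates and frame:
    those of [A] composed with the reflection. *)
Lemma quasi_homogeneous_bar C (R : realType) r n (A : 'rV[R]_r -> 'M[R]_n) :
  sym_quasi_homogeneous C A -> sym_quasi_homogeneous C (bar A).
Proof.
move=> [phi [lambda [delta [X [phid l0 Xg [U U0 BE]]]]]].
have Sd := diffeo_germ_reflection C R r; have [Sg S0 _] := Sd.
exists (fun x => phi (reflection x)), lambda, delta, (fun x => X (reflection x)).
split=> //; first exact: diffeo_germ_comp.
  exact: GL_germ_comp.
exists (fun x => U (reflection x)); first exact: near_comp Sg S0 U0.
move=> i j; have := BE i j; case: ifP => _ H => [p Up|t p q Up Uq pq].
  exact: H.
exact: H.
Qed.

Lemma equiv_via_bar C (R : realType) r n (A B : 'rV[R]_r -> 'M[R]_n) Phi :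
  equiv_via C A B Phi -> equiv_via C (bar A) B (fun x => reflection (Phi x)).
Proof.
move=> [X Xg BE]; exists X => //; apply: filterS BE => x ->.
by rewrite /bar -/(reflection _) reflectionK.
Qed.

(** An empty sum of weights is not positive. This excludes [r = 0], where the reflection is the
    identity and reverses nothing. *)
Lemma quasi_homogeneous_dim_gt0 C (R : realType) r n (A : 'rV[R]_r -> 'M[R]_n) :
  sym_quasi_homogeneous C A -> (0 < r)%N.
Proof. by case: r A => // A [? [l [? [? [_]]]]]; rewrite big_ord0. Qed.

Theorem proposition2p16 (C : category) (R : realType) (r n : nat)
    (Omega : dform R r) (hOmega : volume_form_germ C Omega)
    (A : 'rV[R]_r -> 'M[R]_n) (hA : sym_germ C A)
    (hqh : sym_quasi_homogeneous C A) :
  ((exists2 Phi, symmetry_group C A Phi & orientation_reversing Phi) ->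
   forall B : 'rV[R]_r -> 'M[R]_n, sym_germ C B ->
     G_equiv C A B -> volume_preserving_equiv C Omega A B)
  /\
  ((forall Phi, symmetry_group C A Phi -> orientation_preserving Phi) ->
   [/\ forall B : 'rV[R]_r -> 'M[R]_n, sym_germ C B ->
         orientation_preserving_equiv C A B ->
         volume_preserving_equiv C Omega A B,
       forall B : 'rV[R]_r -> 'M[R]_n, sym_germ C B ->
         G_equiv C A B -> ~ orientation_preserving_equiv C A B ->
         volume_preserving_equiv C Omega (bar A) B &
       ~ volume_preserving_equiv C Omega A (bar A)]).
Proof.
have r0 := quasi_homogeneous_dim_gt0 hqh.
have det_comp (Phi Psi : 'rV[R]_r -> 'rV[R]_r) : diffeo_germ C Phi -> diffeo_germ C Psi ->
    \det ('J (fun x => Psi (Phi x)) 0) = \det ('J Phi 0) * \det ('J Psi 0).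
  move=> [Pg P0 _] [Sg _ _].
  by have := nbhs_singleton (near_det_jacobian_comp Pg Sg P0); rewrite P0.
have nmul_gt0 (a b : R) : a < 0 -> b < 0 -> 0 < a * b by move=> a0; rewrite nmulr_rgt0.
have nmul1_le0 (a b : R) : a < 0 -> b = 1 -> ~ 0 < a * b.
  by move=> a0 ->; rewrite mulr1 => /(lt_trans a0); rewrite ltxx.
have refl_rev : \det ('J (@reflection R r) 0) < 0.
  by rewrite det_jacobian_reflection // ltrN10.
have Sd := diffeo_germ_reflection C R r; have [Sg S0 _] := Sd.
split=> [[] Theta [Td AA] Trev B _ [Phi Pd AB]|symA].
  apply: orientation_preserving_volume_equiv => //; have [Pg P0 _] := Pd.
  have [Ppos|Pneg|/esym Peq] := ltgtP 0 (\det ('J Phi 0)).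
  - by exists Phi.
  (* The orientation-reversing symmetry [Theta] corrects the sign of [Phi] and leaves the
     equivalence from [A] to [B] intact. *)
  - exists (fun x => Theta (Phi x)); split; first exact: diffeo_germ_comp.
      rewrite /orientation_preserving (det_comp _ _ Pd Td).
      exact: (nmul_gt0 _ _ Pneg Trev).
    exact: equiv_via_comp AB.
  - by have := diffeo_germ_det_jacobian0 Pd; rewrite Peq eqxx.
split=> [B _|B _ [Phi Pd AB] nAB|].
- exact: orientation_preserving_volume_equiv.
(* By assumption no equivalence from [A] to [B] preserves orientation, so [Phi] reverses it;
   followed by the reflection it is an orientation-preserving equivalence from [bar A] to [B]. *)
- apply: orientation_preserving_volume_equiv => //; first exact: quasi_homogeneous_bar.
  exists (fun x => reflection (Phi x)); split; [exact: diffeo_germ_comp| |exact: equiv_via_bar].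
  rewrite /orientation_preserving (det_comp _ _ Pd Sd).
  suff Pneg : \det ('J Phi 0) < 0 by exact: (nmul_gt0 _ _ Pneg refl_rev).
  rewrite lt_neqAle (diffeo_germ_det_jacobian0 Pd) /= leNgt.
  by apply/negP => Ppos; apply: nAB; exists Phi.
(* Preserving a volume form at the fixed point [0] forces the Jacobian [1] there. Preceded by the
   reflection, such a [Phi] would be a symmetry of [A] of negative Jacobian, contrary to the
   assumption. *)
- move=> [Phi [Pd Pvol Abar]]; have [Pg P0 _] := Pd.
  have detP : \det ('J Phi 0) = 1.
    have [_ w0 _] := volume_form_density hOmega.
    move/(preserves_formP hOmega Pg P0): Pvol => /nbhs_singleton; rewrite P0.
    by rewrite -[RHS]mulr1 => /(mulfI w0).
  apply: (nmul1_le0 _ _ refl_rev detP); rewrite -(det_comp _ _ Sd Pd).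
  apply: symA; split; first exact: diffeo_germ_comp.
  have [X Xg barE] := Abar; exists (fun x => X (reflection x)); first exact: GL_germ_comp.
  apply: filterS (near_comp Sg S0 barE) => x <-.
  by rewrite /bar -/(reflection _) reflectionK.
Qed.
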